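(* Let $\varphi:M^2\to\mathbb{H}^4$ be a PNMC biconservative immersion with $C=0$ (where $C$ is the integration constant attached to $\varphi$, as defined in the context), and let $\Phi=\iota\circ\varphi:M\to\mathbb{R}^5_1$. Identifying $M$ with its image, the surface $M$ can be locally (around each of its points) parametrized as $$ \Phi(u,v)=\hat{\sigma}(u)+v\,\overline{b}_1+v^2 f^{3/4}(u)\,\overline{b}_2, $$ where: (i) $f=f(u)$ (the mean curvature function) is a positive solution of the first-order ordinary differential equation $$ f'=\frac{4}{3}f\sqrt{1-9f^2-c^2f^3}>0, $$ where $c$ is a non-zero real constant; (ii) $\overline{b}_1$ and $\overline{b}_2$ are constant vectors in $\mathbb{R}^5_1$ such that $$ \langle\overline{b}_1,\overline{b}_1\rangle=1\qquad\text{and}\qquad \langle\overline{b}_2,\overline{b}_2\rangle=\langle\overline{b}_1,\overline{b}_2\rangle=0; $$ (iii) $\hat{\sigma}=\hat{\sigma}(u)$ is a curve in $\mathbb{R}^5_1$ such that $\hat{\sigma}=\iota\circ\tilde{\sigma}$, where $\tilde{\sigma}$ is a curve parametrized by arc-length which lies in a totally geodesic hypersurface $\mathbb{H}^3=\mathbb{H}^4\cap\Pi$ of $\mathbb{H}^4$, the hyperplane $\Pi\subset\mathbb{R}^5_1$ containing the origin and being orthogonal to $\overline{b}_1$. Moreover, the curvature and torsion of $\tilde{\sigma}$, as a curve in $\mathbb{H}^3$, are $$ \kappa(u)=f(u)\sqrt{1+c^2f(u)},\qquad \tau(u)=\frac{2|c|\sqrt{f(u)}}{3\left(1+c^2f(u)\right)}\sqrt{1-9f^2(u)-c^2f^3(u)},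 $$ and the curve $\hat{\sigma}$ satisfies $$ \langle\hat{\sigma}(u),\overline{b}_2\rangle=-\frac{1}{2f^{3/4}(u)}. $$
   Context: $\mathbb{R}^5_1$ is $\mathbb{R}^5$ with the bilinear form $\langle\overline{x},\overline{y}\rangle=\sum_{i=1}^4x^iy^i-x^5y^5$; orthogonality in $\mathbb{R}^5_1$ is with respect to this form. $\mathbb{H}^4=\{\overline{x}\in\mathbb{R}^5_1:\langle\overline{x},\overline{x}\rangle=-1,\ x^5>0\}$ is the hyperboloid model of hyperbolic space, and $\iota:\mathbb{H}^4\to\mathbb{R}^5_1$ is the canonical inclusion. Surfaces $M$ are connected and oriented; immersions are smooth and isometric. For an isometric immersion $\varphi:M^2\to\mathbb{H}^4$ with second fundamental form $B$, let $H=\frac12\operatorname{trace}B$ be the mean curvature vector field, $f=|H|$ the mean curvature function, $\nabla^\perp$ the normal connection. The bitension field is $\tau_2(\varphi)=-\Delta^\varphi\tau(\varphi)-\operatorname{trace}R^{\mathbb{H}^4}(\varphi_*,\tau(\varphi))\varphi_*$, with $\tau(\varphi)=2H$, $\Delta^\varphi=-\operatorname{trace}(\nabla^\varphi\nabla^\varphi-\nabla^\varphi_\nabla)$ and $R(X,Y)Z=[\nabla_X,\nabla_Y]Z-\nabla_{[X,Y]}Z$; $\varphi$ is biconservative if the tangential part $\tau_2(\varphi)^\top$ vanishes. ''PNMC biconservative immersion (surface)'' means: $\varphi$ is biconservative, $f>0$ on $M$, $\operatorname{grad}f$ is nowhere zero, $\nabla^\perp(H/|H|)=0$, and $M$ is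 completely contained in $\mathbb{H}^4$, i.e. no open subset of $M$ lies in a totally geodesic hypersurface $\mathbb{H}^3\subset\mathbb{H}^4$. Set $E_1=\operatorname{grad}f/|\operatorname{grad}f|$, $E_3=H/f$, and let $\{E_1,E_2\}$, $\{E_3,E_4\}$ be positively oriented orthonormal frame fields of the tangent and the normal bundle of $\varphi$. With this notation, biconservativity is equivalent to $A_3(\operatorname{grad}f)=-f\operatorname{grad}f$, where $A_3$ is the shape operator of $E_3$. Constants attached to $\varphi$: it is known that $E_2f=0$ and that the shape operator of $E_4$ is $A_4=\operatorname{diag}(cf^{3/2},-cf^{3/2})$ with respect to $\{E_1,E_2\}$, for a non-zero real constant $c$; moreover there is a real constant $C$ (integration constant) such that $E_1f=\frac43f\sqrt{1+9Cf^{3/2}-9f^2-c^2f^3}>0$ on $M$. For a unit speed curve in a Riemannian $3$-manifold, curvature and torsion are its first and second Frenet curvatures, the torsion here being taken non-negative (i.e. up to the choice of orientation). *)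

(* Defs.v *)
From HB Require Import structures.
From mathcomp Require Import all_boot all_order all_algebra.
From mathcomp Require Import all_classical all_reals all_analysis.

Set Implicit Arguments.
Unset Strict Implicit.
Unset Printing Implicit Defensive.

Import Order.TTheory GRing.Theory Num.Theory.
Import numFieldNormedType.Exports.

Local Open Scope classical_set_scope.
Local Open Scope ring_scope.

Section Smoothness.
Context {R : realType} {V : normedModType R}.

(* Class C^k on an open set A. *)
Fixpoint class_C (k : nat) (W : normedModType R) (A : set V) (F : V -> W)
    : Prop :=
  match k with
  | 0 => forall x, A x -> {for x, continuous F}
  | k'.+1 => (forall x, A x -> differentiable F x) /\
             (forall v : V, class_C k' A (fun x => 'D_v F x))
  end.

Definition smooth (W : normedModType R) (A : set V) (F : V -> W) : Prop :=
  forall k, class_C k A F.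

End Smoothness.

Section Surfaces.
Context {R : realType} {M : topologicalType}.

(* [cinv] is only meaningful on the coordinate domain, i.e. on [coords]. *)
Record chart := Chart {
  dom : set M;
  cmap : M -> 'rV[R]_2;
  cinv : 'rV[R]_2 -> M }.

Definition coords (a : chart) : set 'rV[R]_2 := cmap a @` dom a.

Definition is_chart (a : chart) : Prop :=
  [/\ open (dom a), open (coords a),
      (forall p, dom a p -> cinv a (cmap a p) = p),
      (forall p, dom a p -> {for p, continuous (cmap a)}) &
      (forall x, coords a x -> {for x, continuous (cinv a)})].

Definition overlap (a b : chart) : set 'rV[R]_2 :=
  cmap a @` (dom a `&` dom b).

Definition transition (a b : chart) : 'rV[R]_2 -> 'rV[R]_2 :=
  cmap b \o cinv a.

Definition oriented_surface (A : set chart) : Prop :=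
  [/\ hausdorff_space M, @second_countable M, connected [set: M] &
      [/\ (forall a, A a -> is_chart a),
          (forall p, exists2 a, A a & dom a p) &
          (forall a b, A a -> A b ->
             smooth (overlap a b) (transition a b) /\
             (forall x, overlap a b x ->
                0 < \det (jacobian (transition a b) x)))]].

(* [b] is a chart of the smooth structure defined by [A]; equivalently,
   [cinv b] is a local parametrization of the surface. *)
Definition smooth_chart (A : set chart) (b : chart) : Prop :=
  is_chart b /\
  (forall a, A a -> smooth (overlap a b) (transition a b) /\
                    smooth (overlap b a) (transition b a)).

End Surfaces.
Arguments chart R M : clear implicits.

Section Minkowski.
Context {R : realType}.
Implicit Types (p n w x y z : 'rV[R]_5) (X Y Z : 'rV[R]_5 -> 'rV[R]_5).

Definition mink x y : R :=
  \sum_(i < 4) x 0 (lift ord_max i) * y 0 (lift ord_max i)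
  - x 0 ord_max * y 0 ord_max.

Definition mnorm x : R := Num.sqrt (mink x x).

Definition H4 : set 'rV[R]_5 :=
  [set x | mink x x = -1 /\ 0 < x 0 ord_max].

(* The totally geodesic hypersurfaces of H4 are its intersections with the
   hyperplanes through the origin which have a spacelike normal n. *)
Definition H3 n : set 'rV[R]_5 := H4 `&` [set x | mink x n = 0].

(* Orthogonal projection onto the tangent space of H4 at p (as <p, p> = -1). *)
Definition projH4 p w := w + mink w p *: p.

(* Orthogonal projection onto the tangent space of H3 n at p, for <n, n> = 1. *)
Definition projH3 n p w := w + mink w p *: p - mink w n *: n.

(* The Levi-Civita connection of H4 is the tangential part of the flat
   connection; along H4 it is applied to fields tangent to H4. *)
Definition covH4 X Y : 'rV[R]_5 -> 'rV[R]_5 :=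
  fun p => projH4 p ('D_(X p) Y p).

Definition lie_bracket X Y : 'rV[R]_5 -> 'rV[R]_5 :=
  fun p => 'D_(X p) Y p - 'D_(Y p) X p.

Definition curvature_field X Y Z : 'rV[R]_5 -> 'rV[R]_5 :=
  fun p => covH4 X (covH4 Y Z) p - covH4 Y (covH4 X Z) p
           - covH4 (lie_bracket X Y) Z p.

(* The curvature tensor R(x,y)z of H4 at p: the tangent vectors x, y, z at p
   are extended to the fields q |-> projH4 q x, etc., tangent to H4. *)
Definition curvH4 p x y z :=
  curvature_field (projH4^~ x) (projH4^~ y) (projH4^~ z) p.

End Minkowski.

(* Submanifold geometry of an immersion Phi of an open set of R^2 into H4.
   The metric of the surface is the one induced by Phi (immersions are
   isometric), with matrix [gram] and Levi-Civita connection [christoffel].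
   Tangent vectors of the surface are given by their coordinates in 'rV_2,
   vector fields along Phi are functions from 'rV_2 to 'rV_5. *)
Section LocalGeometry.
Context {R : realType}.
Variable Phi : 'rV[R]_2 -> 'rV[R]_5.
Implicit Types (i j k l : 'I_2) (x X Y : 'rV[R]_2) (w eta : 'rV[R]_5).
Implicit Types (V : 'rV[R]_2 -> 'rV[R]_5) (h : 'rV[R]_2 -> R).

Definition basis_vec i : 'rV[R]_2 := delta_mx 0 i.

Definition dPhi X x : 'rV[R]_5 := 'D_X Phi x.

Definition gram x : 'M[R]_2 :=
  \matrix_(i, j) mink (dPhi (basis_vec i) x) (dPhi (basis_vec j) x).

Definition gram_inv x : 'M[R]_2 := invmx (gram x).

Definition dgram i j k x : R := 'D_(basis_vec i) (fun y => gram y j k) x.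

(* Gamma^k_{ij} *)
Definition christoffel i j k x : R :=
  2^-1 * \sum_l gram_inv x k l * (dgram i j l x + dgram j i l x - dgram l i j x).

Definition tangent_part x w : 'rV[R]_5 :=
  \sum_i \sum_j (gram_inv x i j * mink w (dPhi (basis_vec i) x))
                *: dPhi (basis_vec j) x.

Definition normal_part x w : 'rV[R]_5 := w - tangent_part x w.

(* Pull-back connection of H4 along Phi. *)
Definition nabla_phi X V x : 'rV[R]_5 := projH4 (Phi x) ('D_X V x).

(* B(d_i, d_j), by the Gauss formula. *)
Definition second_form_basis i j x : 'rV[R]_5 :=
  nabla_phi (basis_vec i) (dPhi (basis_vec j)) x
  - \sum_k christoffel i j k x *: dPhi (basis_vec k) x.

Definition second_form X Y x : 'rV[R]_5 :=
  \sum_i \sum_j (X 0 i * Y 0 j) *: second_form_basis i j x.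

Definition mean_vec x : 'rV[R]_5 :=
  2^-1 *: \sum_i \sum_j gram_inv x i j *: second_form_basis i j x.

(* Coordinates of A_eta X, where <A_eta X, Y> = <B(X, Y), eta>. *)
Definition shape x eta X : 'rV[R]_2 :=
  (\row_k mink (second_form X (basis_vec k) x) eta) *m gram_inv x.

Definition tension x : 'rV[R]_5 := 2 *: mean_vec x.

Definition rough_laplacian V x : 'rV[R]_5 :=
  - \sum_i \sum_j gram_inv x i j *:
      (nabla_phi (basis_vec i) (nabla_phi (basis_vec j) V) x
       - \sum_k christoffel i j k x *: nabla_phi (basis_vec k) V x).

Definition bitension x : 'rV[R]_5 :=
  - rough_laplacian tension x
  - \sum_i \sum_j gram_inv x i j *:
      curvH4 (Phi x) (dPhi (basis_vec i) x) (tension x) (dPhi (basis_vec j) x).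

Definition gradient h x : 'rV[R]_2 :=
  (\row_i 'D_(basis_vec i) h x) *m gram_inv x.

(* In the remaining definitions h is the mean curvature function in the
   coordinates of Phi. *)
Definition frame1 h x : 'rV[R]_2 :=
  (mnorm (dPhi (gradient h x) x))^-1 *: gradient h x.

Definition frame3 h x : 'rV[R]_5 := (h x)^-1 *: mean_vec x.

(* {E1, E2} is a positively oriented orthonormal basis of the tangent plane. *)
Definition is_frame2 h x (E2 : 'rV[R]_2) : Prop :=
  [/\ mink (dPhi E2 x) (dPhi E2 x) = 1,
      mink (dPhi (frame1 h x) x) (dPhi E2 x) = 0 &
      0 < \det (col_mx (frame1 h x) E2 : 'M[R]_2)].

(* {E3, E4} is a positively oriented orthonormal basis of the normal plane,
   i.e. {E1, E2, E3, E4} is a positively oriented orthonormal basis of the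
   tangent space of H4.  A basis {X1, ..., X4} of the tangent space at p is
   positive when {X1, ..., X4, p} is a positive basis of R^5. *)
Definition is_frame4 h x (E2 : 'rV[R]_2) (E4 : 'rV[R]_5) : Prop :=
  [/\ mink E4 E4 = 1, mink E4 (frame3 h x) = 0, mink E4 (Phi x) = 0,
      (forall i, mink E4 (dPhi (basis_vec i) x) = 0) &
      0 < \det (\matrix_(i < 5)
                  nth 0 [:: dPhi (frame1 h x) x; dPhi E2 x; frame3 h x; E4;
                            Phi x] i)].

End LocalGeometry.

Section Immersions.
Context {R : realType} {M : topologicalType}.
Variables (A : set (chart R M)) (phi : M -> 'rV[R]_5).

Definition immersion_H4 : Prop :=
  (forall p, H4 (phi p)) /\
  (forall a, A a ->
     smooth (coords a) (phi \o cinv a) /\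
     (forall x, coords a x -> row_free (jacobian (phi \o cinv a) x))).

(* f is the function |H| on M; its value does not depend on the chart. *)
Definition is_mean_curvature (f : M -> R) : Prop :=
  forall a x, A a -> coords a x ->
    f (cinv a x) = mnorm (mean_vec (phi \o cinv a) x).

Definition biconservative : Prop :=
  forall a x, A a -> coords a x ->
    tangent_part (phi \o cinv a) x (bitension (phi \o cinv a) x) = 0.

(* The normal connection is the normal part of the pull-back connection. *)
Definition parallel_mean_direction (f : M -> R) : Prop :=
  forall a x i, A a -> coords a x ->
    normal_part (phi \o cinv a) x
      (nabla_phi (phi \o cinv a) (basis_vec i)
         (frame3 (phi \o cinv a) (f \o cinv a)) x) = 0.

Definition completely_contained : Prop :=
  forall (U : set M) (n : 'rV[R]_5), open U -> U !=set0 -> 0 < mink n n ->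
    ~ (phi @` U `<=` H3 n).

Definition PNMC_biconservative (f : M -> R) : Prop :=
  [/\ biconservative,
      (forall p, 0 < f p),
      (forall a x, A a -> coords a x ->
         gradient (phi \o cinv a) (f \o cinv a) x != 0),
      parallel_mean_direction f &
      completely_contained].

Definition attached_constants (f : M -> R) (c C : R) : Prop :=
  c != 0 /\
  forall a x, A a -> coords a x ->
    let Phi := phi \o cinv a in
    let h := f \o cinv a in
    let E1 := frame1 Phi h x in
    (forall E2 E4, is_frame2 Phi h x E2 -> is_frame4 Phi h x E2 E4 ->
       shape Phi x E4 E1 = (c * h x `^ (3 / 2)) *: E1 /\
       shape Phi x E4 E2 = - (c * h x `^ (3 / 2)) *: E2) /\
    'D_E1 h x = 4 / 3 * h x *
      Num.sqrt (1 + 9 * C * h x `^ (3 / 2) - 9 * h x ^+ 2 - c ^+ 2 * h x ^+ 3) /\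
    0 < 'D_E1 h x.

End Immersions.

Section Curves.
Context {R : realType}.

(* Covariant derivative in H3 n of a vector field V along the curve sigma. *)
Definition cov_along (n : 'rV[R]_5) (sigma V : R -> 'rV[R]_5) (u : R) :=
  projH3 n (sigma u) (derive1 V u).

(* kappa and tau are the curvature and the torsion of the unit speed curve
   sigma of H3 n; {T, N, B} is its Frenet frame, and choosing the sign of B
   makes tau non-negative. *)
Definition frenet_curvatures (n : 'rV[R]_5) (I : set R)
    (sigma : R -> 'rV[R]_5) (kappa tau : R -> R) : Prop :=
  exists T N B : R -> 'rV[R]_5,
    forall u, I u ->
      [/\ T u = derive1 sigma u,
          [/\ mink (T u) (T u) = 1, mink (N u) (N u) = 1 &
              mink (B u) (B u) = 1],
          [/\ mink (T u) (N u) = 0, mink (T u) (B u) = 0 &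
              mink (N u) (B u) = 0],
          (forall V, V = T \/ V = N \/ V = B ->
             [/\ mink (V u) (sigma u) = 0, mink (V u) n = 0 &
                 derivable V u 1]) &
          [/\ 0 < kappa u, 0 <= tau u,
              cov_along n sigma T u = kappa u *: N u,
              cov_along n sigma N u = - kappa u *: T u + tau u *: B u &
              cov_along n sigma B u = - tau u *: N u]].

Definition pt (u v : R) : 'rV[R]_2 := \row_i nth 0 [:: u; v] i.

End Curves.

(* Main.v *)
(* In terms of E1 = grad f / |grad f|, E2, E3 = H / f and the fourth frame field,
   biconservativity, the Codazzi equation and the parallelism of E3 determine the
   second fundamental form and the connection as functions of f.  For C = 0 this
   makes E2 constant along E1, and W = D_{E2} E2 a null field of R^5_1 with
   D_{E2} W = 0 and D_{E1} W = sqrt(1 - 9 f^2 - c^2 f^3) W.  Hence W = 2 f^(3/4) b2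
   with b2 a constant null vector; as E2 f = 0, the integral curves of E2 are the
   parabolas v |-> sigma + v b1 + v^2 f^(3/4) b2.  The coordinate v is obtained
   from the linear function E2 |-> <E2, Phi(x0)>, and u by integrating df / f'.
   The curve v = 0 is an integral curve of E1 along which E2 = b1 is constant, so
   it lies in the hyperplane orthogonal to b1, and the structure equations of the
   frame along it are its Frenet equations. *)

Require Import Defs.
From HB Require Import structures.
From mathcomp Require Import all_boot all_order all_algebra.
From mathcomp Require Import all_classical all_reals all_analysis.
From mathcomp Require Import ring lra.

Set Implicit Arguments.
Unset Strict Implicit.
Unset Printing Implicit Defensive.

Import Order.TTheory GRing.Theory Num.Theory.
Import numFieldNormedType.Exports.

Local Open Scope classical_set_scope.
Local Open Scope ring_scope.

(** * Smooth maps and directional derivatives *)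

(** With s the radical in f' = (4/3) f s, one finds <W, W> = s^2 + 9 f^2 + c^2 f^3 - 1, so W is null
    exactly because s^2 contains no term in [C]. The exponent 3/4 is the power of f that grows along
    E1 at the same rate s as W. The fourth frame field is delicate, since E4 is given pointwise and
    with an orientation; the proof works instead with c f^(3/2) E4 = D_{E1} E1 + f E3 - Phi, which
    is smooth by construction. The fields E1 and E2 do not commute, [E1, E2] = s E2, so they are not
    coordinate fields; the coordinate field of u is E1 + s v E2, which agrees with E1 on v = 0. That
    (u, v) is a chart of the given smooth structure rests on an inverse function theorem with smooth
    inverse; the fields dual to du and dv are known in advance, which makes the derivative of the
    inverse explicit. Curvature and torsion are read off in the plane of E3 and E4 along v = 0: the
    vector c f^(3/2) E4 - f E3 has length f sqrt(1 + c^2 f), and the torsion is the rate at which it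
    turns in that plane. *)

Section DirectionalDerivative.
Context {R : realType}.
Implicit Types V W U : normedModType R.

Lemma derive_comp V U W (F : V -> U) (G : U -> W) (x v : V) :
  differentiable F x -> differentiable G (F x) ->
  'D_v (G \o F) x = 'D_('D_v F x) G (F x).
Proof.
move=> dF dG; rewrite deriveE; last exact: differentiable_comp.
by rewrite diff_comp //= deriveE // [in RHS]deriveE.
Qed.

Section Bilinear.
Variables (V U1 U2 W : normedModType R) (B : {bilinear U1 -> U2 -> W}).
Hypothesis Bcont : continuous (fun p : U1 * U2 => B p.1 p.2).
Variables (F : V -> U1) (G : V -> U2) (x : V).
Hypotheses (dF : differentiable F x) (dG : differentiable G x).

Let dFG : differentiable (fun y => (F y, G y)) x.
Proof. exact: differentiable_pair. Qed.

Lemma differentiable_bilin_comp : differentiable (fun y => B (F y) (G y)) x.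
Proof.
exact: (differentiable_comp dFG (differentiable_bilin (F x, G x) Bcont)).
Qed.

(** A single Leibniz rule for continuous bilinear maps, from which the rules for scaling, products
    and the Minkowski form all follow. *)
Lemma derive_bilin v : 'D_v (fun y => B (F y) (G y)) x =
  B ('D_v F x) (G x) + B (F x) ('D_v G x).
Proof.
rewrite deriveE; last exact: differentiable_bilin_comp.
rewrite (diff_comp dFG (differentiable_bilin (F x, G x) Bcont)) /=.
rewrite diff_bilin //= diff_pair //= deriveE // [in RHS]deriveE //.
by rewrite addrC.
Qed.

End Bilinear.

End DirectionalDerivative.

(** * Maps of class C^k and their closure properties *)

Section ClassC.
Context {R : realType} {V : normedModType R}.
Implicit Types (A B : set V) (k : nat).

Lemma class_CS (W : normedModType R) k A (F : V -> W) :
  class_C k.+1 A F -> class_C k A F.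
Proof.
elim: k F => [|k IH] F /= [dF DF].
  by move=> x Ax; exact/differentiable_continuous/dF.
by split=> // v; exact: IH (DF v).
Qed.

Lemma class_C_subset (W : normedModType R) k A B (F : V -> W) :
  A `<=` B -> class_C k B F -> class_C k A F.
Proof.
move=> AB; elim: k F => [|k IH] F /=; first by move=> cF x /AB /cF.
by move=> [dF DF]; split=> [x /AB /dF //|v]; exact: IH.
Qed.

(** The difference [G - F] vanishes near [x], hence has zero differential, and [G] is the sum of [F]
    and this difference. Being of class C^k on an open set thereby depends only on the values on
    that set. *)
Lemma near_eq_differentiable (W : normedModType R) (F G : V -> W) (x : V) :
  (\near x, F x = G x) -> differentiable F x -> differentiable G x.
Proof.
move=> FG dF.
suff dD : differentiable (G - F) x.
  by rewrite -(subrK F G); exact: differentiableD.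
have FG0 : \forall h \near 0, F (h + x) = G (h + x).
    move: FG; rewrite (near_shift 0 x); apply: filterS => y /=.
    by rewrite subr0.
  have D0 : (G - F) \o shift x = cst ((G - F) x) + (\0 : V -> W) +o_ 0 id.
  apply/eqaddoP => _/posnumP[e]; near=> h.
  have GFh : F (h + x) = G (h + x) by near: h.
  have GFx : F x = G x by exact: nbhs_singleton FG.
  by rewrite /= !fctE GFh GFx !subrr addr0 subrr normr0 mulr_ge0.
have dE : 'd (G - F) x = \0 :> (V -> W).
  by apply: diff_unique D0; exact: cst_continuous.
by apply/diff_locallyP; rewrite dE; split; [exact: cst_continuous|].
Unshelve. all: by end_near. Qed.

Lemma class_C_eq (W : normedModType R) k A (F G : V -> W) : open A ->
  (forall x, A x -> F x = G x) -> class_C k A F -> class_C k A G.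
Proof.
move=> oA; have nA x : A x -> \near x, A x by move=> ?; exact: open_nbhs_nbhs.
elim: k F G => [|k IH] F G FG /=.
  move=> cF x Ax; have := cF x Ax.
  rewrite /prop_for /continuous_at FG //; apply: cvg_trans; apply: near_eq_cvg.
  by near=> y; rewrite FG //; near: y; exact: nA.
have nFG x : A x -> \near x, F x = G x.
  by move=> /nA; apply: filterS => y /FG.
move=> [dF DF]; split=> [x Ax|v].
  exact: near_eq_differentiable (nFG _ Ax) (dF x Ax).
by apply: IH (DF v) => x Ax; exact: near_eq_derive (nFG _ Ax).
Unshelve. all: by end_near. Qed.

Lemma class_C_cst (W : normedModType R) k A (w : W) : class_C k A (fun=> w).
Proof.
elim: k w => [|k IH] w /=; first by move=> x _; exact: cst_continuous.
split=> [x _|v]; first exact: differentiable_cst.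
have -> : (fun x : V => 'D_v (fun=> w) x) = fun=> 0; last exact: IH.
by apply/funext => x; rewrite -[fun=> w]/(cst w) derive_cst.
Qed.

Lemma class_CD (W : normedModType R) k A (F G : V -> W) : open A ->
  class_C k A F -> class_C k A G -> class_C k A (fun x => F x + G x).
Proof.
move=> oA; elim: k F G => [|k IH] F G /=.
  by move=> cF cG x Ax; apply: cvgD; [exact: cF|exact: cG].
move=> [dF DF] [dG DG]; split=> [x Ax|v].
  by apply: differentiableD; [exact: dF|exact: dG].
apply: (class_C_eq oA _ (IH _ _ (DF v) (DG v))) => x Ax.
by rewrite deriveD //; apply: diff_derivable; [exact: dF|exact: dG].
Qed.

Lemma class_C_linear (U W : normedModType R) (L : {linear U -> W}) k A
    (F : V -> U) : continuous L -> open A ->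
  class_C k A F -> class_C k A (fun x => L (F x)).
Proof.
move=> cL oA; have dL y := linear_differentiable y cL.
elim: k F => [|k IH] F /=.
  by move=> cF x Ax; apply: continuous_comp; [exact: cF|exact: cL].
move=> [dF DF]; split=> [x Ax|v].
  by apply: (differentiable_comp (dF x Ax)); exact: dL.
apply: (class_C_eq oA _ (IH _ (DF v))) => x Ax.
by rewrite (derive_comp v (dF x Ax) (dL (F x))) [RHS](deriveE _ (dL _)) diff_lin.

Qed.

Lemma class_C_bilin (U1 U2 W : normedModType R) (B : {bilinear U1 -> U2 -> W})
    k A (F : V -> U1) (G : V -> U2) :
  continuous (fun p : U1 * U2 => B p.1 p.2) -> open A ->
  class_C k A F -> class_C k A G -> class_C k A (fun x => B (F x) (G x)).
Proof.
move=> cB oA; elim: k F G => [|k IH] F G.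
  move=> cF cG x Ax.
  apply: (@continuous_comp V (U1 * U2)%type W (fun y => (F y, G y))
    (fun p => B p.1 p.2)); last exact: cB.
  by apply: cvg_pair; [exact: cF|exact: cG].
move=> cF cG; have [dF DF] := cF; have [dG DG] := cG; split=> [x Ax|v].
  by apply: differentiable_bilin_comp => //; [exact: dF|exact: dG].
apply: (class_C_eq oA _ (class_CD oA (IH _ _ (DF v) (class_CS cG))
                                     (IH _ _ (class_CS cF) (DG v)))) => x Ax.
by rewrite derive_bilin //; [exact: dF|exact: dG].
Qed.

End ClassC.

Section ScaleBilinear.
Context {R : realType} {W : normedModType R}.

Lemma scale_is_bilinear : bilinear_for
  (GRing.Scale.Law.clone _ _ *:%R _) (GRing.Scale.Law.clone _ _ *:%R _)
  (@GRing.scale R W).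
Proof.
split=> [w|a] b x y /=; first by rewrite scalerDl scalerA.
by rewrite scalerDr !scalerA mulrC.
Qed.
HB.instance Definition _ :=
  bilinear_isBilinear.Build R R W W _ _ (@GRing.scale R W) scale_is_bilinear.

End ScaleBilinear.

Section Coordinates.
Context {R : realType} {n : nat}.

Definition row_coord (j : 'I_n) (x : 'rV[R]_n) : R := x 0 j.

Lemma row_coord_linear j : linear (row_coord j).
Proof. by move=> a x y; rewrite /row_coord !mxE. Qed.
HB.instance Definition _ j :=
  GRing.isLinear.Build R 'rV[R]_n R *:%R (row_coord j) (row_coord_linear j).

Lemma row_coord_continuous j : continuous (row_coord j).
Proof. exact: coord_continuous. Qed.

End Coordinates.

Section SmoothComposition.
Context {R : realType} {V : normedModType R}.
Implicit Types (A : set V) (k : nat).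

Lemma class_C_sum (W : normedModType R) (I : Type) (r : seq I) k A
    (F : I -> V -> W) : open A ->
  (forall i, class_C k A (F i)) -> class_C k A (fun x => \sum_(i <- r) F i x).
Proof.
move=> oA cF; elim: r => [|i r IH].
  by apply: (class_C_eq oA _ (class_C_cst k A 0)) => x _; rewrite big_nil.
by apply: (class_C_eq oA _ (class_CD oA (cF i) IH)) => x _; rewrite big_cons.
Qed.

Section Composition.
Variables (U W : normedModType R) (n : nat) (e : 'I_n -> U).
Variable l : 'I_n -> {linear U -> R}.
Hypothesis lcont : forall i, continuous (l i).
Hypothesis decomp : forall w, w = \sum_i l i w *: e i.

Lemma derive_decomp (G : U -> W) y w : differentiable G y ->
  'D_w G y = \sum_i l i w *: 'D_(e i) G y.
Proof.
move=> dG; rewrite deriveE // {1}(decomp w) linear_sum.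
by apply: eq_bigr => i _; rewrite linearZ /= deriveE.
Qed.

(** The chain rule differentiates [G] in the direction ['D_v F x], which moves with [x], while
    [class_C] only controls fixed directions. Expanding that direction in the finite basis [e] turns
    the derivative into a sum of products of maps already known to be of class C^k, and the
    induction goes through. *)
Lemma class_C_comp k A (B : set U) (F : V -> U) (G : U -> W) : open A ->
  (forall x, A x -> B (F x)) -> class_C k A F -> class_C k B G ->
  class_C k A (G \o F).
Proof.
move=> oA FAB; elim: k G => [|k IH] G cF.
  move=> cG x Ax; apply: continuous_comp; first exact: cF.
  by apply: cG; exact: FAB.
move=> [dG DG]; have [dF DF] := cF; split=> [x Ax|v].
  by apply: differentiable_comp; [exact: dF|apply: dG; exact: FAB].
have cDi i : class_C k A (fun x => l i ('D_v F x) *: 'D_(e i) G (F x)).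
  apply: class_C_bilin => //; first exact: scale_continuous.
    by apply: (class_C_linear (L := l i) (@lcont i) oA); exact: DF.
  by apply: (IH ('D_(e i) G)); [exact: class_CS|exact: DG].
apply: (class_C_eq oA _ (class_C_sum (index_enum 'I_n) oA cDi)) => x Ax.
rewrite derive_comp; [|exact: dF|exact/dG/FAB].
by rewrite derive_decomp //; exact/dG/FAB.
Qed.

End Composition.

Lemma row_decomp n (w : 'rV[R]_n) :
  w = \sum_i (row_coord i : {linear 'rV[R]_n -> R}) w *: delta_mx 0 i.
Proof. exact: row_sum_delta. Qed.

Lemma scalar_decomp (w : R) :
  w = \sum_(i < 1) (idfun : {linear R -> R}) w *: 1.
Proof. by rewrite big_ord1 [RHS]mulr1. Qed.

Implicit Types W U : normedModType R.

Lemma smooth_eq W A (F G : V -> W) : open A ->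
  (forall x, A x -> F x = G x) -> smooth A F -> smooth A G.
Proof. by move=> oA FG sF k; exact: class_C_eq (sF k). Qed.

Lemma smooth_subset W A B (F : V -> W) : A `<=` B -> smooth B F -> smooth A F.
Proof. by move=> AB sF k; exact: class_C_subset (sF k). Qed.

Lemma smooth_differentiable W A (F : V -> W) x :
  smooth A F -> A x -> differentiable F x.
Proof. by move=> sF; have [dF _] := sF 1%N; exact: dF. Qed.

Lemma smooth_continuous W A (F : V -> W) x :
  smooth A F -> A x -> {for x, continuous F}.
Proof. by move=> sF; exact: (sF 0%N). Qed.

Lemma smooth_derive W A (F : V -> W) v : smooth A F -> smooth A ('D_v F).
Proof. by move=> sF k; have [_ H] := sF k.+1; exact: H. Qed.

Lemma smooth_cst W A (w : W) : smooth A (fun=> w).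
Proof. by move=> k; exact: class_C_cst. Qed.

Lemma smoothD W A (F G : V -> W) : open A ->
  smooth A F -> smooth A G -> smooth A (fun x => F x + G x).
Proof. by move=> oA sF sG k; exact: class_CD. Qed.

Lemma smooth_sum W (I : Type) (r : seq I) A (F : I -> V -> W) : open A ->
  (forall i, smooth A (F i)) -> smooth A (fun x => \sum_(i <- r) F i x).
Proof. by move=> oA sF k; apply: class_C_sum => // i; exact: sF. Qed.

Lemma smoothZ W A (F : V -> R) (G : V -> W) : open A ->
  smooth A F -> smooth A G -> smooth A (fun x => F x *: G x).
Proof.
by move=> oA sF sG k; apply: class_C_bilin => //; exact: scale_continuous.
Qed.

Lemma smoothM A (F G : V -> R) : open A ->
  smooth A F -> smooth A G -> smooth A (fun x => F x * G x).
Proof. exact: smoothZ. Qed.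

Lemma smoothN W A (F : V -> W) : open A ->
  smooth A F -> smooth A (fun x => - F x).
Proof.
move=> oA sF; apply: (smooth_eq oA _ (smoothZ oA (smooth_cst A (-1 : R)) sF)) => x _.
by rewrite scaleN1r.
Qed.

Lemma smoothB W A (F G : V -> W) : open A ->
  smooth A F -> smooth A G -> smooth A (fun x => F x - G x).
Proof. by move=> oA sF sG; apply: smoothD => //; exact: smoothN. Qed.

Lemma smoothX A (F : V -> R) n : open A ->
  smooth A F -> smooth A (fun x => F x ^+ n).
Proof.
move=> oA sF; elim: n => [|n IH].
  by apply: (smooth_eq oA _ (smooth_cst A (1 : R))) => x _; rewrite expr0.
by apply: (smooth_eq oA _ (smoothM oA sF IH)) => x _; rewrite exprS.
Qed.

Lemma smooth_coord n A (F : V -> 'rV[R]_n) j : open A ->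
  smooth A F -> smooth A (fun x => F x 0 j).
Proof.
move=> oA sF k.
by apply: (class_C_linear (L := row_coord j)) => //; exact: row_coord_continuous.
Qed.

Lemma smooth_row n A (F : 'I_n -> V -> R) : open A ->
  (forall j, smooth A (F j)) -> smooth A (fun x => \row_j F j x).
Proof.
move=> oA sF.
apply: (smooth_eq oA _ (smooth_sum (index_enum 'I_n) oA
  (fun j => smoothZ oA (sF j) (smooth_cst A (delta_mx 0 j))))) => x _.
by rewrite [RHS]row_sum_delta; apply: eq_bigr => j _; rewrite mxE.
Qed.

Lemma smooth_comp_row n W A (B : set 'rV[R]_n) (F : V -> 'rV[R]_n) G :
  open A -> (forall x, A x -> B (F x)) -> smooth A F -> smooth B G ->
  smooth A (G \o F : V -> W).
Proof.
move=> oA FAB sF sG k.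
exact: (class_C_comp (l := fun i => row_coord i) (@row_coord_continuous R n)
  (@row_decomp n) oA FAB (sF k) (sG k)).
Qed.

Lemma smooth_comp_real W A (B : set R) (F : V -> R) G :
  open A -> (forall x, A x -> B (F x)) -> smooth A F -> smooth B G ->
  smooth A (G \o F : V -> W).
Proof.
move=> oA FAB sF sG k.
have id_cont (i : 'I_1) : continuous (idfun : {linear R -> R}) by move=> x.
exact: (class_C_comp (l := fun=> idfun) id_cont scalar_decomp oA FAB
  (sF k) (sG k)).
Qed.

End SmoothComposition.

Section Curves.
Context {R : realType}.
Implicit Types V W : normedModType R.

Lemma is_derive_curve V W (F : V -> W) (g : R -> V) (dg : V) (u : R) :
  differentiable F (g u) -> is_derive u 1 g dg ->
  is_derive u 1 (F \o g) ('D_dg F (g u)).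
Proof.
move=> dF [/derivable1_diffP dgu <-]; split.
  exact/derivable1_diffP/differentiable_comp.
by rewrite derive_comp.
Qed.

Lemma is_derive_line V (x v : V) (u : R) :
  is_derive u 1 (fun s : R => x + s *: v) v.
Proof.
have dl : is_derive u 1 (fun s : R => s *: v) v.
  have /derivable1_diffP dv : differentiable (fun s : R => s *: v) u by [].
  by split=> //; rewrite deriveE // diff_val scale1r.
have := is_deriveD (is_derive_cst x u (1 : R)) dl.
by rewrite add0r.
Qed.

Lemma is_derive_on_line V W (F : V -> W) (x v : V) (u : R) :
  differentiable F (x + u *: v) ->
  is_derive u 1 (fun s : R => F (x + s *: v)) ('D_v F (x + u *: v)).
Proof. by move=> dF; exact: (is_derive_curve dF (is_derive_line x v u)). Qed.

Lemma line_MVT V (F : V -> R) (x v : V) (h : R) : 0 < h ->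
  (forall s, 0 <= s <= h -> differentiable F (x + s *: v)) ->
  exists2 s, 0 < s < h & F (x + h *: v) - F x = h * 'D_v F (x + s *: v).
Proof.
move=> h0 dF.
have dl s : 0 <= s <= h ->
    is_derive s 1 (fun s : R => F (x + s *: v)) ('D_v F (x + s *: v)).
  by move=> sh; exact/is_derive_on_line/dF.
have [|||s] := @MVT R (fun s : R => F (x + s *: v)) (fun s => 'D_v F (x + s *: v)) 0 h.
- by [].
- by move=> s /[!in_itv]/= /andP[s0 sh]; apply: dl; rewrite !ltW.
- apply: derivable_within_continuous => s /[!in_itv]/= sh.
  by have [] := dl s sh.
by rewrite in_itv /= subr0 scale0r addr0 mulrC => sh ->; exists s.
Qed.

End Curves.

(** * Symmetry of second derivatives *)

Section Schwarz.
Local Opaque derive.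
Context {R : realType} {V : normedModType R}.
Implicit Type A : set V.

(** The mean value theorem is applied in direction [v] to the increment [G] of [F] along [h *: w],
    then in direction [w] to ['D_v F]. The second difference obtained in this way is symmetric in
    [v] and [w]. *)
Let mixed_increment A (F : V -> R) x v w r h : 0 < h -> smooth A F ->
  ball x r `<=` A -> h * (`|v| + `|w|) < r ->
  exists2 y, ball x r y &
    F (x + h *: v + h *: w) - F (x + h *: v) - (F (x + h *: w) - F x) =
    h ^+ 2 * 'D_w ('D_v F) y.
Proof.
move=> h0 sF rA hr.
have in_ball s t : 0 <= s <= h -> 0 <= t <= h -> ball x r (x + s *: v + t *: w).
  move=> /andP[s0 sh] /andP[t0 th].
  rewrite -ball_normE /ball_ /= opprD addrA opprD addNKr -opprD normrN.
  apply: le_lt_trans hr; rewrite (le_trans (ler_normD _ _))// mulrDr.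
  by rewrite !normrZ !ger0_norm // lerD // ler_wpM2r.
have h0h : 0 <= h <= h by rewrite lexx ltW.
have i0h : 0 <= (0 : R) <= h by rewrite lexx ltW.
pose G y := F (y + h *: w) - F y.
have dF y : ball x r y -> differentiable F y.
  by move=> /rA; exact: smooth_differentiable.
have dshift y : differentiable (fun z : V => z + h *: w) y.
  by apply: differentiableD.
have dG s : 0 <= s <= h -> differentiable G (x + s *: v) /\
    'D_v G (x + s *: v) = 'D_v F (x + s *: v + h *: w) - 'D_v F (x + s *: v).
  move=> sh; have d1 := dF _ (in_ball s h sh h0h).
  have d2 : differentiable F (x + s *: v).
    by have := dF _ (in_ball s 0 sh i0h); rewrite scale0r addr0.
  have d3 := differentiable_comp (dshift (x + s *: v)) d1.
  split; first exact: differentiableB.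
  rewrite deriveB; [|exact: diff_derivable|exact: diff_derivable].
  have -> : 'D_v (fun y => F (y + h *: w)) (x + s *: v) = _ := derive_comp v (dshift _) d1.
  congr (derive F _ _ - _).
  rewrite deriveD; [|exact: diff_derivable|exact: diff_derivable].
  by rewrite derive_id derive_cst addr0.
have [s sh eqG] := line_MVT h0 (fun s sh => (dG s sh).1).
have {}sh : 0 <= s <= h by case/andP: sh => s0 s1; rewrite !ltW.
have [|t th eqD] := @line_MVT R V ('D_v F) (x + s *: v) w h h0.
  move=> t th; apply: smooth_differentiable (smooth_derive v sF) _.
  exact/rA/in_ball.
have {}th : 0 <= t <= h by case/andP: th => t0 t1; rewrite !ltW.
exists (x + s *: v + t *: w); first exact: in_ball.
by rewrite -/(G (x + h *: v)) -/(G x) eqG (dG s sh).2 eqD mulrA expr2.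
Qed.

Let common_ball A (g1 g2 : V -> R) x (e : R) : open A -> A x ->
  {for x, continuous g1} -> {for x, continuous g2} -> 0 < e ->
  exists2 r, 0 < r & forall y, ball x r y ->
    [/\ A y, `|g1 x - g1 y| < e & `|g2 x - g2 y| < e].
Proof.
move=> oA Ax c1 c2 e0.
have nA : \near x, A x by exact: open_nbhs_nbhs.
have /cvgrPdist_lt/(_ _ e0) n1 := c1; have /cvgrPdist_lt/(_ _ e0) n2 := c2.
have : nbhs x (A `&` ([set y | `|g1 x - g1 y| < e] `&`
    [set y | `|g2 x - g2 y| < e])).
  by apply: filterI nA _; exact: filterI n1 n2.
move=> /nbhs_ballP[r /= r0 rP].
by exists r => // y /rP[Ay [y1 y2]].
Qed.

(** Both mixed derivatives, taken at suitable points near [x], equal the same second difference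
    divided by [h ^+ 2]; continuity at [x] makes their values at [x] agree up to any [e]. *)
Lemma derive_comm_real A (F : V -> R) (x v w : V) : open A -> smooth A F ->
  A x -> 'D_w ('D_v F) x = 'D_v ('D_w F) x.
Proof.
move=> oA sF Ax; apply/eqP; rewrite -subr_eq0 -normr_le0.
apply/ler_addgt0Pl => e e0; rewrite addr0.
have s1 := smooth_continuous (smooth_derive w (smooth_derive v sF)) Ax.
have s2 := smooth_continuous (smooth_derive v (smooth_derive w sF)) Ax.
have close (a b c d : R) : b = d -> `|a - b| < e / 2 -> `|c - d| < e / 2 ->
    `|a - c| <= e.
  move=> -> /ltW ad /ltW cd; rewrite (splitr e) -(subrKA d).
  by rewrite (le_trans (ler_normD _ _)) // lerD // distrC.
have e2 : 0 < e / 2 by rewrite divr_gt0.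
have [r r0 rP] := common_ball oA Ax s1 s2 e2.
(* The summand 1 keeps the denominator positive when [v] and [w] are both zero. *)
pose h := r / (`|v| + `|w| + 1).
have vw1 : 0 < `|v| + `|w| + 1 by rewrite ltr_pwDr // addr_ge0.
have h0 : 0 < h by rewrite divr_gt0.
have hr : h * (`|v| + `|w|) < r.
  by rewrite /h mulrAC ltr_pdivrMr // ltr_pM2l // ltrDl.
have hr' : h * (`|w| + `|v|) < r by rewrite (addrC `|w|).
have rA : ball x r `<=` A by move=> y /rP[].
have [y1 /rP[_ y1e _] eq1] := mixed_increment h0 sF rA hr.
have [y2 /rP[_ _ y2e] eq2] := mixed_increment h0 sF rA hr'.
have D12 : 'D_w ('D_v F) y1 = 'D_v ('D_w F) y2.
  apply: (mulfI (x := h ^+ 2)); first by rewrite expf_neq0 // gt_eqF.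
  have swap (a b b' d : R) : a - b - (b' - d) = a - b' - (b - d) by ring.
  apply: etrans (esym eq1) (etrans _ eq2).
  by rewrite swap [x + _ + _]addrAC.
exact: close D12 y1e y2e.
Qed.

Lemma derive_coord n (F : V -> 'rV[R]_n) (x v : V) j : differentiable F x ->
  'D_v (fun y => F y 0 j) x = ('D_v F x) 0 j.
Proof.
by move=> dF; rewrite derive_mx ?mxE //; exact: diff_derivable.
Qed.

Lemma derive_comm n A (F : V -> 'rV[R]_n) (x v w : V) : open A -> smooth A F ->
  A x -> 'D_w ('D_v F) x = 'D_v ('D_w F) x.
Proof.
move=> oA sF Ax; apply/rowP => j.
have nA : \near x, A x by exact: open_nbhs_nbhs.
have E u u' : ('D_u ('D_u' F) x) 0 j = 'D_u ('D_u' (fun y => F y 0 j)) x.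
  rewrite -derive_coord; last first.
    exact: smooth_differentiable (smooth_derive _ sF) Ax.
  apply: near_eq_derive; apply: filterS nA => y Ay.
  by rewrite derive_coord //; exact: smooth_differentiable sF Ay.
apply: etrans (E w v) (etrans _ (esym (E v w))).
exact: derive_comm_real oA (smooth_coord j oA sF) Ax.
Qed.

End Schwarz.

(** * The Minkowski form as a continuous bilinear map *)

Section MinkowskiForm.
Context {R : realType}.
Implicit Types x y z : 'rV[R]_5.

Lemma mink_is_bilinear : bilinear_for
  (GRing.Scale.Law.clone _ _ *:%R _) (GRing.Scale.Law.clone _ _ *:%R _)
  (@mink R).
Proof.
split=> [z|z] a x y /=; rewrite /mink !big_ord_recr !big_ord0 /= !mxE;
  rewrite /GRing.scale /=; ring.
Qed.
HB.instance Definition _ := bilinear_isBilinear.Build R 'rV[R]_5 'rV[R]_5 R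
  _ _ (@mink R) mink_is_bilinear.

Lemma minkC x y : mink x y = mink y x.
Proof. by rewrite /mink mulrC; under eq_bigr do rewrite mulrC. Qed.

Lemma minkDl x y z : mink (x + y) z = mink x z + mink y z.
Proof. exact: linearDl. Qed.
Lemma minkDr x y z : mink x (y + z) = mink x y + mink x z.
Proof. exact: linearDr. Qed.
Lemma minkNl x y : mink (- x) y = - mink x y.
Proof. exact: linearNl. Qed.
Lemma minkNr x y : mink x (- y) = - mink x y.
Proof. exact: linearNr. Qed.
Lemma minkZl a x y : mink (a *: x) y = a * mink x y.
Proof. exact: linearZl_LR. Qed.
Lemma minkZr a x y : mink x (a *: y) = a * mink x y.
Proof. exact: linearZr_LR. Qed.
Lemma mink0l x : mink 0 x = 0.
Proof. exact: linear0l. Qed.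
Lemma mink0r x : mink x 0 = 0.
Proof. exact: linear0r. Qed.
Lemma mink_suml (I : Type) (r : seq I) (F : I -> 'rV[R]_5) z :
  mink (\sum_(i <- r) F i) z = \sum_(i <- r) mink (F i) z.
Proof. exact: (big_morph (mink^~ z) (fun x y => minkDl x y z) (mink0l z)). Qed.
Lemma mink_sumr (I : Type) (r : seq I) (F : I -> 'rV[R]_5) z :
  mink z (\sum_(i <- r) F i) = \sum_(i <- r) mink z (F i).
Proof. exact: (big_morph (mink z) (minkDr z) (mink0r z)). Qed.

Definition minkE := (minkDl, minkDr, minkNl, minkNr, minkZl, minkZr).

Lemma mink_continuous : continuous (fun p : 'rV[R]_5 * 'rV[R]_5 => mink p.1 p.2).
Proof.
have c1 i : continuous (fun p : 'rV[R]_5 * 'rV[R]_5 => p.1 0 i).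
  by move=> p; apply: (@continuous_comp _ _ _ fst (fun x : 'rV[R]_5 => x 0 i));
    [exact: cvg_fst|exact: coord_continuous].
have c2 i : continuous (fun p : 'rV[R]_5 * 'rV[R]_5 => p.2 0 i).
  by move=> p; apply: (@continuous_comp _ _ _ snd (fun x : 'rV[R]_5 => x 0 i));
    [exact: cvg_snd|exact: coord_continuous].
move=> p; apply: cvgB; last by apply: cvgM; [exact: c1|exact: c2].
apply: cvg_big => [|i _]; first exact: add_continuous.
by apply: cvgM; [exact: c1|exact: c2].
Qed.

End MinkowskiForm.

Section Rules.
Context {R : realType} {V : normedModType R}.
Local Opaque derive.
Implicit Types (A : set V) (x v : V).

Lemma smooth_mink A (F G : V -> 'rV[R]_5) : open A ->
  smooth A F -> smooth A G -> smooth A (fun x => mink (F x) (G x)).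
Proof.
by move=> oA sF sG k; apply: class_C_bilin => //; exact: mink_continuous.
Qed.

Lemma derive_mink (F G : V -> 'rV[R]_5) x v :
  differentiable F x -> differentiable G x ->
  'D_v (fun y => mink (F y) (G y)) x =
  mink ('D_v F x) (G x) + mink (F x) ('D_v G x).
Proof. by move=> dF dG; rewrite derive_bilin //; exact: mink_continuous. Qed.

Lemma derive_scale (W : normedModType R) (a : V -> R) (F : V -> W) x v :
  differentiable a x -> differentiable F x ->
  'D_v (fun y => a y *: F y) x = 'D_v a x *: F x + a x *: 'D_v F x.
Proof. by move=> da dF; rewrite derive_bilin //; exact: scale_continuous. Qed.

Lemma derive_mul (a b : V -> R) x v :
  differentiable a x -> differentiable b x ->
  'D_v (fun y => a y * b y) x = 'D_v a x * b x + a x * 'D_v b x.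
Proof. exact: derive_scale. Qed.

Lemma derive_add (W : normedModType R) (F G : V -> W) x v :
  differentiable F x -> differentiable G x ->
  'D_v (fun y => F y + G y) x = 'D_v F x + 'D_v G x.
Proof. by move=> dF dG; apply: deriveD; exact: diff_derivable. Qed.

Lemma derive_sub (W : normedModType R) (F G : V -> W) x v :
  differentiable F x -> differentiable G x ->
  'D_v (fun y => F y - G y) x = 'D_v F x - 'D_v G x.
Proof. by move=> dF dG; apply: deriveB; exact: diff_derivable. Qed.

Lemma derive_const (W : normedModType R) (w : W) x v :
  'D_v (fun=> w) x = 0.
Proof. exact: derive_cst. Qed.

Lemma derive_dirD (W : normedModType R) (F : V -> W) x v w :
  differentiable F x -> 'D_(v + w) F x = 'D_v F x + 'D_w F x.
Proof. by move=> dF; rewrite !deriveE // linearD. Qed.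

Lemma derive_dirZ (W : normedModType R) (F : V -> W) x a v :
  differentiable F x -> 'D_(a *: v) F x = a *: 'D_v F x.
Proof. by move=> dF; rewrite !deriveE // linearZ. Qed.

Lemma derive_dir_sum (W : normedModType R) (F : V -> W) x (I : Type) (r : seq I)
    (v : I -> V) : differentiable F x ->
  'D_(\sum_(i <- r) v i) F x = \sum_(i <- r) 'D_(v i) F x.
Proof.
by move=> dF; rewrite deriveE // linear_sum; apply: eq_bigr => i _;
  rewrite deriveE.
Qed.

Lemma eq_derive_open (W : normedModType R) A (F G : V -> W) x v : open A ->
  (forall y, A y -> F y = G y) -> A x -> 'D_v F x = 'D_v G x.
Proof.
move=> oA FG Ax; apply: near_eq_derive.
have : \near x, A x by exact: open_nbhs_nbhs.
by apply: filterS => y /FG.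
Qed.

(** The mean value theorem is one for real functions, so it is applied to each coordinate, with its
    own intermediate point. *)
Lemma segment_const n (F : V -> 'rV[R]_n) x v :
  (forall s, 0 <= s <= 1 -> differentiable F (x + s *: v)) ->
  (forall s, 0 <= s <= 1 -> 'D_v F (x + s *: v) = 0) -> F (x + v) = F x.
Proof.
move=> dF DF; apply/rowP => j; apply/eqP; rewrite -subr_eq0; apply/eqP.
have dFj s : 0 <= s <= 1 -> differentiable (fun y => F y 0 j) (x + s *: v).
  move=> /dF dFs; exact: (differentiable_comp dFs (differentiable_coord _ 0 j)).
have [s /andP[s0 s1]] := line_MVT ltr01 dFj.
have sh : 0 <= s <= 1 by rewrite !ltW.
by rewrite scale1r derive_coord ?DF ?mxE ?mulr0 //; exact: dF.
Qed.

End Rules.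

Section SmoothReal.
Context {R : realType}.
Local Opaque derive.
Implicit Types (A : set R).

Lemma derive_real_comp (V : normedModType R) (g : R -> R) (h : V -> R) x v dg :
  differentiable h x -> is_derive (h x) 1 g dg ->
  'D_v (g \o h) x = dg * 'D_v h x.
Proof.
move=> dh [/derivable1_diffP dg1 <-].
rewrite derive_comp //; have := derive_dirZ ('D_v h x) (1 : R) dg1.
by rewrite [_ *: 1]mulr1 mulrC.
Qed.

Lemma smooth_antiderivative A (G g : R -> R) : open A ->
  (forall t, A t -> is_derive t 1 G (g t)) -> smooth A g -> smooth A G.
Proof.
move=> oA dG sg.
have dfG t : A t -> differentiable G t.
  by move=> /dG[/derivable1_diffP].
case=> [t /dfG|k]; first exact: differentiable_continuous.
split=> // v; apply: (class_C_eq oA _ (smoothZ oA (smooth_cst A v) sg k)) => t At.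
have [_ <-] := dG _ At; have := derive_dirZ v (1 : R) (dfG _ At).
by rewrite [_ *: 1]mulr1.
Qed.

(** The induction over [k] treats all exponents at once, since differentiation passes from [a] to
    [a - 1]. *)
Lemma smooth_powR a : smooth [set t : R | 0 < t] (fun t => t `^ a).
Proof.
have oP : open [set t : R | 0 < t] by exact: open_gt.
move=> k; elim: k a => [|k IH] a.
  move=> t /= t0; apply/differentiable_continuous/derivable1_diffP.
  by have [] := is_derive1_powR a t0.
have dp (t : R) : 0 < t -> differentiable (fun t : R => t `^ a) t.
  by move=> t0; apply/derivable1_diffP; have [] := is_derive1_powR a t0.
split=> // v; apply: (class_C_eq oP _ (class_C_bilin (@scale_continuous _ _) oP
  (class_C_cst k _ (v * a)) (IH (a - 1)))) => t t0.
have [_ dE] := is_derive1_powR a t0; have := derive_dirZ v (1 : R) (dp _ t0).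
by rewrite [v *: 1]mulr1 dE => ->; apply/esym/mulrA.
Qed.

End SmoothReal.

(** * Derivatives along vector fields and the Lie bracket *)

Section VectorFields.
Context {R : realType} {n : nat}.
Local Opaque derive.
Implicit Types (A : set 'rV[R]_n) (e : 'rV[R]_n -> 'rV[R]_n) (x v : 'rV[R]_n).

Lemma derive_dirB (W : normedModType R) (F : 'rV[R]_n -> W) x v w :
  differentiable F x -> 'D_(v - w) F x = 'D_v F x - 'D_w F x.
Proof. by move=> dF; rewrite !deriveE // linearB. Qed.

Lemma derive_row (W : normedModType R) (F : 'rV[R]_n -> W) x v :
  differentiable F x -> 'D_v F x = \sum_j v 0 j *: 'D_(delta_mx 0 j) F x.
Proof.
move=> dF; rewrite {1}(row_sum_delta v) derive_dir_sum //.
by apply: eq_bigr => j _; rewrite derive_dirZ.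
Qed.

Lemma smooth_derive_along (W : normedModType R) A (F : 'rV[R]_n -> W) e :
  open A -> smooth A e -> smooth A F -> smooth A (fun x => 'D_(e x) F x).
Proof.
move=> oA se sF.
apply: (smooth_eq oA _ (smooth_sum (index_enum 'I_n) oA (fun j =>
  smoothZ oA (smooth_coord j oA se) (smooth_derive (delta_mx 0 j) sF)))).
by move=> x Ax; rewrite [RHS]derive_row //; exact: smooth_differentiable sF Ax.
Qed.

Lemma derive_derive_along m A (F : 'rV[R]_n -> 'rV[R]_m) e x v :
  open A -> smooth A e -> smooth A F -> A x ->
  'D_v (fun y => 'D_(e y) F y) x =
  'D_('D_v e x) F x + \sum_j e x 0 j *: 'D_v ('D_(delta_mx 0 j) F) x.
Proof.
move=> oA se sF Ax.
have dF y : A y -> differentiable F y by exact: smooth_differentiable.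
have de : differentiable e x by exact: smooth_differentiable se Ax.
have dj j : differentiable (fun y => e y 0 j) x.
  by exact: smooth_differentiable (smooth_coord j oA se) Ax.
have dDj j : differentiable ('D_(delta_mx 0 j) F) x.
  by exact: smooth_differentiable (smooth_derive _ sF) Ax.
rewrite (@eq_derive_open R _ _ _ _
  (\sum_j (fun y => e y 0 j *: 'D_(delta_mx 0 j) F y)) x v oA); last 2 first.
- by move=> y Ay; rewrite derive_row ?fct_sumE //; exact: dF.
- by [].
rewrite derive_sum => [|j]; last first.
  apply: diff_derivable; apply: differentiable_bilin_comp => //.
  exact: scale_continuous.
rewrite [X in _ = X + _]derive_row; last exact: dF.
rewrite -big_split /=; apply: eq_bigr => j _.
by rewrite derive_scale // derive_coord.
Qed.

(* The two sums of second derivatives agree by Schwarz's theorem. *)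
Lemma derive_bracket m A (F : 'rV[R]_n -> 'rV[R]_m) e1 e2 x :
  open A -> smooth A e1 -> smooth A e2 -> smooth A F -> A x ->
  'D_(e1 x) (fun y => 'D_(e2 y) F y) x - 'D_(e2 x) (fun y => 'D_(e1 y) F y) x =
  'D_('D_(e1 x) e2 x - 'D_(e2 x) e1 x) F x.
Proof.
move=> oA s1 s2 sF Ax.
have dF : differentiable F x by exact: smooth_differentiable sF Ax.
have dDj j : differentiable ('D_(delta_mx 0 j) F) x.
  by exact: smooth_differentiable (smooth_derive _ sF) Ax.
rewrite (derive_derive_along _ oA s2 sF Ax) (derive_derive_along _ oA s1 sF Ax).
rewrite derive_dirB // opprD addrACA.
rewrite [X in _ + X](_ : _ = 0) ?addr0 //; apply/eqP; rewrite subr_eq0; apply/eqP.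
transitivity (\sum_j \sum_i (e2 x 0 j * e1 x 0 i) *:
    'D_(delta_mx 0 i) ('D_(delta_mx 0 j) F) x).
  apply: eq_bigr => j _.
  apply: etrans (congr1 ( *:%R _) (derive_row (e1 x) (dDj j))) _.
  by rewrite scaler_sumr; apply: eq_bigr => i _; rewrite scalerA.
rewrite exchange_big /=; apply: eq_bigr => i _.
apply: etrans (esym (congr1 ( *:%R _) (derive_row (e2 x) (dDj i)))).
rewrite scaler_sumr; apply: eq_bigr => j _.
rewrite scalerA [e2 x 0 j * _]mulrC.
by apply: (congr1 ( *:%R _)); exact: (derive_comm _ _ oA sF Ax).
Qed.

End VectorFields.

(** * Local inverses *)

Section RowNorm.
Context {R : realType} {n : nat}.
Implicit Types (x y : 'rV[R]_n).

(** Completeness is what the Banach fixed point theorem asks of row vectors. *)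
HB.instance Definition _ := Complete.on 'rV[R]_n.

Lemma row_norm_le x (c : R) : 0 <= c -> (forall j, `|x 0 j| <= c) -> `|x| <= c.
Proof.
move=> c0 xc; rewrite /Num.Def.normr /= mx_normrE bigmax_le //= => -[i j] _ /=.
by rewrite ord1.
Qed.

Lemma coord_le_norm x j : `|x 0 j| <= `|x|.
Proof.
by rewrite [leRHS]/Num.Def.normr /= mx_normrE (le_bigmax _ _ (0, j)).
Qed.

Lemma smooth_id (V : normedModType R) (A : set V) : open A -> smooth A id.
Proof.
move=> oA; case=> [x _|k]; first by [].
split=> // v; apply: (class_C_eq oA _ (class_C_cst k A v)) => x _.
by rewrite derive_id.
Qed.

Lemma in_ballE x (r : R) y : ball x r y = (`|x - y| < r) :> Prop.
Proof. by rewrite -ball_normE. Qed.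

End RowNorm.

Section LocalInverse.
Context {R : realType} {n : nat}.
Local Opaque derive.
Variables (A : set 'rV[R]_n) (Psi : 'rV[R]_n -> 'rV[R]_n).
Variable K : 'I_n -> 'rV[R]_n -> 'rV[R]_n.
Hypotheses (oA : open A) (sPsi : smooth A Psi) (sK : forall i, smooth A (K i)).
Hypothesis DPsi : forall x i, A x -> 'D_(K i x) Psi x = delta_mx 0 i.
Variable x0 : 'rV[R]_n.
Hypothesis Ax0 : A x0.

(** The hypothesis on [K] says that the matrix with rows [K i x] inverts the Jacobian [J x]. The
    inverse matrix is thus known in advance and smooth, which later yields the smoothness of the
    local inverse. *)
Let P x : 'M[R]_n := \matrix_i K i x.
Let J x : 'M[R]_n := \matrix_i 'D_(delta_mx 0 i) Psi x.

Let row_mulP w x : w *m P x = \sum_i w 0 i *: K i x.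
Proof. by rewrite mulmx_sum_row; apply: eq_bigr => i _; rewrite rowK. Qed.

Let dPsi x : A x -> differentiable Psi x.
Proof. exact: smooth_differentiable sPsi. Qed.

Let row_mulJ w x : A x -> 'D_w Psi x = w *m J x.
Proof.
move=> Ax; rewrite mulmx_sum_row derive_row; last exact: dPsi.
by apply: eq_bigr => i _; rewrite rowK.
Qed.

Let PJ x : A x -> P x *m J x = 1%:M.
Proof.
move=> Ax; apply/row_matrixP => i.
by rewrite row_mul rowK -row_mulJ // DPsi // row1.
Qed.

Let JP x : A x -> J x *m P x = 1%:M.
Proof. by move=> Ax; apply: mulmx1C; exact: PJ. Qed.

Let C x : R := \sum_i `|K i x| + 1.

Let C_gt0 x : 0 < C x.
Proof. by rewrite ltr_wpDl // sumr_ge0. Qed.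

Let normP (w : 'rV[R]_n) x : `|w *m P x| <= C x * `|w|.
Proof.
rewrite row_mulP (le_trans (ler_norm_sum _ _ _)) // /C mulrDl mul1r.
rewrite ler_wpDr // mulr_suml ler_sum // => i _.
by rewrite normrZ mulrC ler_wpM2l // coord_le_norm.
Qed.

Let theta x := x - Psi x *m P x0.

Let smooth_theta j : smooth A (fun x => theta x 0 j).
Proof.
apply: smooth_coord => //; apply: smoothB => //.
  exact: smooth_id.
apply: (smooth_eq oA _ (smooth_sum (index_enum 'I_n) oA (fun i =>
  smoothZ oA (smooth_coord i oA sPsi) (smooth_cst A (K i x0))))) => x _.
by rewrite row_mulP.
Qed.

Let derive_theta v x : A x -> 'D_v theta x = v - 'D_v Psi x *m P x0.
Proof.
move=> Ax; have dPx := dPsi Ax.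
have -> : theta = fun x => x - \sum_i Psi x 0 i *: K i x0.
  by apply/funext => y; rewrite /theta row_mulP.
have dc i : differentiable (fun x => Psi x 0 i) x.
  exact: smooth_differentiable (smooth_coord i oA sPsi) Ax.
have dZ i : differentiable (fun x => Psi x 0 i *: K i x0) x.
  apply: differentiable_bilin_comp => //; exact: scale_continuous.
have dS : differentiable (fun x => \sum_i Psi x 0 i *: K i x0) x.
  have -> : (fun x => \sum_i Psi x 0 i *: K i x0) =
     \sum_i (fun x => Psi x 0 i *: K i x0).
    by apply/funext => y; rewrite fct_sumE.
  exact: differentiable_sum.
rewrite derive_sub // derive_id row_mulP; congr (_ - _).
have -> : (fun x => \sum_i Psi x 0 i *: K i x0) =
   \sum_i (fun x => Psi x 0 i *: K i x0).
  by apply/funext => y; rewrite fct_sumE.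
rewrite derive_sum => [|i]; last exact: diff_derivable.
apply: eq_bigr => i _.
by rewrite derive_scale // derive_const scaler0 addr0 derive_coord.
Qed.

(** At [x0] the derivative of [theta] is zero because [J x0 *m P x0 = 1%:M]. Its partial derivatives
    are therefore small on a whole ball, and the mean value theorem along the segments of this
    convex ball makes [theta] a contraction. *)
Let theta_contracts : exists2 r : R, 0 < r & ball x0 r `<=` A /\
  forall x y, ball x0 r x -> ball x0 r y ->
    `|theta y - theta x| <= 2^-1 * `|y - x|.
Proof.
(* A sum of [n] partial derivatives below [e] is at most 1/2; [n.+1] keeps [e] positive when
   [n = 0]. *)
pose e : R := (2 * n.+1%:R)^-1.
have e0 : 0 < e by rewrite invr_gt0 mulr_gt0.
have near_small : \forall x \near x0, forall ij : 'I_n * 'I_n,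
    `|'D_(delta_mx 0 ij.1) (fun x => theta x 0 ij.2) x| < e.
  suff Dij (ij : 'I_n * 'I_n) : \forall x \near x0,
      `|'D_(delta_mx 0 ij.1) (fun x => theta x 0 ij.2) x| < e.
    exact: (@filter_forall _ _ _ (nbhs x0) _ Dij).
  case: ij => i j /=; have c := smooth_continuous (smooth_derive (delta_mx 0 i) (smooth_theta j)) Ax0.
  have z : 'D_(delta_mx 0 i) (fun x => theta x 0 j) x0 = 0.
    have dth : differentiable theta x0.
      rewrite (_ : theta = fun x => \row_k theta x 0 k); last first.
        by apply/funext => x; apply/rowP => k; rewrite mxE.
      exact: smooth_differentiable (smooth_row oA smooth_theta) Ax0.
    rewrite derive_coord // derive_theta // row_mulJ // -mulmxA JP // mulmx1.
    by rewrite subrr mxE.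
  have c0 : 'D_(delta_mx 0 i) (fun x => theta x 0 j) x @[x --> x0] --> (0 : R).
    by rewrite -z; exact: c.
  by move/cvgr0Pnorm_lt: c0 => /(_ _ e0).
have nA : \near x0, A x0 by exact: open_nbhs_nbhs.
have : nbhs x0 (A `&` [set x | forall ij : 'I_n * 'I_n,
    `|'D_(delta_mx 0 ij.1) (fun x => theta x 0 ij.2) x| < e]).
  by apply: filterI.
move=> /nbhs_ballP[r /= r0 rP]; exists r => //; split=> [x /rP[]//|x y bx by_].
have bxy s : 0 <= s <= 1 -> ball x0 r (x + s *: (y - x)).
  move=> /andP[s0 s1]; move: bx by_; rewrite !in_ballE => bx by_.
  have -> : x0 - (x + s *: (y - x)) = (1 - s) *: (x0 - x) + s *: (x0 - y).
    by apply/rowP => j; rewrite !mxE; ring.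
  rewrite (le_lt_trans (ler_normD _ _)) // !normrZ !ger0_norm ?subr_ge0 //.
  have [->|sn0] := eqVneq s 0; first by rewrite subr0 mul1r mul0r addr0.
  have sp : 0 < s by rewrite lt_neqAle eq_sym sn0.
  have -> : r = (1 - s) * r + s * r by ring.
  by rewrite ler_ltD // ?ltr_pM2l // ler_wpM2l ?subr_ge0 // ltW.
apply: row_norm_le => [|j]; first by rewrite mulr_ge0.
have -> : (theta y - theta x) 0 j = theta y 0 j - theta x 0 j by rewrite !mxE.
have dth s : 0 <= s <= 1 ->
    differentiable (fun x => theta x 0 j) (x + s *: (y - x)).
  move=> /bxy/rP[As _]; exact: smooth_differentiable (smooth_theta j) As.
have [s /andP[s0 s1]] := line_MVT ltr01 dth.
have sh : 0 <= s <= 1 by rewrite !ltW.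
rewrite scale1r [x + (y - x)]addrC subrK mul1r => ->.
have [_ small] := rP _ (bxy _ sh).
rewrite derive_row; last exact: dth.
rewrite (le_trans (ler_norm_sum _ _ _)) //.
have le1 i : `|(y - x) 0 i *: 'D_(delta_mx 0 i) (fun x => theta x 0 j)
    (x + s *: (y - x))| <= e * `|y - x|.
  rewrite normrZ mulrC; apply: ler_pM => //; last exact: coord_le_norm.
  exact: (ltW (small (i, j))).
apply: le_trans (ler_sum _ (fun i _ => le1 i)) _.
rewrite sumr_const card_ord -mulrnAl ler_wpM2r // -mulr_natr /e invfM -mulrA.
rewrite ger_pMr ?invr_gt0 // mulrC ler_pdivrMr // mul1r ler_nat.
exact: leqnSn.
Qed.

(** With [h := inv (k + y) - x], the expansion of [Psi] gives k = h J + o(h). Multiplying by [P x]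
    isolates [h], and the Lipschitz bound turns o(h) into o(k). *)
Let inverse_derivative (B : set 'rV[R]_n) (c : R) inv y : open B -> B y ->
  (forall y y', B y -> B y' -> `|inv y - inv y'| <= c * `|y - y'|) ->
  (forall y, B y -> Psi (inv y) = y) -> A (inv y) ->
  differentiable inv y /\ forall w, 'D_w inv y = w *m P (inv y).
Proof.
move=> oB By lip invK Ax; set x := inv y.
have cL : continuous (mulmxr (P x) : 'rV[R]_n -> 'rV[R]_n).
  have oT : open [set: 'rV[R]_n] by exact: openT.
  have sL : smooth setT (mulmxr (P x) : 'rV[R]_n -> 'rV[R]_n).
    apply: (smooth_eq oT _ (smooth_sum (index_enum 'I_n) oT (fun i =>
      smoothZ oT (smooth_coord i oT (smooth_id oT)) (smooth_cst setT (K i x))))).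
    by move=> w _; rewrite /= row_mulP.
  by move=> w; exact: smooth_continuous sL I.
have c1 : 0 < `|c| + 1 by rewrite ltr_pwDr.
have expand : inv \o shift y =
    cst (inv y) + (mulmxr (P x) : 'rV[R]_n -> 'rV[R]_n) +o_ 0 id.
  apply/eqaddoP => _/posnumP[e].
  have /diff_locally/eqaddoP oPsi := dPsi Ax.
  (* The factor [C x] bounds multiplication by [P x], and |c| + 1 bounds the norm of [h] relative to
     that of [k]; the summand 1 makes this factor positive whatever [c] is. *)
  pose e1 : R := e%:num / (C x * (`|c| + 1)).
  have e10 : 0 < e1 by rewrite divr_gt0 // mulr_gt0.
  have /nbhs_ballP[d /= d0 dP] := oPsi _ e10.
  have nB : nbhs (0 : 'rV[R]_n) [set k | B (k + y)].
    have : nbhs y B by exact: open_nbhs_nbhs.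
    rewrite -[nbhs y B]/(\forall z \near y, B z) (near_shift 0 y).
    by apply: filterS => k /=; rewrite subr0.
  have nd : nbhs (0 : 'rV[R]_n) (ball 0 (d / (`|c| + 1))).
    by apply: nbhsx_ballx; rewrite divr_gt0.
  have : nbhs (0 : 'rV[R]_n) ([set k | B (k + y)] `&` ball 0 (d / (`|c| + 1))).
    by apply: filterI.
  apply: filterS => k /= [Bk]; rewrite in_ballE sub0r normrN => kd.
  pose h := inv (k + y) - x.
  have hk : `|h| <= (`|c| + 1) * `|k|.
    have := lip _ _ Bk By; rewrite addrK => le1; apply: le_trans le1 _.
    by rewrite ler_wpM2r // (le_trans (ler_norm c)) // lerDl.
  have hd : ball 0 d h.
    by rewrite in_ballE sub0r normrN (le_lt_trans hk) // mulrC -ltr_pdivlMr.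
  have E1 : (Psi \o shift (inv y) - (cst (Psi (inv y)) + 'd Psi (inv y))) h =
      k - h *m J x.
    rewrite -[LHS]/(Psi (h + x) - (Psi x + 'd Psi x h)) {1}/h subrK !invK //.
    rewrite -deriveE; last exact: dPsi.
    by rewrite row_mulJ // opprD addrA addrK.
  have E2 : (inv \o shift y - (cst (inv y) + mulmxr (P x))) k =
      - ((k - h *m J x) *m P x).
    rewrite -[LHS]/(inv (k + y) - (x + k *m P x)) mulmxBl -mulmxA JP // mulmx1.
    by rewrite opprB opprD addrA.
  have := dP _ hd; rewrite /= E1 E2 normrN => small.
  apply: le_trans (normP _ _) _.
  have -> : e%:num * `|k| = C x * (e1 * ((`|c| + 1) * `|k|)).
    by rewrite /e1; field; rewrite !gt_eqF.
  by rewrite ler_pM2l // (le_trans small) // ler_pM2l.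
have dE : 'd inv y = mulmxr (P x) :> ('rV[R]_n -> 'rV[R]_n).
  exact: diff_unique cL expand.
have dinv : differentiable inv y.
  by apply/diff_locallyP; rewrite dE; split.
by split=> // w; rewrite deriveE // dE.
Qed.

(* Newton's iteration with the derivative frozen at x0: the fixed points of
   [x |-> theta x + y *m P x0] are the solutions of [Psi x = y]. *)
Lemma local_inverse : exists (r rho : R) (inv : 'rV[R]_n -> 'rV[R]_n),
  [/\ 0 < r, 0 < rho, ball x0 r `<=` A,
    (forall y, ball (Psi x0) rho y -> ball x0 r (inv y) /\ Psi (inv y) = y) &
    [/\ (forall x, ball x0 r x -> ball (Psi x0) rho (Psi x) -> inv (Psi x) = x),
      smooth (ball (Psi x0) rho) inv &
      (forall y w, ball (Psi x0) rho y ->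
        'D_w inv y = \sum_i w 0 i *: K i (inv y))]].
Proof.
have [r r0 [rA contr]] := theta_contracts.
(* Half the radius leaves room for the closed ball of radius [r1], on which the fixed point theorem
   is applied, inside the open ball of radius [r]. *)
pose r1 := r / 2; have r10 : 0 < r1 by rewrite divr_gt0.
have r1r : r1 < r by rewrite /r1 ltr_pdivrMr // ltr_pMr // ltr1n.
(* Chosen so that the first Newton step from [x0] is shorter than [r1 / 2], as [C x0] bounds
   multiplication by [P x0]. *)
pose rho := r1 / 2 / C x0; have rho0 : 0 < rho by rewrite !divr_gt0.
have sub1 x : `|x0 - x| <= r1 -> ball x0 r x.
  by rewrite in_ballE => xr1; exact: le_lt_trans xr1 r1r.
have psi_theta x y : (x - y) = (theta x - theta y) + (Psi x - Psi y) *m P x0.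
  by rewrite /theta mulmxBl; apply/rowP => j; rewrite !mxE; ring.
(* The contraction [theta] absorbs half of the distance. This gives both the injectivity of [Psi] on
   the ball and the Lipschitz bound for the inverse. *)
have lipinv x y : ball x0 r x -> ball x0 r y ->
    `|x - y| <= 2 * C x0 * `|Psi x - Psi y|.
  move=> bx by_; have := ler_normD (theta x - theta y) ((Psi x - Psi y) *m P x0).
  rewrite -psi_theta => le1; have le2 := contr _ _ by_ bx.
  have := normP (Psi x - Psi y) x0; move: le1 le2; lra.
have surj y : ball (Psi x0) rho y -> exists x, ball x0 r1 x /\ Psi x = y.
  rewrite in_ballE => yrho.
  pose T x := theta x + y *m P x0.
  have Tx0 : `|T x0 - x0| < r1 / 2.
    have -> : T x0 - x0 = (y - Psi x0) *m P x0.
      by rewrite /T /theta mulmxBl; apply/rowP => j; rewrite !mxE; ring.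
    apply: le_lt_trans (normP _ _) _.
    by rewrite mulrC -ltr_pdivlMr // distrC.
  pose U := [set x | `|x0 - x| <= r1].
  have close x : U x -> `|T x - x0| < r1.
    move=> Ux; have bx := sub1 _ Ux.
    have bx0 : ball x0 r x0 by rewrite in_ballE subrr normr0.
    have le1 := contr _ _ bx0 bx.
    have le2 := ler_normD (theta x - theta x0) (T x0 - x0).
    have E : theta x - theta x0 + (T x0 - x0) = T x - x0.
      by rewrite /T; apply/rowP => j; rewrite !mxE; ring.
    have Ux' : `|x - x0| <= r1 by rewrite distrC.
    move: le1 le2 Tx0 Ux'; rewrite E /r1; lra.
  have funT : set_fun U U T.
    by move=> x /close Tx; rewrite /U /= distrC ltW.
  pose fT := HB.pack_for {fun U >-> U} T (isFun.Build _ _ U U T funT).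
  have cT : is_contraction fT.
    have h0 : 0 <= (2^-1 : R) by rewrite invr_ge0.
    exists (NngNum h0); split; first by rewrite /= invf_lt1 ?ltr1n.
    move=> [x z] /= [Ux Uz].
    have -> : T x - T z = theta x - theta z.
      by rewrite /T; apply/rowP => j; rewrite !mxE; ring.
    by apply: contr; exact: sub1.
  have clU : closed U.
    have -> : U = closed_ball x0 r1 by rewrite closed_ballE.
    exact: closed_ball_closed.
  have [|x Ux /= xE] := banach_fixed_point cT clU.
    by exists x0; rewrite /U /= subrr normr0 ltW.
  have {}xE : x = T x by exact: xE.
  exists x; split; first by rewrite in_ballE distrC {1}xE; exact: close.
  (* This is the fixed point equation rewritten; [P x0] is invertible, so [Psi x = y] follows. *)
  have : (y - Psi x) *m P x0 = 0.
    rewrite mulmxBl; move: xE; rewrite /T /theta => /(congr1 (fun z => z - x)).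
    rewrite subrr => E; rewrite {}[RHS]E.
    by apply/rowP => j; rewrite !mxE; ring.
  move=> /(congr1 (mulmx^~ (J x0))); rewrite -mulmxA PJ // mulmx1 mul0mx.
  by move=> /eqP; rewrite subr_eq0 => /eqP.
have [inv invP] : exists inv : 'rV[R]_n -> 'rV[R]_n,
    forall y, ball (Psi x0) rho y -> ball x0 r1 (inv y) /\ Psi (inv y) = y.
  have /choice[g gP] : forall y, exists x,
      ball (Psi x0) rho y -> ball x0 r1 x /\ Psi x = y.
    move=> y; have [/surj[x]|ny] := pselect (ball (Psi x0) rho y); first by exists x.
    by exists x0.
  by exists g.
have ball1 x : ball x0 r1 x -> ball x0 r x.
  by rewrite in_ballE => /ltW/sub1.
have oB : open (ball (Psi x0) rho) by exact: ball_open.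
have lip y y' : ball (Psi x0) rho y -> ball (Psi x0) rho y' ->
    `|inv y - inv y'| <= 2 * C x0 * `|y - y'|.
  move=> /invP[/ball1 b1 e1] /invP[/ball1 b2 e2].
  by rewrite -[in leRHS]e1 -[in leRHS]e2; exact: lipinv.
have invA y : ball (Psi x0) rho y -> A (inv y).
  by move=> /invP[/ball1/rA].
have dinv y : ball (Psi x0) rho y -> differentiable inv y /\
    forall w, 'D_w inv y = w *m P (inv y).
  move=> By; have [/ball1 bx xE] := invP _ By; have Ax := invA _ By.
  exact: inverse_derivative oB By lip (fun y b => (invP y b).2) Ax.
have Dinv y w : ball (Psi x0) rho y ->
    'D_w inv y = \sum_i w 0 i *: K i (inv y).
  by move=> By; rewrite (dinv _ By).2 row_mulP.
exists r, rho, inv; split => //.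
  by move=> y /invP[/ball1].
split=> // [x bx bPx|k].
  have [/ball1 bi iE] := invP _ bPx.
  have := lipinv _ _ bi bx; rewrite iE subrr normr0 mulr0 normr_le0 subr_eq0.
  by move=> /eqP.
elim: k => [|k IH].
  by move=> y /dinv[dy _]; exact: differentiable_continuous.
split=> [y /dinv[]//|w].
(* Bootstrap: the derivative of [inv] is a combination of the maps [K i \o inv], which are of class
   C^k as soon as [inv] is. *)
have cK i : class_C k (ball (Psi x0) rho) (fun y => w 0 i *: K i (inv y)).
  apply: class_C_bilin => //; [exact: scale_continuous|exact: class_C_cst|].
  exact: (class_C_comp (l := fun i => row_coord i) (@row_coord_continuous R n)
    (@row_decomp R n) oB invA IH (sK i k)).
apply: (class_C_eq oB _ (class_C_sum (index_enum 'I_n) oB cK)) => y By.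
by rewrite Dinv.
Qed.

End LocalInverse.

(** * Orthonormal frames of the Minkowski form *)

Section MinkowskiAlgebra.
Context {R : realType}.
Implicit Types x y z p w : 'rV[R]_5.

Lemma forall_I5 (P : 'I_5 -> Prop) : P (inord 0) -> P (inord 1) ->
  P (inord 2) -> P (inord 3) -> P (inord 4) -> forall i, P i.
Proof.
move=> P0 P1 P2 P3 P4 i; rewrite -(inord_val i).
by case: i => -[|[|[|[|[|//]]]]].
Qed.

Lemma mink5 x y : mink x y = x 0 (inord 0) * y 0 (inord 0) +
  x 0 (inord 1) * y 0 (inord 1) + x 0 (inord 2) * y 0 (inord 2) +
  x 0 (inord 3) * y 0 (inord 3) - x 0 (inord 4) * y 0 (inord 4).
Proof.
rewrite /mink !big_ord_recr !big_ord0 /= add0r; congr (_ + _ + _ + _ - _);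
  by congr (x 0 _ * y 0 _); apply: val_inj; rewrite /= ?inordK.
Qed.

(** Orthogonality expresses p4 w4, and the norm expresses p4^2, through spatial coordinates.
    Lagrange's identity then writes <w, w> p4^2 as the sum of the squares of the four spatial
    coordinates of [w] and of the 2 by 2 minors of the spatial parts. The orthogonal complement of a
    timelike vector is thus positive definite. *)
Lemma spacelike_ge0 p w : mink p p = -1 -> mink p w = 0 ->
  0 <= mink w w /\ (mink w w = 0 -> w = 0).
Proof.
rewrite !mink5.
set p0 := p _ _; set p1 := p _ _; set p2 := p _ _; set p3 := p _ _.
set p4 := p _ _.
set w0 := w _ _; set w1 := w _ _; set w2 := w _ _; set w3 := w _ _.
set w4 := w _ _ => pp pw.
have key : (w0 ^+ 2 + w1 ^+ 2 + w2 ^+ 2 + w3 ^+ 2 - w4 ^+ 2) * p4 ^+ 2 =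
  w0 ^+ 2 + w1 ^+ 2 + w2 ^+ 2 + w3 ^+ 2 + (p0 * w1 - p1 * w0) ^+ 2 +
  (p0 * w2 - p2 * w0) ^+ 2 + (p0 * w3 - p3 * w0) ^+ 2 +
  (p1 * w2 - p2 * w1) ^+ 2 + (p1 * w3 - p3 * w1) ^+ 2 +
  (p2 * w3 - p3 * w2) ^+ 2.
  have e4 : p4 ^+ 2 = p0 ^+ 2 + p1 ^+ 2 + p2 ^+ 2 + p3 ^+ 2 + 1.
    by rewrite !expr2; lra.
  have e5 : p4 * w4 = p0 * w0 + p1 * w1 + p2 * w2 + p3 * w3 by lra.
  have -> : (w0 ^+ 2 + w1 ^+ 2 + w2 ^+ 2 + w3 ^+ 2 - w4 ^+ 2) * p4 ^+ 2 =
    (w0 ^+ 2 + w1 ^+ 2 + w2 ^+ 2 + w3 ^+ 2) * p4 ^+ 2 - (p4 * w4) ^+ 2 by ring.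
  by rewrite e4 e5; ring.
have p40 : 0 < p4 ^+ 2.
  have : p4 ^+ 2 = p0 ^+ 2 + p1 ^+ 2 + p2 ^+ 2 + p3 ^+ 2 + 1.
    by rewrite !expr2; lra.
  by move=> ->; rewrite ltr_wpDl // !addr_ge0 // sqr_ge0.
have E : w0 * w0 + w1 * w1 + w2 * w2 + w3 * w3 - w4 * w4 =
  w0 ^+ 2 + w1 ^+ 2 + w2 ^+ 2 + w3 ^+ 2 - w4 ^+ 2 by ring.
split; first by rewrite E -(pmulr_lge0 _ p40) key !addr_ge0 // sqr_ge0.
rewrite E => E0; move: key; rewrite E0 mul0r => /esym.
have s1 := sqr_ge0 (p0 * w1 - p1 * w0); have s2 := sqr_ge0 (p0 * w2 - p2 * w0).
have s3 := sqr_ge0 (p0 * w3 - p3 * w0); have s4 := sqr_ge0 (p1 * w2 - p2 * w1).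
have s5 := sqr_ge0 (p1 * w3 - p3 * w1); have s6 := sqr_ge0 (p2 * w3 - p3 * w2).
have q0 := sqr_ge0 w0; have q1 := sqr_ge0 w1; have q2 := sqr_ge0 w2.
have q3 := sqr_ge0 w3 => s0.
have z0 : w0 = 0 by apply/eqP; rewrite -sqrf_eq0; apply/eqP; lra.
have z1 : w1 = 0 by apply/eqP; rewrite -sqrf_eq0; apply/eqP; lra.
have z2 : w2 = 0 by apply/eqP; rewrite -sqrf_eq0; apply/eqP; lra.
have z3 : w3 = 0 by apply/eqP; rewrite -sqrf_eq0; apply/eqP; lra.
have z4 : w4 = 0.
  by apply/eqP; rewrite -sqrf_eq0; move: E0; rewrite z0 z1 z2 z3 !expr0n /=;
  rewrite !addr0 add0r => /eqP; rewrite oppr_eq0.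
by apply/rowP; apply: forall_I5; rewrite mxE.
Qed.

Definition minkI : 'M[R]_5 := diag_mx (\row_i (if i == ord_max then -1 else 1)).

Lemma mink_mulmx x y : mink x y = (x *m minkI *m y^T) 0 0.
Proof.
rewrite mink5 mul_mx_diag mxE.
rewrite !big_ord_recr big_ord0 /= add0r !mxE.
have -> : (widen_ord (leqnSn 4) (widen_ord (leqnSn 3) (widen_ord (leqnSn 2)
  (widen_ord (leqnSn 1) ord_max)))) = inord 0 :> 'I_5.
  by apply: val_inj; rewrite /= inordK.
have -> : (widen_ord (leqnSn 4) (widen_ord (leqnSn 3) (widen_ord (leqnSn 2)
  ord_max))) = inord 1 :> 'I_5 by apply: val_inj; rewrite /= inordK.
have -> : (widen_ord (leqnSn 4) (widen_ord (leqnSn 3) ord_max)) = inord 2 :> 'I_5.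
  by apply: val_inj; rewrite /= inordK.
have -> : widen_ord (leqnSn 4) ord_max = inord 3 :> 'I_5.
  by apply: val_inj; rewrite /= inordK.
have -> : ord_max = inord 4 :> 'I_5 by apply: val_inj; rewrite /= inordK.
by rewrite -!val_eqE /= !inordK //= !mulr1 mulrN1 mulNr.
Qed.

Lemma minkI_unit : minkI \in unitmx.
Proof.
rewrite unitmxE det_diag unitfE; apply/prodf_neq0 => i _; rewrite mxE.
by case: ifP => _; rewrite ?oppr_eq0 oner_eq0.
Qed.

Section Frame.
Variable F : 'I_5 -> 'rV[R]_5.
Hypotheses (F_orth : forall i j, i != j -> mink (F i) (F j) = 0)
           (F_n0 : forall i, mink (F i) (F i) != 0).
Let M : 'M[R]_5 := \matrix_i F i.

Let gramM : M *m minkI *m M^T = diag_mx (\row_i mink (F i) (F i)).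
Proof.
apply/matrixP => i j; transitivity (mink (F i) (F j)).
  rewrite mink_mulmx !mxE; apply: eq_bigr => k _; rewrite !mxE; congr (_ * _).
  by apply: eq_bigr => l _; rewrite !mxE.
by rewrite !mxE; have [->|ij] := eqVneq i j; rewrite ?mulr1n // F_orth // mulr0n.
Qed.

(** The Gram matrix [M *m minkI *m M^T] is diagonal with nonzero entries, so five pairwise
    orthogonal non-null vectors form a basis. *)
Let M_unit : M \in unitmx.
Proof.
have : diag_mx (\row_i mink (F i) (F i)) \in unitmx.
  rewrite unitmxE det_diag unitfE; apply/prodf_neq0 => i _; by rewrite mxE.
by rewrite -gramM !unitmx_mul => /andP[/andP[]].
Qed.

Lemma mink_frame_det : \det (\matrix_i F i) != 0.
Proof. by rewrite -unitfE -unitmxE; exact: M_unit. Qed.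

Lemma mink_frame_eq0 w : (forall i, mink (F i) w = 0) -> w = 0.
Proof.
move=> Fw; have : M *m minkI *m w^T = 0.
  apply/matrixP => i j; rewrite ord1 [RHS]mxE -(Fw i) mink_mulmx !mxE.
  apply: eq_bigr => k _; rewrite !mxE; congr (_ * _).
  by apply: eq_bigr => l _; rewrite !mxE.
have uMI : M *m minkI \in unitmx by rewrite unitmx_mul M_unit minkI_unit.
move=> /(congr1 (mulmx (invmx (M *m minkI)))); rewrite mulKmx // mulmx0.
by move=> /(congr1 trmx); rewrite trmxK trmx0.
Qed.

End Frame.

Section ExplicitFrame.
Variables E1 E2 E3 E4 E5 : 'rV[R]_5.
Hypotheses (n1 : mink E1 E1 != 0) (n2 : mink E2 E2 != 0)
  (n3 : mink E3 E3 != 0) (n4 : mink E4 E4 != 0) (n5 : mink E5 E5 != 0).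
Hypotheses (o12 : mink E1 E2 = 0) (o13 : mink E1 E3 = 0)
  (o14 : mink E1 E4 = 0) (o15 : mink E1 E5 = 0) (o23 : mink E2 E3 = 0)
  (o24 : mink E2 E4 = 0) (o25 : mink E2 E5 = 0) (o34 : mink E3 E4 = 0)
  (o35 : mink E3 E5 = 0) (o45 : mink E4 E5 = 0).

Let F (i : 'I_5) := nth 0 [:: E1; E2; E3; E4; E5] i.

Let F_orth i j : i != j -> mink (F i) (F j) = 0.
Proof.
move: i j; apply: forall_I5; apply: forall_I5;
  rewrite -val_eqE /F /= !inordK //= => _; by rewrite // minkC.
Qed.

Let F_n0 i : mink (F i) (F i) != 0.
Proof. by move: i; apply: forall_I5; rewrite /F /= inordK. Qed.

Lemma frame_det :
  \det (\matrix_(i < 5) nth 0 [:: E1; E2; E3; E4; E5] i) != 0.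
Proof. exact: mink_frame_det F_orth F_n0. Qed.

(** Nondegeneracy in the form in which it is used: most structure equations are checked by comparing
    five inner products. *)
Lemma frame_ext w w' : mink w E1 = mink w' E1 -> mink w E2 = mink w' E2 ->
  mink w E3 = mink w' E3 -> mink w E4 = mink w' E4 -> mink w E5 = mink w' E5 ->
  w = w'.
Proof.
move=> e1 e2 e3 e4 e5; apply/eqP; rewrite -subr_eq0; apply/eqP.
apply: (mink_frame_eq0 F_orth F_n0); apply: forall_I5;
  by rewrite /F inordK //= minkC minkDl minkNl ?e1 ?e2 ?e3 ?e4 ?e5 subrr.
Qed.

End ExplicitFrame.

(** Four linear conditions on five unknowns have a nonzero solution, found in the kernel of [N].
    Being orthogonal to the timelike [p], it is spacelike and can be normalized. *)
Lemma exists_unit_normal E1 E2 E3 p : mink p p = -1 ->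
  exists E4 : 'rV[R]_5, [/\ mink E4 E4 = 1, mink E4 E1 = 0, mink E4 E2 = 0,
    mink E4 E3 = 0 & mink E4 p = 0].
Proof.
move=> pp; pose N : 'M[R]_(5, 4) :=
  minkI *m (\matrix_(i < 4) nth 0 [:: E1; E2; E3; p] i)^T.
have kN : kermx N != 0.
  rewrite kermx_eq0 /row_free neq_ltn; apply/orP; left.
  exact: leq_ltn_trans (rank_leq_col N) _.
have [i zi] : exists i, row i (kermx N) != 0.
  apply/existsP; apply: contraR kN; rewrite negb_exists => /forallP r0.
  by apply/eqP/row_matrixP => i; rewrite row0; apply/eqP; have := r0 i;
    rewrite negbK.
set z := row i _ in zi; have zN : z *m N = 0 by rewrite -row_mul mulmx_ker row0.
have zE (k : 'I_4) : mink z (nth 0 [:: E1; E2; E3; p] k) = 0.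
  have := congr1 (fun X : 'M[R]_(1, 4) => X 0 k) zN; rewrite mulmxA mxE [RHS]mxE.
  by rewrite mink_mulmx [in X in _ -> X]mxE => {2}<-; apply: eq_bigr => l _;
    rewrite !mxE.
have z1 : mink z E1 = 0 by have := zE (inord 0); rewrite inordK.
have z2 : mink z E2 = 0 by have := zE (inord 1); rewrite inordK.
have z3 : mink z E3 = 0 by have := zE (inord 2); rewrite inordK.
have zp : mink z p = 0 by have := zE (inord 3); rewrite inordK.
have [zz0 zz] : 0 <= mink z z /\ (mink z z = 0 -> z = 0).
  by apply: (spacelike_ge0 pp); rewrite minkC.
have {zz0}zz0 : 0 < mink z z.
  by rewrite lt_neqAle zz0 andbT eq_sym; apply: contraNneq zi => /zz ->.
exists ((Num.sqrt (mink z z))^-1 *: z); split; rewrite ?minkZl ?minkZr.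
- by rewrite mulrA -invfM -expr2 sqr_sqrtr ?ltW // mulVf ?gt_eqF.
- by rewrite z1 mulr0.
- by rewrite z2 mulr0.
- by rewrite z3 mulr0.
- by rewrite zp mulr0.
Qed.

End MinkowskiAlgebra.

(** * Immersed surfaces in hyperbolic space *)

Section SmoothInverse.
Context {R : realType}.
Local Opaque derive.

Lemma smooth_Rinv : smooth [set t : R | t != 0] (fun t : R => t^-1).
Proof.
have oP : open [set t : R | t != 0] by exact: open_neq.
have dV (t : R) : t != 0 -> differentiable (fun t : R => t^-1) t.
  by move=> t0; exact: (differentiableV (f := id)).
elim=> [t /= t0|k IH]; first exact/differentiable_continuous/dV.
split=> // v; apply: (class_C_eq oP _ (class_C_bilin (@scale_continuous _ _) oP
  (class_C_cst k _ (- v)) (class_C_bilin (@scale_continuous _ _) oP IH IH))).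
move=> t t0; have := deriveV (f := id) t0 (@derivable_id _ _ t v).
rewrite derive_id => ->; rewrite -[LHS]/(- v * (t^-1 * t^-1)) -[RHS]/(- t ^- 2 * v).
by rewrite expr2 invfM mulNr mulNr mulrC.
Qed.

Lemma smoothV (V : normedModType R) (A : set V) (F : V -> R) : open A ->
  (forall x, A x -> F x != 0) -> smooth A F -> smooth A (fun x => (F x)^-1).
Proof. by move=> oA F0 sF; exact: smooth_comp_real F0 sF smooth_Rinv. Qed.

Lemma smooth_comp_powR (V : normedModType R) (A : set V) (F : V -> R) a :
  open A -> (forall x, A x -> 0 < F x) -> smooth A F ->
  smooth A (fun x => F x `^ a).
Proof. by move=> oA F0 sF; exact: smooth_comp_real F0 sF (smooth_powR a). Qed.

Lemma smooth_sqrt (V : normedModType R) (A : set V) (F : V -> R) :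
  open A -> (forall x, A x -> 0 < F x) -> smooth A F ->
  smooth A (fun x => Num.sqrt (F x)).
Proof.
move=> oA F0 sF; apply: (smooth_eq oA _ (smooth_comp_powR 2^-1 oA F0 sF)) => x Ax.
by rewrite powR12_sqrt // ltW // F0.
Qed.

End SmoothInverse.

Section LocalGeometryOfImmersion.
Context {R : realType}.
Local Opaque derive.
Variables (Om : set 'rV[R]_2) (Phi : 'rV[R]_2 -> 'rV[R]_5).
Hypotheses (oOm : open Om) (sPhi : smooth Om Phi).
Hypothesis HPhi : forall x, Om x -> H4 (Phi x).
Hypothesis immPhi : forall x, Om x -> row_free (jacobian Phi x).
Implicit Types (x v w : 'rV[R]_2) (i j k : 'I_2).

Local Notation Ph i := ('D_(basis_vec i) Phi).

Lemma smooth_Ph i : smooth Om (Ph i).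
Proof. exact: smooth_derive. Qed.

Lemma diff_Phi x : Om x -> differentiable Phi x.
Proof. exact: smooth_differentiable. Qed.

Lemma diff_Ph v x : Om x -> differentiable ('D_v Phi) x.
Proof. by move=> Ox; exact: smooth_differentiable (smooth_derive _ sPhi) Ox. Qed.

Lemma mink_PhiPhi x : Om x -> mink (Phi x) (Phi x) = -1.
Proof. by move=> /HPhi[]. Qed.

Lemma mink_dPhi_Phi v x : Om x -> mink ('D_v Phi x) (Phi x) = 0.
Proof.
move=> Ox; have dP := diff_Phi Ox.
have : 'D_v (fun y => mink (Phi y) (Phi y)) x = 0.
  rewrite (@eq_derive_open _ _ _ _ _ (fun=> -1 : R) x v oOm mink_PhiPhi Ox).
  exact: derive_const.
rewrite derive_mink // [mink (Phi x) _]minkC -mulr2n => /eqP.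
by rewrite mulrn_eq0 => /eqP.
Qed.

(** Obtained by differentiating [mink ('D_w Phi y) (Phi y) = 0]. As <Phi, Phi> = -1, this is the
    origin of the term [gram Phi x i j *: Phi x] in [gauss_formula]. *)
Lemma mink_ddPhi_Phi v w x : Om x ->
  mink ('D_v ('D_w Phi) x) (Phi x) = - mink ('D_v Phi x) ('D_w Phi x).
Proof.
move=> Ox; have : 'D_v (fun y => mink ('D_w Phi y) (Phi y)) x = 0.
  rewrite (@eq_derive_open _ _ _ _ _ (fun=> 0 : R) x v oOm (mink_dPhi_Phi w) Ox).
  exact: derive_const.
rewrite derive_mink; [|exact: diff_Ph|exact: diff_Phi].
by move=> /eqP; rewrite addr_eq0 => /eqP ->; rewrite minkC.
Qed.

Lemma dPhi_row v x : Om x -> 'D_v Phi x = \sum_j v 0 j *: Ph j x.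
Proof. by move=> Ox; rewrite derive_row //; exact: diff_Phi. Qed.

Lemma dPhi_eq0 v x : Om x -> 'D_v Phi x = 0 -> v = 0.
Proof.
move=> Ox; rewrite deriveEjacobian; last exact: diff_Phi.
by move=> v0; apply: (row_free_inj (immPhi Ox)); rewrite v0 mul0mx.
Qed.

Definition first_form x v w := mink ('D_v Phi x) ('D_w Phi x).

Lemma first_form_gram x v w : Om x ->
  first_form x v w = \sum_i \sum_j v 0 i * w 0 j * gram Phi x i j.
Proof.
move=> Ox; rewrite /first_form !dPhi_row // mink_suml; apply: eq_bigr => i _.
rewrite minkZl mink_sumr mulr_sumr; apply: eq_bigr => j _.
by rewrite minkZr mulrA mxE.
Qed.

Lemma first_formC x v w : first_form x v w = first_form x w v.
Proof. exact: minkC. Qed.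

(** Tangent vectors are orthogonal to the timelike [Phi x], hence spacelike or zero, and the
    immersion hypothesis excludes zero. The induced metric is Riemannian. *)
Lemma first_form_pos x v : Om x -> v != 0 -> 0 < first_form x v v.
Proof.
move=> Ox v0.
have [m0 m1] : 0 <= first_form x v v /\ (first_form x v v = 0 -> 'D_v Phi x = 0).
  apply: (spacelike_ge0 (mink_PhiPhi Ox)); rewrite minkC; exact: mink_dPhi_Phi.
rewrite lt_neqAle m0 andbT eq_sym; apply: contraNneq v0.
by move=> /m1 /(dPhi_eq0 Ox) ->.
Qed.

Lemma gram_mulE x v w : (v *m gram Phi x *m w^T) 0 0 =
  \sum_i \sum_j v 0 i * w 0 j * gram Phi x i j.
Proof.
rewrite mxE exchange_big; apply: eq_bigr => j _; rewrite !mxE mulr_suml.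
by apply: eq_bigr => i _; rewrite mulrAC.
Qed.

Lemma gram_unit x : Om x -> gram Phi x \in unitmx.
Proof.
move=> Ox; rewrite -row_free_unit -kermx_eq0; apply/rowV0P => v /sub_kermxP vg.
apply/eqP; apply: contraTT isT => v0.
have := first_form_pos Ox v0; rewrite first_form_gram // -gram_mulE vg mul0mx mxE.
by rewrite ltxx.
Qed.

Lemma smooth_gram i j : smooth Om (fun x => gram Phi x i j).
Proof.
apply: (smooth_eq oOm _ (smooth_mink oOm (smooth_Ph i) (smooth_Ph j))) => x _.
by rewrite mxE.
Qed.

Lemma smooth_gram_inv i j : smooth Om (fun x => gram_inv Phi x i j).
Proof.
have cof (B : 'M[R]_2) k l :
    cofactor B k l = (-1) ^+ (k + l) * B (lift k 0) (lift l 0).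
  by rewrite /cofactor det_mx11 !mxE.
have sdet : smooth Om (fun x => \det (gram Phi x)).
  apply: (smooth_eq oOm _ (smooth_sum (index_enum 'I_2) oOm (fun k =>
    smoothM oOm (smooth_gram 0 k) (smoothM oOm
      (smooth_cst Om ((-1) ^+ (0 + k)%N : R)) (smooth_gram (lift 0 0) (lift k 0)))))).
  move=> x _; rewrite (expand_det_row _ 0); apply: eq_bigr => k _.
  by rewrite cof.
have det0 x : Om x -> \det (gram Phi x) != 0.
  by move=> Ox; rewrite -unitfE -unitmxE gram_unit.
apply: (smooth_eq oOm _ (smoothM oOm (smoothV oOm det0 sdet) (smoothM oOm
  (smooth_cst Om ((-1) ^+ (j + i)%N : R)) (smooth_gram (lift j 0) (lift i 0))))).
by move=> x Ox; rewrite /gram_inv /invmx gram_unit // [RHS]mxE [X in _ = _ * X]mxE cof.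
Qed.

Lemma smooth_christoffel i j k : smooth Om (christoffel Phi i j k).
Proof.
have sdg a b l : smooth Om (dgram Phi a b l).
  exact: smooth_derive (smooth_gram b l).
apply: smoothM => //; first exact: smooth_cst.
apply: smooth_sum => // l; apply: smoothM => //; first exact: smooth_gram_inv.
by apply: smoothB => //; apply: smoothD.
Qed.

End LocalGeometryOfImmersion.

(** The interchange of sums behind the passage from coordinate fields to arbitrary fields, stated in
    an abstract module because it serves for both [Phi] and the tension field. *)
Lemma bilinear_gauss (R : realType) (W : lmodType R) (n : nat)
    (v e : 'I_n -> R) (D B : 'I_n -> 'I_n -> W) (G : 'I_n -> 'I_n -> 'I_n -> R)
    (P : 'I_n -> W) (g : 'I_n -> 'I_n -> R) (p : W) :
  (forall i j, D i j = B i j + \sum_k G i j k *: P k + g i j *: p) ->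
  \sum_j e j *: \sum_i v i *: D i j =
  \sum_i \sum_j (v i * e j) *: B i j +
  \sum_k (\sum_i \sum_j (v i * e j) * G i j k) *: P k +
  (\sum_i \sum_j v i * e j * g i j) *: p.
Proof.
move=> DE; transitivity (\sum_i \sum_j (v i * e j) *: D i j).
  rewrite exchange_big; apply: eq_bigr => j _ /=.
  rewrite scaler_sumr; apply: eq_bigr => i _.
  by rewrite scalerA mulrC.
rewrite scaler_suml.
under [X in _ = _ + X + _]eq_bigr do rewrite scaler_suml.
rewrite [X in _ = _ + X + _]exchange_big -!big_split /=; apply: eq_bigr => i _.
under [X in _ = _ + X + _]eq_bigr do rewrite scaler_suml.
rewrite [X in _ = _ + X + _]exchange_big scaler_suml -!big_split /=.
apply: eq_bigr => j _.
rewrite DE !scalerDr scaler_sumr scalerA; congr (_ + _ + _).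
by apply: eq_bigr => k _; rewrite scalerA.
Qed.

(** * Christoffel symbols and the Gauss formula *)

Section GaussFormula.
Context {R : realType}.
Local Opaque derive.
Variables (Om : set 'rV[R]_2) (Phi : 'rV[R]_2 -> 'rV[R]_5).
Hypotheses (oOm : open Om) (sPhi : smooth Om Phi).
Hypothesis HPhi : forall x, Om x -> H4 (Phi x).
Hypothesis immPhi : forall x, Om x -> row_free (jacobian Phi x).
Implicit Types (x v w : 'rV[R]_2) (i j k l : 'I_2).

Local Notation Ph i := ('D_(basis_vec i) Phi).

Lemma gramC x i j : gram Phi x i j = gram Phi x j i.
Proof. by rewrite !mxE; exact: minkC. Qed.

Lemma ddPhiC x i j : Om x ->
  'D_(basis_vec i) (Ph j) x = 'D_(basis_vec j) (Ph i) x.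
Proof. by move=> Ox; exact: derive_comm oOm sPhi Ox. Qed.

Lemma dgramE i j k x : Om x -> dgram Phi i j k x =
  mink ('D_(basis_vec i) (Ph j) x) (Ph k x) +
  mink (Ph j x) ('D_(basis_vec i) (Ph k) x).
Proof.
move=> Ox; rewrite /dgram.
have -> : (fun y => gram Phi y j k) = (fun y => mink (Ph j y) (Ph k y)).
  by apply/funext => y; rewrite mxE.
by apply: derive_mink; exact: diff_Ph sPhi _ _ Ox.
Qed.

(** Of the six terms in the three derivatives of the metric, four cancel by symmetry of second
    derivatives. Hence the Christoffel symbols, defined from the metric alone, describe the
    tangential part of the flat derivative. *)
Lemma koszul i j l x : Om x ->
  \sum_k christoffel Phi i j k x * gram Phi x k l =
  mink ('D_(basis_vec i) (Ph j) x) (Ph l x).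
Proof.
move=> Ox; pose S m := dgram Phi i j m x + dgram Phi j i m x - dgram Phi m i j x.
have SE : S l = 2 * mink ('D_(basis_vec i) (Ph j) x) (Ph l x).
  pose D a b := 'D_(basis_vec a) (Ph b) x; pose P a := Ph a x.
  have DC a b : D a b = D b a by exact: ddPhiC.
  have dE a b c : dgram Phi a b c x = mink (D a b) (P c) + mink (P b) (D a c).
    by exact: dgramE.
  rewrite /S -/(D i j) -/(P l); move: (D) (P) DC dE => {}D {}P DC dE.
  rewrite !dE (DC j i) (DC l i) (DC l j) [mink (P j) _]minkC [mink (P i) _]minkC.
  by rewrite [mink _ (P i)]minkC; ring.
transitivity (2^-1 * \sum_m S m * \sum_k gram Phi x l k * gram_inv Phi x k m).
  rewrite mulr_sumr; under [RHS]eq_bigr do rewrite !mulr_sumr.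
  rewrite exchange_big; apply: eq_bigr => k _.
  rewrite /christoffel -mulrA mulr_suml mulr_sumr; apply: eq_bigr => m _.
  by rewrite -/(S m) (gramC x k l); ring.
rewrite /gram_inv (bigD1 l) //= [X in _ * (_ + X)]big1 => [|m ml].
  have := congr1 (fun X : 'M[R]_2 => X l l) (mulmxV (gram_unit oOm sPhi HPhi immPhi Ox)).
  by rewrite mxE [RHS]mxE eqxx => ->; rewrite SE mulr1 addr0 mulrA mulVf ?mul1r // pnatr_eq0.
have := congr1 (fun X : 'M[R]_2 => X l m) (mulmxV (gram_unit oOm sPhi HPhi immPhi Ox)).
by rewrite mxE [RHS]mxE eq_sym (negbTE ml) => ->; rewrite mulr0.
Qed.

Lemma smooth_second_form_basis i j : smooth Om (second_form_basis Phi i j).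
Proof.
apply: smoothB => //; last first.
  apply: smooth_sum => // k; apply: smoothZ => //.
    exact: smooth_christoffel.
  exact: smooth_derive.
have sd : smooth Om ('D_(basis_vec i) (Ph j)) by do 2!apply: smooth_derive.
by apply: smoothD => //; apply: smoothZ => //; exact: smooth_mink.
Qed.

Lemma gauss_formula i j x : Om x -> 'D_(basis_vec i) (Ph j) x =
  second_form_basis Phi i j x + \sum_k christoffel Phi i j k x *: Ph k x +
  gram Phi x i j *: Phi x.
Proof.
move=> Ox; rewrite /second_form_basis subrK /nabla_phi /projH4.
by rewrite (mink_ddPhi_Phi oOm sPhi HPhi) // mxE scaleNr subrK.
Qed.

Lemma second_form_basis_Phi i j x : Om x ->
  mink (second_form_basis Phi i j x) (Phi x) = 0.
Proof.
move=> Ox; have T : mink (\sum_k christoffel Phi i j k x *: Ph k x) (Phi x) = 0.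
  rewrite mink_suml; apply: big1 => k _.
  by rewrite minkZl (mink_dPhi_Phi oOm sPhi HPhi) // mulr0.
move: (gauss_formula i j Ox); move: (second_form_basis Phi i j x) => B G.
have := congr1 (mink^~ (Phi x)) G.
rewrite (mink_ddPhi_Phi oOm sPhi HPhi) // !minkDl minkZl T addr0.
rewrite (mink_PhiPhi HPhi Ox) mxE mulrN1 -[LHS]add0r => E.
exact: esym (addIr _ E).
Qed.

Lemma second_form_basis_Ph i j l x : Om x ->
  mink (second_form_basis Phi i j x) (Ph l x) = 0.
Proof.
move=> Ox.
have T : mink (\sum_k christoffel Phi i j k x *: Ph k x) (Ph l x) =
    mink ('D_(basis_vec i) (Ph j) x) (Ph l x).
  rewrite -(koszul i j l Ox) mink_suml; apply: eq_bigr => k _.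
  by rewrite minkZl mxE.
move: (gauss_formula i j Ox); move: (second_form_basis Phi i j x) => B G.
have := congr1 (mink^~ (Ph l x)) G.
rewrite !minkDl minkZl T [mink (Phi x) _]minkC (mink_dPhi_Phi oOm sPhi HPhi) //.
rewrite mulr0 addr0 -[LHS]add0r => E.
exact: esym (addIr _ E).
Qed.

Lemma second_form_basisC i j x : Om x ->
  second_form_basis Phi i j x = second_form_basis Phi j i x.
Proof.
move=> Ox.
have dC l : dgram Phi l i j x = dgram Phi l j i x.
  rewrite /dgram; have -> // : (fun y => gram Phi y i j) = (fun y => gram Phi y j i).
  by apply/funext => y; exact: gramC.
have GC k : christoffel Phi i j k x = christoffel Phi j i k x.
  rewrite /christoffel; congr (_ * _); apply: eq_bigr => l _.
  by rewrite dC [dgram Phi i j l x + _]addrC.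
apply: (congr2 (fun D S => D + mink D (Phi x) *: Phi x - S)).
  exact: ddPhiC.
by apply: eq_bigr => k _; apply: (congr1 ( *:%R^~ _)); exact: GC.
Qed.

(** The Levi-Civita derivative on the surface, in coordinates, of the field [e] in the direction
    [v]. *)
Definition cov (e : 'rV[R]_2 -> 'rV[R]_2) v x : 'rV[R]_2 :=
  'D_v e x + \row_k \sum_i \sum_j (v 0 i * e x 0 j) * christoffel Phi i j k x.

(** Needed because the frame fields are not coordinate fields. The three summands are mutually
    orthogonal: normal to the surface inside the hyperboloid, tangent to the surface, and along the
    position vector. *)
Lemma gauss_formula_along e v x : smooth Om e -> Om x ->
  'D_v (fun y => 'D_(e y) Phi y) x =
  second_form Phi v (e x) x + 'D_(cov e v x) Phi x + first_form Phi x v (e x) *: Phi x.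
Proof.
move=> se Ox; have dP := diff_Phi sPhi Ox.
apply: etrans (derive_derive_along v oOm se sPhi Ox) _.
have -> : 'D_(cov e v x) Phi x = 'D_('D_v e x) Phi x + \sum_k (\sum_i \sum_j
    (v 0 i * e x 0 j) * christoffel Phi i j k x) *: Ph k x.
  rewrite /cov derive_dirD //; congr (_ + _); rewrite derive_row //.
  by apply: eq_bigr => k _; rewrite mxE.
rewrite [second_form _ _ _ _ + (_ + _)]addrCA -addrA; congr (_ + _).
have row2 j : 'D_v (Ph j) x = \sum_i v 0 i *: 'D_(basis_vec i) (Ph j) x.
  by rewrite derive_row //; exact: diff_Ph sPhi _ _ Ox.
rewrite (first_form_gram sPhi) //.
apply: etrans (bilinear_gauss (fun i => v 0 i) (fun j => e x 0 j)
  (fun i j => gauss_formula i j Ox)).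
by apply: eq_bigr => j _; apply: (congr1 ( *:%R _)); exact: row2.
Qed.

Lemma mink_second_form_dPhi v w e x : Om x ->
  mink (second_form Phi v w x) ('D_e Phi x) = 0.
Proof.
move=> Ox; rewrite (dPhi_row sPhi) // mink_sumr big1 // => l _.
rewrite minkZr mink_suml big1 ?mulr0 // => i _; rewrite mink_suml big1 // => j _.
by rewrite minkZl second_form_basis_Ph // mulr0.
Qed.

Lemma second_formC v w x : Om x -> second_form Phi v w x = second_form Phi w v x.
Proof.
move=> Ox; rewrite /second_form exchange_big /=.
apply: eq_bigr => i _; apply: eq_bigr => j _.
by rewrite second_form_basisC // mulrC.
Qed.

Lemma mink_derive_normal e v x eta : smooth Om e -> Om x ->
  (forall w, mink ('D_w Phi x) eta = 0) -> mink (Phi x) eta = 0 ->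
  mink ('D_v (fun y => 'D_(e y) Phi y) x) eta =
  mink (second_form Phi v (e x) x) eta.
Proof.
move=> se Ox tan pos; rewrite gauss_formula_along // !minkDl minkZl tan pos.
by rewrite mulr0 !addr0.
Qed.

Lemma mink_derive_tangent e v w x : smooth Om e -> Om x ->
  mink ('D_v (fun y => 'D_(e y) Phi y) x) ('D_w Phi x) =
  first_form Phi x (cov e v x) w.
Proof.
move=> se Ox; rewrite gauss_formula_along // !minkDl minkZl.
rewrite mink_second_form_dPhi // [mink (Phi x) _]minkC.
by rewrite (mink_dPhi_Phi oOm sPhi HPhi) // mulr0 addr0 add0r.
Qed.

Lemma smooth_mean_vec : smooth Om (mean_vec Phi).
Proof.
apply: smoothZ => //; first exact: smooth_cst.
apply: smooth_sum => // i; apply: smooth_sum => // j; apply: smoothZ => //.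
  exact: smooth_gram_inv.
exact: smooth_second_form_basis.
Qed.

Lemma mean_vec_Ph v x : Om x -> mink (mean_vec Phi x) ('D_v Phi x) = 0.
Proof.
move=> Ox; rewrite minkZl mink_suml big1 ?mulr0 // => i _.
rewrite mink_suml big1 // => j _; rewrite minkZl (dPhi_row sPhi) // mink_sumr.
rewrite big1 ?mulr0 // => l _; by rewrite minkZr second_form_basis_Ph // mulr0.
Qed.

Lemma mean_vec_Phi x : Om x -> mink (mean_vec Phi x) (Phi x) = 0.
Proof.
move=> Ox; rewrite minkZl mink_suml big1 ?mulr0 // => i _.
rewrite mink_suml big1 // => j _.
by rewrite minkZl second_form_basis_Phi // mulr0.
Qed.

End GaussFormula.

Section TwoByTwo.
Context {R : realType}.

Lemma forall_I2 (P : 'I_2 -> Prop) : P 0 -> P 1 -> forall i, P i.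
Proof.
move=> P0 P1 i; have [->|->] : i = 0 \/ i = 1; [|exact: P0|exact: P1].
by case: i => -[|[|//]] ?; [left|right]; apply: val_inj.
Qed.

Lemma sum2 (V : nmodType) (F : 'I_2 -> V) : \sum_i F i = F 0 + F 1.
Proof.
rewrite big_ord_recl big_ord1; congr (_ + F _); exact: val_inj.
Qed.

Lemma det2 (M : 'M[R]_2) : \det M = M 0 0 * M 1 1 - M 0 1 * M 1 0.
Proof.
have l0 : lift 0 0 = 1 :> 'I_2 by exact: val_inj.
have l1 : lift 1 0 = 0 :> 'I_2 by exact: val_inj.
rewrite (expand_det_row _ 0) sum2 /cofactor !det_mx11 !mxE l0 l1.
by rewrite expr0 expr1 mul1r mulN1r mulrN.
Qed.

End TwoByTwo.

(** * Orthonormal frames of the tangent plane *)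

Section OrthonormalTangentFrame.
Context {R : realType}.
Local Opaque derive.
Variables (Om : set 'rV[R]_2) (Phi : 'rV[R]_2 -> 'rV[R]_5).
Hypotheses (oOm : open Om) (sPhi : smooth Om Phi).
Hypothesis HPhi : forall x, Om x -> H4 (Phi x).
Hypothesis immPhi : forall x, Om x -> row_free (jacobian Phi x).
Implicit Types (x v w e : 'rV[R]_2) (i j k l : 'I_2).

Lemma first_formZ x a b v w : Om x ->
  first_form Phi x (a *: v) (b *: w) = a * b * first_form Phi x v w.
Proof.
move=> Ox; rewrite (first_form_gram sPhi) // (first_form_gram sPhi) //.
rewrite mulr_sumr; apply: eq_bigr => i _; rewrite mulr_sumr.
by apply: eq_bigr => j _; rewrite !mxE; ring.
Qed.

Lemma first_form2 x v w : Om x -> first_form Phi x v w =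
  v 0 0 * w 0 0 * gram Phi x 0 0 + (v 0 0 * w 0 1 + v 0 1 * w 0 0) * gram Phi x 0 1
  + v 0 1 * w 0 1 * gram Phi x 1 1.
Proof.
move=> Ox; rewrite (first_form_gram sPhi) //; have := gramC Phi x 1 0.
by move: (gram Phi x) => g gC; rewrite !sum2 gC; ring.
Qed.

(* The rotation by a right angle, up to the factor [Num.sqrt (\det (gram x))]. *)
Definition gram_rot x v : 'rV[R]_2 := \row_j
  (if j == 0 then - (v 0 0 * gram Phi x 0 1 + v 0 1 * gram Phi x 1 1)
   else v 0 0 * gram Phi x 0 0 + v 0 1 * gram Phi x 0 1).

Lemma first_form_rot x v : Om x -> first_form Phi x v (gram_rot x v) = 0.
Proof.
move=> Ox; rewrite first_form2 // /gram_rot; move: (gram Phi x) => g.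
by rewrite !mxE /=; ring.
Qed.

Lemma first_form_rot_rot x v : Om x ->
  first_form Phi x (gram_rot x v) (gram_rot x v) = \det (gram Phi x) * first_form Phi x v v.
Proof.
move=> Ox; rewrite !first_form2 // det2 /gram_rot; have := gramC Phi x 1 0.
by move: (gram Phi x) => g gC; rewrite gC !mxE /=; ring.
Qed.

(** The rotation [gram_rot] multiplies squared lengths by this determinant, and both a nonzero
    vector and its rotated image have positive length. *)
Lemma det_gram_gt0 x : Om x -> 0 < \det (gram Phi x).
Proof.
move=> Ox; pose v : 'rV[R]_2 := delta_mx 0 0.
have v0 : v != 0.
  apply/eqP => /rowP/(_ 0); rewrite !mxE /= => /eqP; by rewrite oner_eq0.
have mv := first_form_pos oOm sPhi HPhi immPhi Ox v0.
have r0 : gram_rot x v != 0.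
  apply/eqP; move: mv; rewrite first_form2 // /gram_rot; move: (gram Phi x) => g mv.
  move=> /rowP/(_ 1); move: mv.
  by rewrite !mxE /= !(mul0r, mul1r, addr0, mulr0) => + z; rewrite z ltxx.
have := first_form_pos oOm sPhi HPhi immPhi Ox r0.
by rewrite first_form_rot_rot // pmulr_lgt0.
Qed.

Section AtPoint.
Variables (x v w : 'rV[R]_2).
Hypotheses (Ox : Om x) (vv : first_form Phi x v v = 1) (ww : first_form Phi x w w = 1)
  (vw : first_form Phi x v w = 0).

(** With the frame as rows of [P], orthonormality reads P g P^T = 1, whence g^-1 = P^T P. This turns
    metric traces into sums over the frame, as in [trace_frame]. *)
Lemma gram_inv_frame i j : gram_inv Phi x i j = v 0 i * v 0 j + w 0 i * w 0 j.
Proof.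
pose P : 'M[R]_2 := \matrix_(a, b) (if a == 0 then v 0 b else w 0 b).
have PgP : P *m (gram Phi x *m P^T) = 1%:M.
  have := vv; have := ww; have := vw; rewrite !first_form2 //.
  have := gramC Phi x 1 0; move: (gram Phi x) => g gC e1 e2 e3.
  rewrite mulmxA; apply/matrixP.
  apply: forall_I2; apply: forall_I2;
    rewrite !mxE !sum2 !mxE !sum2 !mxE /= ?mulr1n ?mulr0n gC;
    [rewrite -e3|rewrite -e1|rewrite -e1|rewrite -e2]; ring.
have gPP : gram Phi x *m (P^T *m P) = 1%:M.
  by rewrite mulmxA; exact: mulmx1C.
have -> : gram_inv Phi x = P^T *m P.
  rewrite /gram_inv -[LHS]mulmx1 -gPP mulKmx //.
  exact: gram_unit oOm sPhi HPhi immPhi _ Ox.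
by rewrite mxE sum2 !mxE /=.
Qed.

Lemma tangent_expansion u : u = first_form Phi x u v *: v + first_form Phi x u w *: w.
Proof.
have gu := gram_unit oOm sPhi HPhi immPhi Ox.
apply/rowP => k.
have E : ((u *m gram Phi x) *m gram_inv Phi x) 0 k =
    first_form Phi x u v * v 0 k + first_form Phi x u w * w 0 k.
  rewrite [LHS]mxE sum2 !gram_inv_frame !first_form2 //.
  have := gramC Phi x 1 0; move: (gram Phi x) => g gC.
  by rewrite !mxE !sum2 gC; ring.
rewrite mulmxK // in E.
by rewrite [LHS]E [RHS]mxE; congr (_ + _); rewrite mxE.
Qed.

Lemma dPhi_expansion u :
  'D_u Phi x = first_form Phi x u v *: 'D_v Phi x + first_form Phi x u w *: 'D_w Phi x.
Proof.
have dP := diff_Phi sPhi Ox.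
rewrite {1}(tangent_expansion u) derive_dirD // derive_dirZ //.
by rewrite [X in _ + X]derive_dirZ.
Qed.

Lemma trace_frame (W : lmodType R) (Q : 'I_2 -> 'I_2 -> W) :
  \sum_i \sum_j gram_inv Phi x i j *: Q i j =
  \sum_i \sum_j (v 0 i * v 0 j) *: Q i j +
  \sum_i \sum_j (w 0 i * w 0 j) *: Q i j.
Proof.
rewrite -big_split; apply: eq_bigr => i _ /=; rewrite -big_split.
by apply: eq_bigr => j _; rewrite gram_inv_frame scalerDl.
Qed.

End AtPoint.

End OrthonormalTangentFrame.

(** * The frame attached to the mean curvature *)

Section MeanCurvatureFrame.
Context {R : realType}.
Local Opaque derive.
Variables (Om : set 'rV[R]_2) (Phi : 'rV[R]_2 -> 'rV[R]_5) (h : 'rV[R]_2 -> R).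
Hypotheses (oOm : open Om) (sPhi : smooth Om Phi).
Hypothesis HPhi : forall x, Om x -> H4 (Phi x).
Hypothesis immPhi : forall x, Om x -> row_free (jacobian Phi x).
Hypothesis hE : forall x, Om x -> h x = mnorm (mean_vec Phi x).
Hypothesis h_gt0 : forall x, Om x -> 0 < h x.
Hypothesis grad_neq0 : forall x, Om x -> gradient Phi h x != 0.
Implicit Types (x v w e : 'rV[R]_2) (i j k l : 'I_2).

(** The square root of a negative real is 0 here, so the positivity of [h] already shows that
    [mean_vec Phi x] is spacelike. *)
Lemma mink_mean_vec x : Om x -> mink (mean_vec Phi x) (mean_vec Phi x) = h x ^+ 2.
Proof.
move=> Ox; rewrite hE // /mnorm sqr_sqrtr //.
have := h_gt0 Ox; rewrite hE // /mnorm => s0.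
by rewrite ltW // -sqrtr_gt0.
Qed.

Lemma smooth_mean_curvature : smooth Om h.
Proof.
have sm := smooth_mean_vec oOm sPhi HPhi immPhi.
have m0 x : Om x -> 0 < mink (mean_vec Phi x) (mean_vec Phi x).
  by move=> Ox; rewrite mink_mean_vec // exprn_gt0 // h_gt0.
apply: (smooth_eq oOm _ (smooth_sqrt oOm m0 (smooth_mink oOm sm sm))) => x Ox.
by rewrite hE.
Qed.

Lemma smooth_frame3 : smooth Om (frame3 Phi h).
Proof.
apply: smoothZ => //; last exact: smooth_mean_vec.
apply: smoothV => //; last exact: smooth_mean_curvature.
by move=> x Ox; rewrite gt_eqF // h_gt0.
Qed.

Lemma mean_vec_frame3 x : Om x -> mean_vec Phi x = h x *: frame3 Phi h x.
Proof. by move=> Ox; rewrite scalerA mulfV ?scale1r // gt_eqF // h_gt0. Qed.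

Lemma frame3_unit x : Om x -> mink (frame3 Phi h x) (frame3 Phi h x) = 1.
Proof.
move=> Ox; rewrite minkZl minkZr mink_mean_vec //; field.
by rewrite gt_eqF // h_gt0.
Qed.

Lemma frame3_dPhi v x : Om x -> mink (frame3 Phi h x) ('D_v Phi x) = 0.
Proof.
by move=> Ox; rewrite minkZl (mean_vec_Ph oOm sPhi HPhi immPhi) // mulr0.
Qed.

Lemma frame3_Phi x : Om x -> mink (frame3 Phi h x) (Phi x) = 0.
Proof.
by move=> Ox; rewrite minkZl (mean_vec_Phi oOm sPhi HPhi) // mulr0.
Qed.

Lemma smooth_gradient : smooth Om (gradient Phi h).
Proof.
have sg k : smooth Om (fun x => \sum_i 'D_(basis_vec i) h x * gram_inv Phi x i k).
  apply: smooth_sum => // i; apply: smoothM => //; last exact: smooth_gram_inv.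
  exact: smooth_derive smooth_mean_curvature.
apply: (smooth_eq oOm _ (smooth_row oOm sg)) => x _; apply/rowP => k.
by rewrite !mxE; apply: eq_bigr => i _; rewrite mxE.
Qed.

Lemma diff_h x : Om x -> differentiable h x.
Proof. exact: smooth_differentiable smooth_mean_curvature. Qed.

Lemma first_form_gradient v x : Om x -> first_form Phi x (gradient Phi h x) v = 'D_v h x.
Proof.
move=> Ox; rewrite (first_form_gram sPhi) // -gram_mulE mulmxKV; last first.
  exact: gram_unit oOm sPhi HPhi immPhi _ Ox.
rewrite mxE derive_row; last exact: diff_h.
by apply: eq_bigr => i _; rewrite !mxE mulrC.
Qed.

Local Notation ngrad x := (mnorm ('D_(gradient Phi h x) Phi x)).

Lemma mnorm_gradient_gt0 x : Om x -> 0 < ngrad x.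
Proof.
move=> Ox; rewrite sqrtr_gt0.
exact: (first_form_pos oOm sPhi HPhi immPhi Ox (grad_neq0 Ox)).
Qed.

Lemma smooth_frame1 : smooth Om (frame1 Phi h).
Proof.
have sG := smooth_gradient.
have sdG := smooth_derive_along oOm sG sPhi.
apply: smoothZ => //; apply: smoothV => //.
  by move=> x Ox; rewrite gt_eqF // mnorm_gradient_gt0.
apply: smooth_sqrt => //; last exact: smooth_mink.
move=> x Ox; exact: (first_form_pos oOm sPhi HPhi immPhi Ox (grad_neq0 Ox)).
Qed.

Lemma first_form_frame1 x : Om x ->
  first_form Phi x (frame1 Phi h x) (frame1 Phi h x) = 1.
Proof.
move=> Ox; rewrite (first_formZ sPhi) //.
have g0 := first_form_pos oOm sPhi HPhi immPhi Ox (grad_neq0 Ox).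
rewrite -invfM -expr2 sqr_sqrtr; last exact: ltW.
by rewrite -[X in X^-1]/(first_form Phi x _ _) mulVf // gt_eqF.
Qed.

(** An explicit E2, smooth and positively oriented with E1; the square root of the determinant is
    the factor by which [gram_rot] stretches lengths. *)
Definition frame2 x := (Num.sqrt (\det (gram Phi x)))^-1 *:
  gram_rot Phi x (frame1 Phi h x).

Let sqrt_det_gt0 x : Om x -> 0 < Num.sqrt (\det (gram Phi x)).
Proof. by move=> Ox; rewrite sqrtr_gt0 (det_gram_gt0 oOm sPhi HPhi immPhi). Qed.

Lemma smooth_frame2 : smooth Om frame2.
Proof.
have sg := smooth_gram oOm sPhi; have s1 := smooth_frame1.
have s1c j := smooth_coord j oOm s1.
apply: smoothZ => //.
  apply: smoothV => //; first by move=> x Ox; rewrite gt_eqF // sqrt_det_gt0.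
  apply: smooth_sqrt => //; first exact: det_gram_gt0.
  apply: (smooth_eq oOm _ (smoothB oOm (smoothM oOm (sg 0 0) (sg 1 1))
    (smoothM oOm (sg 0 1) (sg 1 0)))) => x _.
  by rewrite det2.
apply: (smooth_row oOm (F := fun j x => if j == 0 then _ else _)).
apply: forall_I2 => /=.
  by apply: smoothN => //; apply: smoothD => //; exact: smoothM.
by apply: smoothD => //; exact: smoothM.
Qed.

Lemma first_form_frame12 x : Om x -> first_form Phi x (frame1 Phi h x) (frame2 x) = 0.
Proof.
move=> Ox; rewrite -[X in first_form _ _ X _]scale1r (first_formZ sPhi) //.
by rewrite (first_form_rot sPhi) // mulr0.
Qed.

Lemma first_form_frame2 x : Om x -> first_form Phi x (frame2 x) (frame2 x) = 1.
Proof.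
move=> Ox; rewrite (first_formZ sPhi) // (first_form_rot_rot sPhi) // first_form_frame1 //.
have d0 := det_gram_gt0 oOm sPhi HPhi immPhi Ox.
by rewrite mulr1 -invfM -expr2 sqr_sqrtr ?ltW // mulVf // gt_eqF.
Qed.

Lemma derive_frame2_h x : Om x -> 'D_(frame2 x) h x = 0.
Proof.
move=> Ox; rewrite -first_form_gradient //.
have -> : gradient Phi h x = ngrad x *: frame1 Phi h x.
  by rewrite scalerA mulfV ?scale1r // gt_eqF // mnorm_gradient_gt0.
rewrite -[X in first_form _ _ _ X]scale1r (first_formZ sPhi) //.
by rewrite first_form_frame12 // mulr0.
Qed.

Lemma frame2_is_frame2 x : Om x -> is_frame2 Phi h x (frame2 x).
Proof.
move=> Ox; split; [exact: first_form_frame2|exact: first_form_frame12|].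
have l0 : 0 = lshift 1 (0 : 'I_1) :> 'I_2 by exact: val_inj.
have r0 : 1 = rshift 1 (0 : 'I_1) :> 'I_2 by exact: val_inj.
have c0 (v w : 'rV[R]_2) j : (col_mx v w : 'M[R]_2) 0 j = v 0 j.
  exact: etrans (congr1 (fun k => col_mx v w k j) l0) (col_mxEu v w 0 j).
have c1 (v w : 'rV[R]_2) j : (col_mx v w : 'M[R]_2) 1 j = w 0 j.
  exact: etrans (congr1 (fun k => col_mx v w k j) r0) (col_mxEd v w 0 j).
rewrite det2 !c0 !c1; have := first_form_frame1 Ox; rewrite (first_form2 sPhi) //.
have := sqrt_det_gt0 Ox; rewrite /frame2 /gram_rot.
move: (frame1 Phi h x) (Num.sqrt _) => a s s0; move: (gram Phi x) => g E.
rewrite !mxE /=.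
suff -> : a 0 0 * (s^-1 * (a 0 0 * g 0 0 + a 0 1 * g 0 1)) -
  a 0 1 * (s^-1 * - (a 0 0 * g 0 1 + a 0 1 * g 1 1)) = s^-1.
  by rewrite invr_gt0.
by rewrite -[RHS]mulr1 -E; ring.
Qed.

Hypothesis parallel : forall x i, Om x -> normal_part Phi x
  (nabla_phi Phi (basis_vec i) (frame3 Phi h) x) = 0.

Lemma diff_frame3 x : Om x -> differentiable (frame3 Phi h) x.
Proof. exact: smooth_differentiable smooth_frame3. Qed.

Lemma derive_frame3_Phi v x : Om x -> mink ('D_v (frame3 Phi h) x) (Phi x) = 0.
Proof.
move=> Ox; have : 'D_v (fun y => mink (frame3 Phi h y) (Phi y)) x = 0.
  rewrite (@eq_derive_open _ _ _ _ _ (fun=> 0 : R) x v oOm frame3_Phi Ox).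
  exact: derive_const.
rewrite derive_mink; [|exact: diff_frame3|exact: diff_Phi sPhi _ Ox].
by rewrite frame3_dPhi // addr0.
Qed.

(** Parallelism kills the component normal to the surface in the hyperboloid, and the component
    along [Phi] vanishes because E3 is orthogonal to every ['D_v Phi x]. *)
Lemma derive_frame3_tangent v x : Om x ->
  exists u, 'D_v (frame3 Phi h) x = 'D_u Phi x.
Proof.
move=> Ox; have dP := diff_Phi sPhi Ox.
have basis i : exists u, 'D_(basis_vec i) (frame3 Phi h) x = 'D_u Phi x.
  have := parallel i Ox; rewrite /normal_part /nabla_phi /projH4.
  rewrite derive_frame3_Phi // scale0r addr0 => /eqP; rewrite subr_eq0 => /eqP ->.
  rewrite /tangent_part; move: ('D_(basis_vec i) _ x) => W.
  exists (\sum_i \sum_j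
    (gram_inv Phi x i j * mink W (dPhi Phi (basis_vec i) x)) *: basis_vec j).
  rewrite derive_dir_sum //; apply: eq_bigr => k _.
  by rewrite derive_dir_sum //; apply: eq_bigr => j _; rewrite derive_dirZ.
have [u uE] := choice basis.
exists (\sum_i v 0 i *: u i); rewrite derive_row; last exact: diff_frame3.
rewrite derive_dir_sum //; apply: eq_bigr => i _.
apply: etrans (esym (derive_dirZ _ (u i) dP)).
by apply: (congr1 ( *:%R _)); exact: uE.
Qed.

Lemma derive_frame3E v x : Om x -> 'D_v (frame3 Phi h) x =
  mink ('D_v (frame3 Phi h) x) ('D_(frame1 Phi h x) Phi x) *:
    'D_(frame1 Phi h x) Phi x +
  mink ('D_v (frame3 Phi h) x) ('D_(frame2 x) Phi x) *: 'D_(frame2 x) Phi x.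
Proof.
move=> Ox; have [u ->] := derive_frame3_tangent v Ox.
exact: (dPhi_expansion oOm sPhi HPhi immPhi Ox (first_form_frame1 Ox)
  (first_form_frame2 Ox) (first_form_frame12 Ox)).
Qed.

End MeanCurvatureFrame.

(** * Structure equations of the frame *)

(* Differentiation along a vector field, kept abstract so that unification never
   has to compare two directional derivatives. *)
Record derivation (R : realType) (Om : set 'rV[R]_2)
    (ds : ('rV[R]_2 -> R) -> 'rV[R]_2 -> R)
    (dv : ('rV[R]_2 -> 'rV[R]_5) -> 'rV[R]_2 -> 'rV[R]_5) : Prop := Derivation {
  ds_smooth : forall g : 'rV[R]_2 -> R, smooth Om g -> smooth Om (ds g);
  dv_smooth : forall F : 'rV[R]_2 -> 'rV[R]_5, smooth Om F -> smooth Om (dv F);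
  ds_eq : forall (g k : 'rV[R]_2 -> R) x,
    (forall y, Om y -> g y = k y) -> Om x -> ds g x = ds k x;
  dv_eq : forall (F G : 'rV[R]_2 -> 'rV[R]_5) x,
    (forall y, Om y -> F y = G y) -> Om x -> dv F x = dv G x;
  ds_cst : forall (a : R) x, ds (fun=> a) x = 0;
  dv_cst : forall (a : 'rV[R]_5) x, dv (fun=> a) x = 0;
  dsD : forall (g k : 'rV[R]_2 -> R) x, smooth Om g -> smooth Om k -> Om x ->
    ds (fun y => g y + k y) x = ds g x + ds k x;
  dsM : forall (g k : 'rV[R]_2 -> R) x, smooth Om g -> smooth Om k -> Om x ->
    ds (fun y => g y * k y) x = ds g x * k x + g x * ds k x;
  dvD : forall (F G : 'rV[R]_2 -> 'rV[R]_5) x, smooth Om F -> smooth Om G -> Om x ->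
    dv (fun y => F y + G y) x = dv F x + dv G x;
  dvZ : forall (g : 'rV[R]_2 -> R) (F : 'rV[R]_2 -> 'rV[R]_5) x,
    smooth Om g -> smooth Om F -> Om x ->
    dv (fun y => g y *: F y) x = ds g x *: F x + g x *: dv F x;
  ds_mink : forall (F G : 'rV[R]_2 -> 'rV[R]_5) x,
    smooth Om F -> smooth Om G -> Om x ->
    ds (fun y => mink (F y) (G y)) x = mink (dv F x) (G x) + mink (F x) (dv G x) }.

Lemma derivation_along (R : realType) (Om : set 'rV[R]_2)
    (e : 'rV[R]_2 -> 'rV[R]_2) : open Om -> smooth Om e ->
  derivation Om (fun g x => 'D_(e x) g x) (fun F x => 'D_(e x) F x).
Proof.
move=> oOm se; have diff (W : normedModType R) (F : 'rV[R]_2 -> W) x :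
  smooth Om F -> Om x -> differentiable F x by exact: smooth_differentiable.
split.
- by move=> g sg; exact: smooth_derive_along.
- by move=> F sF; exact: smooth_derive_along.
- by move=> g k x gk Ox; exact: eq_derive_open oOm gk Ox.
- by move=> F G x FG Ox; exact: eq_derive_open oOm FG Ox.
- by move=> a x; exact: derive_const.
- by move=> a x; exact: derive_const.
- by move=> g k x sg sk Ox; apply: derive_add; exact: diff.
- by move=> g k x sg sk Ox; apply: derive_mul; exact: diff.
- by move=> F G x sF sG Ox; apply: derive_add; exact: diff.
- by move=> g F x sg sF Ox; apply: derive_scale; exact: diff.
- by move=> F G x sF sG Ox; apply: derive_mink; exact: diff.
Qed.

Section DerivationTheory.
Context {R : realType} (Om : set 'rV[R]_2).
Variables (ds : ('rV[R]_2 -> R) -> 'rV[R]_2 -> R)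
  (dv : ('rV[R]_2 -> 'rV[R]_5) -> 'rV[R]_2 -> 'rV[R]_5).
Hypotheses (oOm : open Om) (dd : derivation Om ds dv).
Implicit Types (g k : 'rV[R]_2 -> R) (F G : 'rV[R]_2 -> 'rV[R]_5).

Lemma ds_eq_cst g a x : (forall y, Om y -> g y = a) -> Om x -> ds g x = 0.
Proof. by move=> ga Ox; rewrite (ds_eq dd ga Ox) (ds_cst dd). Qed.

Lemma mink_dv F G k x : smooth Om F -> smooth Om G ->
  (forall y, Om y -> mink (F y) (G y) = k y) -> Om x ->
  mink (dv F x) (G x) = ds k x - mink (F x) (dv G x).
Proof.
move=> sF sG FG Ox; rewrite -(ds_eq dd FG Ox) (ds_mink dd) //.
by rewrite addrK.
Qed.

Lemma mink_dv_cst F G a x : smooth Om F -> smooth Om G ->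
  (forall y, Om y -> mink (F y) (G y) = a) -> Om x ->
  mink (dv F x) (G x) = - mink (F x) (dv G x).
Proof.
by move=> sF sG FG Ox; rewrite (mink_dv (k := fun=> a)) // (ds_cst dd) sub0r.
Qed.

Lemma mink_dv_norm F k x : smooth Om F ->
  (forall y, Om y -> mink (F y) (F y) = k y) -> Om x ->
  2 * mink (dv F x) (F x) = ds k x.
Proof.
move=> sF FG Ox; rewrite -(ds_eq dd FG Ox) (ds_mink dd) //.
by rewrite [mink (F x) _]minkC mulr2n mulrDl mul1r.
Qed.

Lemma dsN g x : smooth Om g -> Om x -> ds (fun y => - g y) x = - ds g x.
Proof.
move=> sg Ox; have := dsM dd (smooth_cst Om (-1 : R)) sg Ox.
rewrite (ds_cst dd) mul0r add0r mulN1r => <-.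
by apply: (ds_eq dd) => // y _; rewrite mulN1r.
Qed.

Lemma dsZ a g x : smooth Om g -> Om x -> ds (fun y => a * g y) x = a * ds g x.
Proof.
move=> sg Ox; have := dsM dd (smooth_cst Om a) sg Ox.
by rewrite (ds_cst dd) mul0r add0r.
Qed.

Lemma dvN F x : smooth Om F -> Om x -> dv (fun y => - F y) x = - dv F x.
Proof.
move=> sF Ox; have := dvZ dd (smooth_cst Om (-1 : R)) sF Ox.
rewrite (ds_cst dd) scale0r add0r scaleN1r => <-.
by apply: (dv_eq dd) => // y _; rewrite scaleN1r.
Qed.

Lemma dvB F G x : smooth Om F -> smooth Om G -> Om x ->
  dv (fun y => F y - G y) x = dv F x - dv G x.
Proof.
by move=> sF sG Ox; rewrite (dvD dd) ?dvN //; exact: smoothN.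
Qed.

End DerivationTheory.

Definition speed (R : realType) (c t : R) :=
  Num.sqrt (1 - 9 * t ^+ 2 - c ^+ 2 * t ^+ 3).

(* [fV] is the fourth frame field times its coefficient [c * h `^ (3 / 2)], and
   [fW], the derivative of [f2] along itself, turns out to be null. *)
Record frame_equations (R : realType) (Om : set 'rV[R]_2)
    (ds1 ds2 : ('rV[R]_2 -> R) -> 'rV[R]_2 -> R)
    (dv1 dv2 : ('rV[R]_2 -> 'rV[R]_5) -> 'rV[R]_2 -> 'rV[R]_5)
    (Phi f1 f2 f3 fV fW : 'rV[R]_2 -> 'rV[R]_5) (h : 'rV[R]_2 -> R) (c : R)
    : Prop := FrameEquations {
  fe_smooth1 : smooth Om f1; fe_smooth2 : smooth Om f2;
  fe_smooth3 : smooth Om f3; fe_smoothV : smooth Om fV;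
  fe_smoothW : smooth Om fW; fe_smooth_h : smooth Om h;
  fe_smooth_speed : smooth Om (fun x => speed c (h x));
  fe_at : forall x, Om x ->
    [/\ [/\ 0 < h x, 0 < speed c (h x) &
          speed c (h x) ^+ 2 = 1 - 9 * h x ^+ 2 - c ^+ 2 * h x ^+ 3],
      [/\ mink (f1 x) (f1 x) = 1, mink (f2 x) (f2 x) = 1,
          mink (f3 x) (f3 x) = 1, mink (fV x) (fV x) = c ^+ 2 * h x ^+ 3 &
          mink (Phi x) (Phi x) = -1],
      [/\ [/\ mink (f1 x) (f2 x) = 0, mink (f1 x) (f3 x) = 0,
            mink (f1 x) (fV x) = 0 & mink (f1 x) (Phi x) = 0],
          [/\ mink (f2 x) (f3 x) = 0, mink (f2 x) (fV x) = 0 &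
            mink (f2 x) (Phi x) = 0] &
          [/\ mink (f3 x) (fV x) = 0, mink (f3 x) (Phi x) = 0 &
            mink (fV x) (Phi x) = 0]],
      [/\ dv1 f1 x = - h x *: f3 x + fV x + Phi x, dv1 f2 x = 0,
          dv1 f3 x = h x *: f1 x,
          dv1 fV x = - (c ^+ 2 * h x ^+ 3) *: f1 x + (2 * speed c (h x)) *: fV x &
          dv1 fW x = speed c (h x) *: fW x] &
      [/\ ds1 h x = 4 / 3 * h x * speed c (h x), ds2 h x = 0,
          dv2 f2 x = fW x, dv2 fW x = 0 &
          [/\ mink (fW x) (fW x) = 0, mink (fW x) (f2 x) = 0 &
            mink (fW x) (Phi x) = -1]]] }.

Section StructureEquations.
Context {R : realType} (Om : set 'rV[R]_2).
Variables (ds1 ds2 : ('rV[R]_2 -> R) -> 'rV[R]_2 -> R)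
  (dv1 dv2 : ('rV[R]_2 -> 'rV[R]_5) -> 'rV[R]_2 -> 'rV[R]_5).
Hypotheses (oOm : open Om) (d1 : derivation Om ds1 dv1)
  (d2 : derivation Om ds2 dv2).
Variables (E1 E2 E3 : 'rV[R]_2 -> 'rV[R]_5) (h : 'rV[R]_2 -> R).
Hypotheses (sE1 : smooth Om E1) (sE2 : smooth Om E2) (sE3 : smooth Om E3)
  (sh : smooth Om h).
Hypothesis n1 : forall x, Om x -> mink (E1 x) (E1 x) = 1.
Hypothesis n2 : forall x, Om x -> mink (E2 x) (E2 x) = 1.
Hypothesis o12 : forall x, Om x -> mink (E1 x) (E2 x) = 0.
Hypothesis o31 : forall x, Om x -> mink (E3 x) (E1 x) = 0.
Hypothesis o32 : forall x, Om x -> mink (E3 x) (E2 x) = 0.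
Hypothesis tangent1 : forall x, Om x -> dv1 E3 x =
  mink (dv1 E3 x) (E1 x) *: E1 x + mink (dv1 E3 x) (E2 x) *: E2 x.
Hypothesis tangent2 : forall x, Om x -> dv2 E3 x =
  mink (dv2 E3 x) (E1 x) *: E1 x + mink (dv2 E3 x) (E2 x) *: E2 x.
Hypothesis bracketE3 : forall x, Om x -> dv1 (dv2 E3) x - dv2 (dv1 E3) x =
  mink (dv1 E2 x - dv2 E1 x) (E1 x) *: dv1 E3 x +
  mink (dv1 E2 x - dv2 E1 x) (E2 x) *: dv2 E3 x.
Hypothesis sym_second_form : forall x, Om x ->
  mink (dv1 E2 x) (E3 x) = mink (dv2 E1 x) (E3 x).
Hypothesis trace_second_form : forall x, Om x ->
  mink (dv1 E1 x) (E3 x) + mink (dv2 E2 x) (E3 x) = 2 * h x.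
Hypothesis h_gt0 : forall x, Om x -> 0 < h x.
Hypothesis h1_gt0 : forall x, Om x -> 0 < ds1 h x.
Hypothesis h2_0 : forall x, Om x -> ds2 h x = 0.

Let T y := (2 * h y) *: E3 y.

(* The tangential component along Eb of the trace of the second covariant
   derivative of the tension field T. *)
Hypothesis biconservative_frame : forall Eb x, Eb = E1 \/ Eb = E2 -> Om x ->
  mink (dv1 (dv1 T) x - mink (dv1 E1 x) (E2 x) *: dv2 T x +
        (dv2 (dv2 T) x - mink (dv2 E2 x) (E1 x) *: dv1 T x)) (Eb x) = 0.

Let a y := mink (dv1 E1 y) (E2 y).
Let b y := mink (dv2 E1 y) (E2 y).
Let al y := mink (dv1 E1 y) (E3 y).
Let be y := mink (dv2 E1 y) (E3 y).
Let ga y := mink (dv2 E2 y) (E3 y).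

Let sal : smooth Om al.
Proof. by apply: smooth_mink => //; exact: dv_smooth d1 _ _. Qed.
Let sbe : smooth Om be.
Proof. by apply: smooth_mink => //; exact: dv_smooth d2 _ _. Qed.
Let sga : smooth Om ga.
Proof. by apply: smooth_mink => //; exact: dv_smooth d2 _ _. Qed.

Let e11 x : Om x -> mink (dv1 E1 x) (E1 x) = 0.
Proof.
move=> Ox; have := mink_dv_norm d1 sE1 (k := fun=> 1) n1 Ox.
by rewrite (ds_cst d1) => /eqP; rewrite mulf_eq0 pnatr_eq0 => /eqP.
Qed.
Let e21 x : Om x -> mink (dv2 E1 x) (E1 x) = 0.
Proof.
move=> Ox; have := mink_dv_norm d2 sE1 (k := fun=> 1) n1 Ox.
by rewrite (ds_cst d2) => /eqP; rewrite mulf_eq0 pnatr_eq0 => /eqP.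
Qed.
Let e12 x : Om x -> mink (dv1 E2 x) (E2 x) = 0.
Proof.
move=> Ox; have := mink_dv_norm d1 sE2 (k := fun=> 1) n2 Ox.
by rewrite (ds_cst d1) => /eqP; rewrite mulf_eq0 pnatr_eq0 => /eqP.
Qed.
Let e22 x : Om x -> mink (dv2 E2 x) (E2 x) = 0.
Proof.
move=> Ox; have := mink_dv_norm d2 sE2 (k := fun=> 1) n2 Ox.
by rewrite (ds_cst d2) => /eqP; rewrite mulf_eq0 pnatr_eq0 => /eqP.
Qed.

Let a' x : Om x -> mink (dv1 E2 x) (E1 x) = - a x.
Proof.
by move=> Ox; rewrite /a (mink_dv_cst d1 sE1 sE2 o12) // opprK minkC.
Qed.
Let b' x : Om x -> mink (dv2 E2 x) (E1 x) = - b x.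
Proof.
by move=> Ox; rewrite /b (mink_dv_cst d2 sE1 sE2 o12) // opprK minkC.
Qed.

Let dE31 x : Om x -> dv1 E3 x = - al x *: E1 x - be x *: E2 x.
Proof.
move=> Ox; rewrite [LHS]tangent1 // (mink_dv_cst d1 sE3 sE1 o31) //.
rewrite (mink_dv_cst d1 sE3 sE2 o32) // ![mink (E3 x) _]minkC.
by rewrite sym_second_form // !scaleNr.
Qed.
Let dE32 x : Om x -> dv2 E3 x = - be x *: E1 x - ga x *: E2 x.
Proof.
move=> Ox; rewrite [LHS]tangent2 // (mink_dv_cst d2 sE3 sE1 o31) //.
by rewrite (mink_dv_cst d2 sE3 sE2 o32) // ![mink (E3 x) _]minkC !scaleNr.
Qed.

Let d1E3 := dv_smooth d1 sE3.
Let d2E3 := dv_smooth d2 sE3.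

Let m31 x : Om x -> mink (dv1 E3 x) (E1 x) = - al x.
Proof.
by move=> Ox; rewrite dE31 // !minkE n1 // minkC o12 //; ring.
Qed.
Let m31' x : Om x -> mink (dv1 E3 x) (E2 x) = - be x.
Proof. by move=> Ox; rewrite dE31 // !minkE n2 // o12 //; ring. Qed.
Let m32 x : Om x -> mink (dv2 E3 x) (E1 x) = - be x.
Proof.
by move=> Ox; rewrite dE32 // !minkE n1 // [mink (E2 x) _]minkC o12 //; ring.
Qed.
Let m32' x : Om x -> mink (dv2 E3 x) (E2 x) = - ga x.
Proof. by move=> Ox; rewrite dE32 // !minkE n2 // o12 //; ring. Qed.

(** The E1-component of the commutation relation for E3 in flat space. Since E3 is parallel in the
    normal bundle, only its own shape operator enters: [al], [be], [ga] are the entries, [a] and [b]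
    the connection coefficients of the tangent frame. *)
Let codazzi1 x : Om x ->
  - ds1 be x + ga x * a x + ds2 al x - be x * b x = a x * al x + b x * be x.
Proof.
move=> Ox; have := congr1 (mink^~ (E1 x)) (bracketE3 Ox).
rewrite !minkDl !minkNl !minkZl a' // e21 // e12 // m31 // m32 //.
rewrite (mink_dv d1 d2E3 sE1 m32 Ox) (mink_dv d2 d1E3 sE1 m31 Ox).
rewrite (dsN d1) // (dsN d2) // dE31 // dE32 //.
rewrite !(minkDl, minkNl, minkZl) -/(a x) -/(b x).
rewrite ![mink (E1 x) (dv1 _ _)]minkC ![mink (E1 x) (dv2 _ _)]minkC.
rewrite ![mink (E2 x) (dv1 _ _)]minkC ![mink (E2 x) (dv2 _ _)]minkC.
rewrite -/(a x) -/(b x) e11 // e21 // => E; lra.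
Qed.

Let codazzi2 x : Om x ->
  - ds1 ga x - be x * a x + ds2 be x + al x * b x = a x * be x + b x * ga x.
Proof.
move=> Ox; have := congr1 (mink^~ (E2 x)) (bracketE3 Ox).
rewrite !minkDl !minkNl !minkZl a' // e21 // e12 // m31' // m32' //.
rewrite (mink_dv d1 d2E3 sE2 m32' Ox) (mink_dv d2 d1E3 sE2 m31' Ox).
rewrite (dsN d1) // (dsN d2) // dE31 // dE32 //.
rewrite !(minkDl, minkNl, minkZl).
rewrite ![mink (E1 x) (dv1 _ _)]minkC ![mink (E1 x) (dv2 _ _)]minkC.
rewrite ![mink (E2 x) (dv1 _ _)]minkC ![mink (E2 x) (dv2 _ _)]minkC.
rewrite -/(b x) a' // b' // e12 // e22 // => E; lra.
Qed.

Let s2h : smooth Om (fun y => 2 * h y).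
Proof. by apply: smoothM => //; exact: smooth_cst. Qed.
Let sT : smooth Om T.
Proof. exact: smoothZ. Qed.

Let dT1 x : Om x ->
  dv1 T x = (2 * ds1 h x) *: E3 x + (2 * h x) *: dv1 E3 x.
Proof. by move=> Ox; rewrite (dvZ d1) // (dsZ d1). Qed.
Let dT2 x : Om x -> dv2 T x = (2 * h x) *: dv2 E3 x.
Proof.
by move=> Ox; rewrite (dvZ d2) // (dsZ d2) // h2_0 // mulr0 scale0r add0r.
Qed.

Let sdT1 : smooth Om (dv1 T). Proof. exact: dv_smooth d1 _ sT. Qed.
Let sdT2 : smooth Om (dv2 T). Proof. exact: dv_smooth d2 _ sT. Qed.

Let T11 x : Om x -> mink (dv1 T x) (E1 x) = (-2 * h x) * al x.
Proof. by move=> Ox; rewrite dT1 // !minkE o31 // m31 //; ring. Qed.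
Let T12 x : Om x -> mink (dv1 T x) (E2 x) = (-2 * h x) * be x.
Proof. by move=> Ox; rewrite dT1 // !minkE o32 // m31' //; ring. Qed.
Let T21 x : Om x -> mink (dv2 T x) (E1 x) = (-2 * h x) * be x.
Proof. by move=> Ox; rewrite dT2 // !minkE m32 //; ring. Qed.
Let T22 x : Om x -> mink (dv2 T x) (E2 x) = (-2 * h x) * ga x.
Proof. by move=> Ox; rewrite dT2 // !minkE m32' //; ring. Qed.

Let sm2h : smooth Om (fun y => -2 * h y).
Proof. by apply: smoothM => //; exact: smooth_cst. Qed.

Let trace_form x : Om x -> al x + ga x = 2 * h x.
Proof. exact: trace_second_form. Qed.

Let trace_d1 x : Om x -> ds1 al x + ds1 ga x = 2 * ds1 h x.
Proof.
by move=> Ox; rewrite -(dsD d1) // (ds_eq d1 trace_form Ox) (dsZ d1).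
Qed.
Let trace_d2 x : Om x -> ds2 al x + ds2 ga x = 0.
Proof.
move=> Ox; rewrite -(dsD d2) // (ds_eq d2 trace_form Ox) (dsZ d2) //.
by rewrite h2_0 // mulr0.
Qed.

(** The E1-component of biconservativity contains derivatives of the second fundamental form;
    [codazzi2] and the E1-derivative of the trace eliminate them and leave E1 f times [al x + h x].
    Together with [shape3_12] this is the relation A_3 (grad f) = - f grad f, derived here from the
    bitension field. *)
Lemma shape3_11 x : Om x -> mink (dv1 E1 x) (E3 x) = - h x.
Proof.
move=> Ox; have := biconservative_frame (or_introl erefl) Ox.
rewrite !(minkDl, minkNl, minkZl) (mink_dv d1 sdT1 sE1 T11 Ox).
rewrite (mink_dv d2 sdT2 sE1 T21 Ox) T21 // T11 // b' // (dsM d1) // (dsM d2) //.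
rewrite (dsZ d1) // (dsZ d2) // h2_0 // dT1 // dT2 // dE31 // dE32 //.
rewrite !(minkDl, minkNl, minkZl).
rewrite ![mink (E1 x) (dv1 _ _)]minkC ![mink (E1 x) (dv2 _ _)]minkC.
rewrite ![mink (E2 x) (dv1 _ _)]minkC ![mink (E2 x) (dv2 _ _)]minkC.
rewrite ![mink (E3 x) (dv1 _ _)]minkC.
rewrite -/(a x) -/(b x) -/(al x) -/(be x) e11 // e21 // => E.
have cod := codazzi2 Ox; have tr := trace_d1 Ox; have h1 := h1_gt0 Ox.
have : ds1 h x * (al x + h x) = 0.
  (* Both auxiliary equations are multiplied by [h x], so that the elimination becomes linear. *)
  have E' : h x * (ds1 al x + ds1 ga x - 2 * ds1 h x) = 0 by rewrite tr subrr mulr0.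
  have E'' : h x * (- ds1 ga x - be x * a x + ds2 be x + al x * b x -
    (a x * be x + b x * ga x)) = 0 by rewrite cod subrr mulr0.
  lra.
by move=> /eqP; rewrite mulf_eq0 gt_eqF //= addr_eq0 => /eqP.
Qed.

(** The E2-component of biconservativity, treated in the same way with [codazzi1] and the
    E2-derivative of the trace, leaves E1 f times [be x]. *)
Lemma shape3_12 x : Om x -> mink (dv2 E1 x) (E3 x) = 0.
Proof.
move=> Ox; have := biconservative_frame (or_intror erefl) Ox.
rewrite !(minkDl, minkNl, minkZl) (mink_dv d1 sdT1 sE2 T12 Ox).
rewrite (mink_dv d2 sdT2 sE2 T22 Ox) T22 // T12 // b' // (dsM d1) // (dsM d2) //.
rewrite (dsZ d1) // (dsZ d2) // h2_0 // dT1 // dT2 // dE31 // dE32 //.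
rewrite !(minkDl, minkNl, minkZl).
rewrite ![mink (E1 x) (dv1 _ _)]minkC ![mink (E1 x) (dv2 _ _)]minkC.
rewrite ![mink (E2 x) (dv1 _ _)]minkC ![mink (E2 x) (dv2 _ _)]minkC.
rewrite ![mink (E3 x) (dv1 _ _)]minkC.
rewrite sym_second_form // -/(a x) -/(b x) -/(al x) -/(be x) a' // b' //.
rewrite e12 // e22 // => E.
have cod := codazzi1 Ox; have tr := trace_d2 Ox; have h1 := h1_gt0 Ox.
have : ds1 h x * be x = 0.
  have E' : h x * (ds2 al x + ds2 ga x) = 0 by rewrite tr mulr0.
  have E'' : h x * (- ds1 be x + ga x * a x + ds2 al x - be x * b x -
    (a x * al x + b x * be x)) = 0 by rewrite cod subrr mulr0.
  lra.
by move=> /eqP; rewrite mulf_eq0 gt_eqF //= => /eqP.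
Qed.

Lemma shape3_22 x : Om x -> mink (dv2 E2 x) (E3 x) = 3 * h x.
Proof. by move=> Ox; have := trace_form Ox; rewrite /al shape3_11 // /ga; lra. Qed.

(** With the shape operator diag(-f, 3f) and E2 f = 0, [codazzi1] reduces to 3 f a = - f a. The
    integral curves of E1 are geodesics of the surface. *)
Lemma connection1 x : Om x -> mink (dv1 E1 x) (E2 x) = 0.
Proof.
move=> Ox; have := codazzi1 Ox.
rewrite (ds_eq_cst d1 shape3_12 Ox) (ds_eq d2 shape3_11 Ox) (dsN d2) // h2_0 //.
rewrite /al /be /ga shape3_11 // shape3_12 // shape3_22 // -/(a x) => E.
have : h x * a x = 0 by lra.
by move=> /eqP; rewrite mulf_eq0 gt_eqF ?h_gt0 //= => /eqP.
Qed.

(** With the shape operator diag(-f, 3f), [codazzi2] reduces to - 3 E1 f - f b = 3 f b. *)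
Lemma connection2 x : Om x -> 4 * h x * mink (dv2 E1 x) (E2 x) = - (3 * ds1 h x).
Proof.
move=> Ox; have := codazzi2 Ox.
rewrite (ds_eq_cst d2 shape3_12 Ox) (ds_eq d1 shape3_22 Ox) (dsZ d1) //.
rewrite /al /be /ga shape3_11 // shape3_12 // shape3_22 // -/(b x); lra.
Qed.

Lemma dv1_E3 x : Om x -> dv1 E3 x = h x *: E1 x.
Proof.
move=> Ox; rewrite dE31 // /al /be shape3_11 // shape3_12 // opprK.
by rewrite scale0r subr0.
Qed.

Lemma dv2_E3 x : Om x -> dv2 E3 x = - (3 * h x) *: E2 x.
Proof.
move=> Ox; rewrite dE32 // /be /ga shape3_12 // shape3_22 // oppr0 scale0r.
by rewrite add0r scaleNr.
Qed.

Variables (Phi : 'rV[R]_2 -> 'rV[R]_5) (c : R).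
Hypotheses (sPhi : smooth Om Phi) (c_neq0 : c != 0).
Hypothesis nPhi : forall x, Om x -> mink (Phi x) (Phi x) = -1.
Hypothesis n3 : forall x, Om x -> mink (E3 x) (E3 x) = 1.
Hypothesis o1P : forall x, Om x -> mink (E1 x) (Phi x) = 0.
Hypothesis o2P : forall x, Om x -> mink (E2 x) (Phi x) = 0.
Hypothesis o3P : forall x, Om x -> mink (E3 x) (Phi x) = 0.
Hypothesis dPhi1 : forall x, Om x -> dv1 Phi x = E1 x.
Hypothesis dPhi2 : forall x, Om x -> dv2 Phi x = E2 x.

Local Notation s x := (speed c (h x)).

Hypothesis ds1_h : forall x, Om x -> ds1 h x = 4 / 3 * h x * s x.

Let k x := c * h x `^ (3 / 2).

(** E4 is asked for at each point separately, without smoothness in [x]; the smooth substitute is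
    [normal4], shown below to equal [k x *: E4]. *)
Hypothesis E4_exists : forall x, Om x -> exists E4 : 'rV[R]_5,
  [/\ mink E4 E4 = 1, [/\ mink (E1 x) E4 = 0, mink (E2 x) E4 = 0,
      mink (E3 x) E4 = 0 & mink (Phi x) E4 = 0] &
    [/\ mink (dv1 E1 x) E4 = k x, mink (dv1 E2 x) E4 = 0,
      mink (dv2 E1 x) E4 = 0 & mink (dv2 E2 x) E4 = - k x]].

Lemma speed_gt0 x : Om x -> 0 < s x.
Proof.
move=> Ox; have := h1_gt0 Ox; rewrite ds1_h // pmulr_rgt0 //.
by rewrite mulr_gt0 ?h_gt0 // divr_gt0.
Qed.

Lemma speed_sqr x : Om x -> s x ^+ 2 = 1 - 9 * h x ^+ 2 - c ^+ 2 * h x ^+ 3.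
Proof.
by move=> Ox; rewrite sqr_sqrtr // ltW // -sqrtr_gt0; exact: speed_gt0.
Qed.

Lemma smooth_speed : smooth Om (fun x => s x).
Proof.
apply: smooth_sqrt => // [x Ox|]; first by rewrite -sqrtr_gt0; exact: speed_gt0.
have sX n := smoothX n oOm sh.
by apply: smoothB => //; [apply: smoothB => //|]; try exact: smooth_cst;
  apply: smoothM => //; exact: smooth_cst.
Qed.

(** Differentiating the square of the speed avoids the derivative of a square root. The statement is
    for any derivation, to serve both frame directions. *)
Let ds_speed (ds : ('rV[R]_2 -> R) -> 'rV[R]_2 -> R)
    (dv : ('rV[R]_2 -> 'rV[R]_5) -> 'rV[R]_2 -> 'rV[R]_5) x :
  derivation Om ds dv -> Om x ->
  2 * s x * ds (fun y => s y) x =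
  - (18 * h x + 3 * c ^+ 2 * h x ^+ 2) * ds h x.
Proof.
move=> dd Ox; have ss := smooth_speed.
have e y : Om y -> s y * s y =
    1 + (- 9 * (h y * h y) + - c ^+ 2 * (h y * (h y * h y))).
  by move=> Oy; rewrite -expr2 speed_sqr //; ring.
have := ds_eq dd e Ox; have shh := smoothM oOm sh sh.
have shhh := smoothM oOm sh shh.
have s9 := smoothM oOm (smooth_cst Om (-9 : R)) shh.
have sc := smoothM oOm (smooth_cst Om (- c ^+ 2 : R)) shhh.
rewrite (dsD dd (smooth_cst Om (1 : R)) (smoothD oOm s9 sc) Ox) (ds_cst dd).
rewrite (dsD dd s9 sc Ox) (dsZ dd) // (dsZ dd) // !(dsM dd) // => E; lra.
Qed.

Lemma ds1_speed x : Om x ->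
  ds1 (fun y => s y) x = - 12 * h x ^+ 2 - 2 * c ^+ 2 * h x ^+ 3.
Proof.
move=> Ox; have := ds_speed d1 Ox; rewrite ds1_h // => E.
have s0 := speed_gt0 Ox; apply: (mulfI (x := 2 * s x)).
  by rewrite mulf_neq0 ?pnatr_eq0 // gt_eqF.
by rewrite E; field.
Qed.

Lemma ds2_speed x : Om x -> ds2 (fun y => s y) x = 0.
Proof.
move=> Ox; have := ds_speed d2 Ox; rewrite h2_0 // mulr0 => /eqP.
by rewrite mulf_eq0 mulf_eq0 pnatr_eq0 (gt_eqF (speed_gt0 Ox)) /= => /eqP.
Qed.

(* [normal4] and [null_field] are variables rather than definitions to prevent
   rewriting with bilinearity from unfolding them. *)
Variables normal4 null_field : 'rV[R]_2 -> 'rV[R]_5.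
Hypothesis normal4_def : forall x, normal4 x = dv1 E1 x + h x *: E3 x - Phi x.
Hypothesis null_field_def : forall x,
  null_field x = s x *: E1 x + (3 * h x) *: E3 x - normal4 x + Phi x.

Lemma smooth_normal4 : smooth Om normal4.
Proof.
apply: (smooth_eq oOm (fun x _ => esym (normal4_def x))).
apply: smoothB => //; apply: smoothD => //; last exact: smoothZ.
exact: dv_smooth d1 _ sE1.
Qed.

Let k_sqr x : Om x -> k x ^+ 2 = c ^+ 2 * h x ^+ 3.
Proof.
move=> Ox; rewrite /k exprMn; congr (_ * _).
rewrite -[LHS]powR_mulrn ?powR_ge0 // -powRrM divfK ?pnatr_eq0 //.
by rewrite powR_mulrn // ltW // h_gt0.
Qed.

Let k_neq0 x : Om x -> c ^+ 2 * h x ^+ 3 != 0.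
Proof.
move=> Ox; apply: mulf_neq0; first by rewrite expf_neq0.
by rewrite expf_neq0 // gt_eqF // h_gt0.
Qed.

Let dE1P x : Om x -> mink (dv1 E1 x) (Phi x) = -1.
Proof. by move=> Ox; rewrite (mink_dv_cst d1 sE1 sPhi o1P) // dPhi1 // n1. Qed.
Let dE1P2 x : Om x -> mink (dv2 E1 x) (Phi x) = 0.
Proof. by move=> Ox; rewrite (mink_dv_cst d2 sE1 sPhi o1P) // dPhi2 // o12 ?oppr0. Qed.
Let dE2P1 x : Om x -> mink (dv1 E2 x) (Phi x) = 0.
Proof.
move=> Ox; rewrite (mink_dv_cst d1 sE2 sPhi o2P) // dPhi1 // minkC o12 //.
by rewrite oppr0.
Qed.
Let dE2P2 x : Om x -> mink (dv2 E2 x) (Phi x) = -1.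
Proof. by move=> Ox; rewrite (mink_dv_cst d2 sE2 sPhi o2P) // dPhi2 // n2. Qed.

Lemma normal4_E1 x : Om x -> mink (normal4 x) (E1 x) = 0.
Proof.
move=> Ox; rewrite normal4_def !(minkDl, minkNl, minkZl) e11 // o31 //.
by rewrite [mink (Phi x) _]minkC o1P // mulr0 subr0 addr0.
Qed.
Lemma normal4_E2 x : Om x -> mink (normal4 x) (E2 x) = 0.
Proof.
move=> Ox; rewrite normal4_def !(minkDl, minkNl, minkZl) connection1 // o32 //.
by rewrite [mink (Phi x) _]minkC o2P // mulr0 subr0 addr0.
Qed.
Lemma normal4_E3 x : Om x -> mink (normal4 x) (E3 x) = 0.
Proof.
move=> Ox; rewrite normal4_def !(minkDl, minkNl, minkZl) shape3_11 // n3 //.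
by rewrite [mink (Phi x) _]minkC o3P // mulr1 subr0 addNr.
Qed.
Lemma normal4_Phi x : Om x -> mink (normal4 x) (Phi x) = 0.
Proof.
move=> Ox; rewrite normal4_def !(minkDl, minkNl, minkZl) dE1P // o3P // nPhi //.
by rewrite mulr0 addr0 opprK addNr.
Qed.

Let normal4_E4 x E4 : Om x -> mink (dv1 E1 x) E4 = k x -> mink (E3 x) E4 = 0 ->
  mink (Phi x) E4 = 0 -> mink (normal4 x) E4 = k x.
Proof.
move=> Ox m1 m3 mP; rewrite normal4_def !(minkDl, minkNl, minkZl) m1 m3 mP.
by rewrite mulr0 subr0 addr0.
Qed.

Let normal4E x E4 : Om x -> mink E4 E4 = 1 -> mink (E1 x) E4 = 0 ->
  mink (E2 x) E4 = 0 -> mink (E3 x) E4 = 0 -> mink (Phi x) E4 = 0 ->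
  mink (dv1 E1 x) E4 = k x -> normal4 x = k x *: E4.
Proof.
move=> Ox m4 m1 m2 m3 mP mk.
apply: (@frame_ext _ (E1 x) (E2 x) (E3 x) E4 (Phi x)) => //;
  rewrite ?n1 ?n2 ?n3 ?m4 ?nPhi ?oppr_eq0 ?oner_eq0 ?o12 ?o1P ?o2P ?o3P //.
- by rewrite minkC o31.
- by rewrite minkC o32.
- by rewrite minkC.
- by rewrite normal4_E1 // minkZl minkC m1 mulr0.
- by rewrite normal4_E2 // minkZl minkC m2 mulr0.
- by rewrite normal4_E3 // minkZl minkC m3 mulr0.
- by rewrite (normal4_E4 Ox) // minkZl m4 mulr1.
- by rewrite normal4_Phi // minkZl minkC mP mulr0.
Qed.

Lemma normal4_norm x : Om x -> mink (normal4 x) (normal4 x) = c ^+ 2 * h x ^+ 3.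
Proof.
move=> Ox; have [E4 [m4 [m1 m2 m3 mP] [k1 _ _ _]]] := E4_exists Ox.
by rewrite (normal4E Ox m4) // minkZl minkZr m4 -k_sqr //; ring.
Qed.

Let normal_dv x : Om x ->
  [/\ mink (dv1 E2 x) (normal4 x) = 0, mink (dv2 E1 x) (normal4 x) = 0 &
      mink (dv2 E2 x) (normal4 x) = - (c ^+ 2 * h x ^+ 3)].
Proof.
move=> Ox; have [E4 [m4 [m1 m2 m3 mP] [k1 k2 k3 k4]]] := E4_exists Ox.
rewrite (normal4E Ox m4) // !minkZr k2 k3 k4 -k_sqr //; split; ring.
Qed.

(** The field [normal4] may replace E4 in the frame because its squared length [c ^+ 2 * h x ^+ 3]
    is nonzero. *)
Lemma frame_eq x w w' : Om x -> mink w (E1 x) = mink w' (E1 x) ->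
  mink w (E2 x) = mink w' (E2 x) -> mink w (E3 x) = mink w' (E3 x) ->
  mink w (normal4 x) = mink w' (normal4 x) ->
  mink w (Phi x) = mink w' (Phi x) -> w = w'.
Proof.
move=> Ox; apply: frame_ext; rewrite ?n1 ?n2 ?n3 ?normal4_norm ?nPhi //
  ?oppr_eq0 ?oner_eq0 ?o12 ?o1P ?o2P ?o3P ?normal4_Phi ?k_neq0 //.
- by rewrite minkC o31.
- by rewrite minkC normal4_E1.
- by rewrite minkC o32.
- by rewrite minkC normal4_E2.
- by rewrite minkC normal4_E3.
Qed.

Lemma dv1_E1 x : Om x -> dv1 E1 x = - h x *: E3 x + normal4 x + Phi x.
Proof. by move=> Ox; apply/rowP => j; rewrite normal4_def !mxE; ring. Qed.

Let frameE := (n1, n2, n3, nPhi, o12, o31, o32, o1P, o2P, o3P, normal4_E1,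
  normal4_E2, normal4_E3, normal4_Phi, normal4_norm).

Let o21 x : Om x -> mink (E2 x) (E1 x) = 0.
Proof. by move=> Ox; rewrite minkC o12. Qed.
Let o13 x : Om x -> mink (E1 x) (E3 x) = 0.
Proof. by move=> Ox; rewrite minkC o31. Qed.
Let o23 x : Om x -> mink (E2 x) (E3 x) = 0.
Proof. by move=> Ox; rewrite minkC o32. Qed.
Let oP1 x : Om x -> mink (Phi x) (E1 x) = 0.
Proof. by move=> Ox; rewrite minkC o1P. Qed.
Let oP2 x : Om x -> mink (Phi x) (E2 x) = 0.
Proof. by move=> Ox; rewrite minkC o2P. Qed.
Let oP3 x : Om x -> mink (Phi x) (E3 x) = 0.
Proof. by move=> Ox; rewrite minkC o3P. Qed.
Let o14 x : Om x -> mink (E1 x) (normal4 x) = 0.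
Proof. by move=> Ox; rewrite minkC normal4_E1. Qed.
Let o24 x : Om x -> mink (E2 x) (normal4 x) = 0.
Proof. by move=> Ox; rewrite minkC normal4_E2. Qed.
Let o34 x : Om x -> mink (E3 x) (normal4 x) = 0.
Proof. by move=> Ox; rewrite minkC normal4_E3. Qed.
Let oP4 x : Om x -> mink (Phi x) (normal4 x) = 0.
Proof. by move=> Ox; rewrite minkC normal4_Phi. Qed.

Definition orthoE := (frameE, (o21, o13, o23, oP1, oP2, oP3, o14, o24, o34, oP4)).

Lemma dv1_E2 x : Om x -> dv1 E2 x = 0.
Proof.
move=> Ox; have [k1 _ _] := normal_dv Ox.
apply: (frame_eq Ox); rewrite mink0l //.
- by rewrite a' // /a connection1 // oppr0.
- exact: e12.
- by rewrite sym_second_form // shape3_12.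
- exact: dE2P1.
Qed.

Let b_speed x : Om x -> b x = - s x.
Proof.
move=> Ox; have := connection2 Ox; rewrite -/(b x) ds1_h // => E.
apply: (mulfI (x := 4 * h x)); last by rewrite E; field.
by rewrite mulf_neq0 ?pnatr_eq0 // gt_eqF // h_gt0.
Qed.

Lemma dv2_E1 x : Om x -> dv2 E1 x = - s x *: E2 x.
Proof.
move=> Ox; have [_ k2 _] := normal_dv Ox.
apply: (frame_eq Ox); rewrite minkZl !orthoE ?mulr0 ?mulr1 //.
- exact: e21.
- exact: b_speed.
- exact: shape3_12.
- exact: dE1P2.
Qed.

(** The components of D_{E2} E2 are s along E1 by [connection2], 3 f along E3, minus the principal
    curvature along E4, and 1 along [Phi], because <D_{E2} E2, Phi> = -1 = <Phi, Phi>. This is the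
    origin of the formula for [null_field]. *)
Lemma dv2_E2 x : Om x -> dv2 E2 x = null_field x.
Proof.
move=> Ox; have [_ _ k3] := normal_dv Ox.
rewrite null_field_def.
apply: (frame_eq Ox); rewrite !(minkDl, minkNl, minkZl) !orthoE //.
- by rewrite b' // b_speed //; ring.
- by rewrite e22 //; ring.
- by rewrite shape3_22 //; ring.
- by rewrite k3; ring.
- by rewrite dE2P2 //; ring.
Qed.

(** The coefficient 2 s is half the logarithmic derivative 3 (4/3) s of the squared length c^2 f^3;
    the other components come from differentiating orthogonality relations. *)
Lemma dv1_normal4 x : Om x ->
  dv1 normal4 x = - (c ^+ 2 * h x ^+ 3) *: E1 x + (2 * s x) *: normal4 x.
Proof.
move=> Ox; have s4 := smooth_normal4.
have dh3 : ds1 (fun y => c ^+ 2 * h y ^+ 3) x = 4 * s x * (c ^+ 2 * h x ^+ 3).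
  have sh2 := smoothX 2 oOm sh; have sh3 := smoothX 3 oOm sh.
  have cube y : Om y -> h y ^+ 3 = h y * (h y * h y) by move=> _; ring.
  rewrite (dsZ d1) // (ds_eq d1 cube Ox).
  have shh := smoothM oOm sh sh.
  by rewrite !(dsM d1) // ds1_h //; field.
apply: (frame_eq Ox); rewrite !(minkDl, minkNl, minkZl) !orthoE //.
- rewrite (mink_dv_cst d1 s4 sE1 normal4_E1) // dv1_E1 // !(minkDr, minkZr).
  by rewrite !orthoE //; ring.
- rewrite (mink_dv_cst d1 s4 sE2 normal4_E2) // dv1_E2 // mink0r; ring.
- rewrite (mink_dv_cst d1 s4 sE3 normal4_E3) // dv1_E3 // minkZr !orthoE //; ring.
- have := mink_dv_norm d1 s4 normal4_norm Ox; rewrite dh3; lra.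
- rewrite (mink_dv_cst d1 s4 sPhi normal4_Phi) // dPhi1 // !orthoE //; ring.
Qed.

Lemma dv2_normal4 x : Om x -> dv2 normal4 x = (c ^+ 2 * h x ^+ 3) *: E2 x.
Proof.
move=> Ox; have s4 := smooth_normal4.
have dh3 : ds2 (fun y => c ^+ 2 * h y ^+ 3) x = 0.
  have sh2 := smoothX 2 oOm sh; have sh3 := smoothX 3 oOm sh.
  have cube y : Om y -> h y ^+ 3 = h y * (h y * h y) by move=> _; ring.
  rewrite (dsZ d2) // (ds_eq d2 cube Ox).
  have shh := smoothM oOm sh sh.
  by rewrite !(dsM d2) // h2_0 //; ring.
apply: (frame_eq Ox); rewrite !(minkDl, minkNl, minkZl) !orthoE //.
- rewrite (mink_dv_cst d2 s4 sE1 normal4_E1) // dv2_E1 // minkZr !orthoE //; ring.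
- rewrite (mink_dv_cst d2 s4 sE2 normal4_E2) // dv2_E2 // null_field_def.
  by rewrite !(minkDr, minkNr, minkZr) !orthoE //; ring.
- rewrite (mink_dv_cst d2 s4 sE3 normal4_E3) // dv2_E3 // minkZr !orthoE //; ring.
- have := mink_dv_norm d2 s4 normal4_norm Ox; rewrite dh3; lra.
- rewrite (mink_dv_cst d2 s4 sPhi normal4_Phi) // dPhi2 // !orthoE //; ring.
Qed.

Lemma smooth_null_field : smooth Om null_field.
Proof.
have ss := smooth_speed; have s4 := smooth_normal4.
have s3h := smoothM oOm (smooth_cst Om (3 : R)) sh.
apply: (smooth_eq oOm (fun x _ => esym (null_field_def x))).
apply: smoothD => //; apply: smoothB => //; apply: smoothD => //; exact: smoothZ.
Qed.

(** The four orthogonal summands have squared lengths s^2, 9 f^2, c^2 f^3 and -1. With a nonzero [C]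
    in the radical the sum would be 9 C f^(3/2). *)
Lemma null_field_null x : Om x -> mink (null_field x) (null_field x) = 0.
Proof.
move=> Ox; rewrite null_field_def !minkE !orthoE //.
have := speed_sqr Ox; move: (s x) => t; lra.
Qed.

Lemma null_field_Phi x : Om x -> mink (null_field x) (Phi x) = -1.
Proof. by move=> Ox; rewrite null_field_def !minkE !orthoE //; ring. Qed.

Lemma null_field_E2 x : Om x -> mink (null_field x) (E2 x) = 0.
Proof. by move=> Ox; rewrite null_field_def !minkE !orthoE //; ring. Qed.

Lemma dv1_null_field x : Om x -> dv1 null_field x = s x *: null_field x.
Proof.
move=> Ox; have ss := smooth_speed; have s4 := smooth_normal4.
have s3h := smoothM oOm (smooth_cst Om (3 : R)) sh.
have sZ1 := smoothZ oOm ss sE1; have sZ3 := smoothZ oOm s3h sE3.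
have sD := smoothD oOm sZ1 sZ3; have sB := smoothB oOm sD s4.
rewrite (dv_eq d1 (fun y _ => null_field_def y) Ox).
rewrite (dvD d1) // (dvB oOm d1) // (dvD d1) // (dvZ d1) // (dvZ d1) //.
rewrite (dsZ d1) // dPhi1 // dv1_E1 // dv1_E3 // dv1_normal4 // ds1_speed //.
rewrite ds1_h // null_field_def; have := speed_sqr Ox; move: (s x) => t t2.
apply/rowP => j; rewrite !mxE.
(* The E1-coefficients match only through the formula for s^2; multiplied by the coordinate, it
   becomes usable by linear arithmetic. *)
have t2' : E1 x 0 j * (t ^+ 2 - (1 - 9 * h x ^+ 2 - c ^+ 2 * h x ^+ 3)) = 0.
  by rewrite t2 subrr mulr0.
lra.
Qed.

Lemma dv2_null_field x : Om x -> dv2 null_field x = 0.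
Proof.
move=> Ox; have ss := smooth_speed; have s4 := smooth_normal4.
have s3h := smoothM oOm (smooth_cst Om (3 : R)) sh.
have sZ1 := smoothZ oOm ss sE1; have sZ3 := smoothZ oOm s3h sE3.
have sD := smoothD oOm sZ1 sZ3; have sB := smoothB oOm sD s4.
rewrite (dv_eq d2 (fun y _ => null_field_def y) Ox).
rewrite (dvD d2) // (dvB oOm d2) // (dvD d2) // (dvZ d2) // (dvZ d2) //.
rewrite (dsZ d2) // dPhi2 // dv2_E1 // dv2_E3 // dv2_normal4 // ds2_speed //.
rewrite h2_0 //; have := speed_sqr Ox; move: (s x) => t t2.
apply/rowP => j; rewrite !mxE.
have t2' : E2 x 0 j * (t ^+ 2 - (1 - 9 * h x ^+ 2 - c ^+ 2 * h x ^+ 3)) = 0.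
  by rewrite t2 subrr mulr0.
lra.
Qed.

Theorem frame_equations_hold :
  frame_equations Om ds1 ds2 dv1 dv2 Phi E1 E2 E3 normal4 null_field h c.
Proof.
split=> //; [exact: smooth_normal4|exact: smooth_null_field|exact: smooth_speed|].
move=> x Ox; split.
- by split; [exact: h_gt0|exact: speed_gt0|exact: speed_sqr].
- by split; rewrite ?n1 ?n2 ?n3 ?normal4_norm ?nPhi.
- by split; split; rewrite ?orthoE.
- by split; [exact: dv1_E1|exact: dv1_E2|exact: dv1_E3|exact: dv1_normal4|
    exact: dv1_null_field].
split; [exact: ds1_h|exact: h2_0|exact: dv2_E2|exact: dv2_null_field|].
by split; [exact: null_field_null|exact: null_field_E2|exact: null_field_Phi].
Qed.

End StructureEquations.

(** * Biconservativity in the frame *)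

Section HyperbolicCurvature.
Context {R : realType}.
Local Opaque derive.
Implicit Types p q x y z v w : 'rV[R]_5.

Let oT : open [set: 'rV[R]_5]. Proof. exact: openT. Qed.

Let sT_id : smooth [set: 'rV[R]_5] (fun q : 'rV[R]_5 => q).
Proof. exact: smooth_id oT. Qed.

Let diffT (W : normedModType R) (F : 'rV[R]_5 -> W) q :
  smooth setT F -> differentiable F q.
Proof. by move=> sF; exact: smooth_differentiable sF I. Qed.

Let smooth_mink_id y : smooth [set: 'rV[R]_5] (fun q => mink y q).
Proof. by apply: smooth_mink => //; exact: smooth_cst. Qed.

Let derive_mink_id y q v : 'D_v (fun q => mink y q) q = mink y v.
Proof.
rewrite (derive_mink (F := fun=> y)); [|exact/diffT/smooth_cst|exact: diffT].
by rewrite derive_const mink0l add0r derive_id.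
Qed.

Let smooth_projH4 y : smooth [set: 'rV[R]_5] (projH4^~ y).
Proof. by apply: smoothD => //; [exact: smooth_cst|exact: smoothZ]. Qed.

Let derive_projH4 y q v :
  'D_v (projH4^~ y) q = mink y v *: q + mink y q *: v.
Proof.
have d1 := diffT q (smooth_mink_id y).
rewrite derive_add; [|exact/diffT/smooth_cst|
  exact: diffT (smoothZ oT (smooth_mink_id y) sT_id)].
rewrite derive_const add0r derive_scale //.
by rewrite derive_mink_id derive_id.
Qed.

Let field x y q := mink y (projH4 q x) *: q + mink y q *: projH4 q x.

Let covH4_projE x y : covH4 (projH4^~ x) (projH4^~ y) = fun q => projH4 q (field x y q).
Proof. by apply/funext => q; rewrite /covH4 derive_projH4. Qed.

Let projH4_tangent p w : mink w p = 0 -> projH4 p w = w.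
Proof. by rewrite /projH4 => ->; rewrite scale0r addr0. Qed.

(** The derivative of [field x y] contributes <y, x> v + <y, v> x. The first term is cancelled by
    differentiating the projection itself, since <field, p> = - <y, x> at [p]. *)
Let covH4_cov p x y v (X := projH4^~ v) : mink p p = -1 -> mink x p = 0 ->
  mink y p = 0 -> mink v p = 0 ->
  covH4 X (covH4 (projH4^~ x) (projH4^~ y)) p = mink y v *: x.
Proof.
move=> pp xp yp vp; rewrite covH4_projE /covH4 /X (projH4_tangent vp).
have s1 : smooth setT (fun q => mink y (projH4 q x)).
  by apply: smooth_mink => //; exact: smooth_cst.
have sf : smooth setT (field x y) by apply: smoothD => //; exact: smoothZ.
have sm : smooth setT (fun q => mink (field x y q) q) by exact: smooth_mink.
have Dx : 'D_v (projH4^~ x) p = mink x v *: p.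
  by rewrite derive_projH4 xp scale0r addr0.
have Dm : 'D_v (fun q => mink y (projH4 q x)) p = 0.
  rewrite (derive_mink (F := fun=> y)); [|exact/diffT/smooth_cst|exact: diffT].
  by rewrite derive_const mink0l add0r Dx minkZr yp mulr0.
have Df : 'D_v (field x y) p = mink y x *: v + mink y v *: x.
  have d1 := diffT p (smoothZ oT s1 sT_id).
  have d2 := diffT p (smoothZ oT (smooth_mink_id y) (smooth_projH4 x)).
  rewrite (derive_add _ d1 d2) derive_scale; [|exact: diffT..].
  rewrite derive_scale; [|exact: diffT..].
  by rewrite Dm Dx derive_mink_id derive_id yp !scale0r add0r addr0 projH4_tangent.
have fp : field x y p = mink y x *: p.
  by rewrite /field projH4_tangent // yp scale0r addr0.
have -> : 'D_v (fun q => projH4 q (field x y q)) p = mink y v *: x.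
  have d1 := diffT p sf; have d2 := diffT p (smoothZ oT sm sT_id).
  rewrite (derive_add _ d1 d2) (derive_scale _ (diffT p sm) (diffT p sT_id)).
  rewrite (derive_mink _ (diffT p sf) (diffT p sT_id)).
  rewrite Df derive_id fp !(minkDl, minkZl) vp xp pp [mink p v]minkC vp.
  by apply/rowP => j; rewrite !mxE; ring.
by rewrite projH4_tangent // minkZl xp mulr0.
Qed.

(** The extended fields commute at [p], so only the two iterated derivatives contribute; the result
    is the tensor of constant curvature -1. *)
Lemma curvH4E p x y z : mink p p = -1 -> mink x p = 0 -> mink y p = 0 ->
  mink z p = 0 -> curvH4 p x y z = mink x z *: y - mink y z *: x.
Proof.
move=> pp xp yp zp; rewrite /curvH4 /curvature_field !covH4_cov //.
have br : lie_bracket (projH4^~ x) (projH4^~ y) p = 0.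
  rewrite /lie_bracket !projH4_tangent // !derive_projH4 xp yp !scale0r !addr0.
  by rewrite [mink x y]minkC subrr.
have -> : covH4 (lie_bracket (projH4^~ x) (projH4^~ y)) (projH4^~ z) p = 0.
  by rewrite /covH4 br derive0 /projH4 mink0l scale0r addr0.
by rewrite subr0 [mink z x]minkC [mink z y]minkC.
Qed.

End HyperbolicCurvature.

Section BiconservativeInFrame.
Context {R : realType}.
Local Opaque derive.
Variables (Om : set 'rV[R]_2) (Phi : 'rV[R]_2 -> 'rV[R]_5).
Hypotheses (oOm : open Om) (sPhi : smooth Om Phi).
Hypothesis HPhi : forall x, Om x -> H4 (Phi x).
Hypothesis immPhi : forall x, Om x -> row_free (jacobian Phi x).
Variables e1 e2 : 'rV[R]_2 -> 'rV[R]_2.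
Hypotheses (se1 : smooth Om e1) (se2 : smooth Om e2).
Hypothesis m11 : forall x, Om x -> first_form Phi x (e1 x) (e1 x) = 1.
Hypothesis m22 : forall x, Om x -> first_form Phi x (e2 x) (e2 x) = 1.
Hypothesis m12 : forall x, Om x -> first_form Phi x (e1 x) (e2 x) = 0.
Implicit Types (x v w : 'rV[R]_2) (i j k : 'I_2).

Local Notation ds e := (fun g x => derive g x (e x)).
Local Notation E1 := (fun x => 'D_(e1 x) Phi x).
Local Notation E2 := (fun x => 'D_(e2 x) Phi x).

Let dd1 := derivation_along oOm se1.
Let dd2 := derivation_along oOm se2.

Lemma smooth_E e : smooth Om e -> smooth Om (fun x => 'D_(e x) Phi x).
Proof. by move=> se; exact: smooth_derive_along. Qed.

Let expand x u (Ox : Om x) := tangent_expansion oOm sPhi HPhi immPhi Ox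
  (m11 Ox) (m22 Ox) (m12 Ox) u.

(** In flat space directional derivatives commute up to the Lie bracket of [e1] and [e2]. Its frame
    coordinates are read off from its image under [Phi], which is the difference appearing on the
    right. *)
Lemma bracket_frame (F : 'rV[R]_2 -> 'rV[R]_5) x : smooth Om F -> Om x ->
  'D_(e1 x) (fun y => 'D_(e2 y) F y) x - 'D_(e2 x) (fun y => 'D_(e1 y) F y) x =
  mink ('D_(e1 x) E2 x - 'D_(e2 x) E1 x) (E1 x) *: 'D_(e1 x) F x +
  mink ('D_(e1 x) E2 x - 'D_(e2 x) E1 x) (E2 x) *: 'D_(e2 x) F x.
Proof.
move=> sF Ox; have dF := smooth_differentiable sF Ox.
pose u := 'D_(e1 x) e2 x - 'D_(e2 x) e1 x.
have uE : 'D_(e1 x) E2 x - 'D_(e2 x) E1 x = 'D_u Phi x.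
  exact: derive_bracket oOm se1 se2 sPhi Ox.
apply: etrans (derive_bracket oOm se1 se2 sF Ox) _; rewrite uE -/u.
rewrite {1}(expand u Ox) derive_dirD //; congr (_ + _); exact: derive_dirZ.
Qed.

Lemma sym_frame x eta : Om x -> (forall w, mink ('D_w Phi x) eta = 0) ->
  mink (Phi x) eta = 0 -> mink ('D_(e1 x) E2 x) eta = mink ('D_(e2 x) E1 x) eta.
Proof.
move=> Ox t p; have md := mink_derive_normal oOm sPhi HPhi.
apply: etrans (md _ (e1 x) x eta se2 Ox t p) _.
apply: etrans (esym (md _ (e2 x) x eta se1 Ox t p)).
by rewrite (second_formC oOm sPhi).
Qed.

Lemma trace_mean_vec x eta : Om x -> (forall w, mink ('D_w Phi x) eta = 0) ->
  mink (Phi x) eta = 0 ->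
  mink ('D_(e1 x) E1 x) eta + mink ('D_(e2 x) E2 x) eta =
  2 * mink (mean_vec Phi x) eta.
Proof.
move=> Ox t p; have md := mink_derive_normal oOm sPhi HPhi.
rewrite minkZl mulrA mulfV ?mul1r ?pnatr_eq0 //.
rewrite (trace_frame oOm sPhi HPhi immPhi Ox (m11 Ox) (m22 Ox) (m12 Ox)) minkDl.
exact: (congr2 +%R (md _ (e1 x) x eta se1 Ox t p) (md _ (e2 x) x eta se2 Ox t p)).
Qed.

Section Tension.
Variable T : 'rV[R]_2 -> 'rV[R]_5.
Hypotheses (sT : smooth Om T) (TE : forall x, Om x -> tension Phi x = T x).
Hypothesis T_dPhi : forall x v, Om x -> mink (T x) ('D_v Phi x) = 0.
Hypothesis T_Phi : forall x, Om x -> mink (T x) (Phi x) = 0.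

Let dT_Phi v x : Om x -> mink ('D_v T x) (Phi x) = 0.
Proof.
move=> Ox; have : 'D_v (fun y => mink (T y) (Phi y)) x = 0.
  rewrite (@eq_derive_open _ _ _ _ _ (fun=> 0 : R) x v oOm T_Phi Ox).
  exact: derive_const.
rewrite derive_mink; [|exact: smooth_differentiable sT Ox|exact: diff_Phi sPhi _ Ox].
by rewrite T_dPhi // addr0.
Qed.

Let nabla_tension i x : Om x ->
  nabla_phi Phi (basis_vec i) (tension Phi) x = 'D_(basis_vec i) T x.
Proof.
move=> Ox; rewrite /nabla_phi /projH4.
have -> : 'D_(basis_vec i) (tension Phi) x = 'D_(basis_vec i) T x.
  exact: eq_derive_open oOm TE Ox.
by rewrite dT_Phi // scale0r addr0.
Qed.

Let nabla2_tension i j x w : Om x -> mink (nabla_phi Phi (basis_vec i)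
    (nabla_phi Phi (basis_vec j) (tension Phi)) x) ('D_w Phi x) =
  mink ('D_(basis_vec i) ('D_(basis_vec j) T) x) ('D_w Phi x).
Proof.
move=> Ox; rewrite {1}/nabla_phi /projH4 minkDl minkZl [mink (Phi x) _]minkC.
rewrite (mink_dPhi_Phi oOm sPhi HPhi) // mulr0 addr0.
apply: (congr1 (mink^~ _)).
exact: eq_derive_open oOm (fun y Oy => nabla_tension j Oy) Ox.
Qed.

(** Subtracting the derivative along [cov] removes the derivatives of [e], so that the second
    derivative becomes tensorial and can be traced in any frame. *)
Let hessian_along e v x : smooth Om e -> Om x ->
  'D_v (fun y => 'D_(e y) T y) x - 'D_(cov Phi e v x) T x =
  \sum_i \sum_j (v 0 i * e x 0 j) *: ('D_(basis_vec i) ('D_(basis_vec j) T) x -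
    \sum_k christoffel Phi i j k x *: 'D_(basis_vec k) T x).
Proof.
move=> se Ox; have dT := smooth_differentiable sT Ox.
have dDT w := smooth_differentiable (smooth_derive w sT) Ox.
rewrite (derive_derive_along v oOm se sT Ox) /cov derive_dirD //.
rewrite opprD addrACA subrr add0r.
have -> : 'D_(\row_k (\sum_i \sum_j v 0 i * e x 0 j * christoffel Phi i j k x)) T x =
  \sum_k (\sum_i \sum_j (v 0 i * e x 0 j) * christoffel Phi i j k x) *:
    'D_(basis_vec k) T x.
  by rewrite derive_row //; apply: eq_bigr => k _; rewrite mxE.
have row2 j : 'D_v ('D_(basis_vec j) T) x =
    \sum_i v 0 i *: 'D_(basis_vec i) ('D_(basis_vec j) T) x.
  by rewrite derive_row.
have -> : \sum_j e x 0 j *: 'D_v ('D_(delta_mx 0 j) T) x = \sum_j e x 0 j *: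
    \sum_i v 0 i *: 'D_(basis_vec i) ('D_(basis_vec j) T) x.
  by apply: eq_bigr => j _; apply: (congr1 ( *:%R _)); exact: row2.
pose D i j := 'D_(basis_vec i) ('D_(basis_vec j) T) x.
pose P k := 'D_(basis_vec k) T x.
rewrite -/P; have := bilinear_gauss (fun i => v 0 i) (fun j => e x 0 j)
  (D := D) (B := fun i j => D i j - \sum_k christoffel Phi i j k x *: P k)
  (G := fun i j k => christoffel Phi i j k x) (P := P) (g := fun _ _ => 0) (p := 0)
  (fun i j => _).
move=> ->; last by move=> i j; rewrite scaler0 addr0 subrK.
by rewrite scaler0 addr0 addrK.
Qed.

Let tangent_partE x W w : Om x ->
  mink (tangent_part Phi x W) ('D_w Phi x) = mink W ('D_w Phi x).
Proof.
move=> Ox; have De v : 'D_v Phi x = \sum_j v 0 j *: dPhi Phi (basis_vec j) x.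
  exact: dPhi_row sPhi _ _ Ox.
have -> : tangent_part Phi x W =
    mink W ('D_(e1 x) Phi x) *: 'D_(e1 x) Phi x +
    mink W ('D_(e2 x) Phi x) *: 'D_(e2 x) Phi x.
  rewrite /tangent_part; under eq_bigr do under eq_bigr do rewrite -scalerA.
  rewrite (trace_frame oOm sPhi HPhi immPhi Ox (m11 Ox) (m22 Ox) (m12 Ox)).
  have term v : \sum_i \sum_j (v 0 i * v 0 j) *:
      (mink W (dPhi Phi (basis_vec i) x) *: dPhi Phi (basis_vec j) x) =
      mink W ('D_v Phi x) *: 'D_v Phi x.
    rewrite De mink_sumr; move: (fun j => dPhi Phi (basis_vec j) x) => P.
    rewrite scaler_suml; apply: eq_bigr => i _; rewrite scaler_sumr.
    by apply: eq_bigr => j _; rewrite minkZr !scalerA; congr (_ *: _); ring.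
  by rewrite !term.
have wE := dPhi_expansion oOm sPhi HPhi immPhi Ox (m11 Ox) (m22 Ox) (m12 Ox) w.
have m1E : mink ('D_(e1 x) Phi x) ('D_w Phi x) = first_form Phi x w (e1 x).
  exact: minkC.
have m2E : mink ('D_(e2 x) Phi x) ('D_w Phi x) = first_form Phi x w (e2 x).
  exact: minkC.
move: wE m1E m2E; move: (first_form Phi x w (e1 x)) (first_form Phi x w (e2 x)) => n1 n2.
move: ('D_w Phi x) ('D_(e1 x) Phi x) ('D_(e2 x) Phi x) => D D1 D2 DE n1E n2E.
by rewrite !minkE n1E n2E DE !minkE; ring.
Qed.

(** In constant curvature -1, with [T] normal, R(X, T) Y = <X, Y> T, which is again normal.
    Biconservativity thus concerns the rough Laplacian alone. *)
Let curvature_term x w : Om x -> mink (\sum_i \sum_j gram_inv Phi x i j *: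
    curvH4 (Phi x) (dPhi Phi (basis_vec i) x) (tension Phi x)
      (dPhi Phi (basis_vec j) x)) ('D_w Phi x) = 0.
Proof.
move=> Ox; rewrite mink_suml big1 // => i _; rewrite mink_suml big1 // => j _.
have dP v := mink_dPhi_Phi oOm sPhi HPhi v Ox.
rewrite minkZl TE // curvH4E ?(mink_PhiPhi HPhi) ?T_Phi //; try exact: dP.
have -> : mink (T x) (dPhi Phi (basis_vec j) x) = 0 by exact: T_dPhi.
by rewrite scale0r subr0 minkZl T_dPhi // !mulr0.
Qed.

Let cov_self e x : smooth Om e -> Om x -> cov Phi e (e x) x =
  mink ('D_(e x) (fun y => 'D_(e y) Phi y) x) (E1 x) *: e1 x +
  mink ('D_(e x) (fun y => 'D_(e y) Phi y) x) (E2 x) *: e2 x.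
Proof.
move=> se Ox; have mt := mink_derive_tangent oOm sPhi HPhi immPhi.
apply: etrans (expand (cov Phi e (e x) x) Ox) _.
by apply: (congr2 (fun p q => p *: e1 x + q *: e2 x)); apply: esym; exact: mt.
Qed.

Let sE1 := smooth_E se1.
Let sE2 := smooth_E se2.

Let e11 x : Om x -> mink ('D_(e1 x) E1 x) (E1 x) = 0.
Proof.
move=> Ox; have := mink_dv_norm dd1 sE1 (k := fun=> 1) m11 Ox.
by rewrite (ds_cst dd1) => /eqP; rewrite mulf_eq0 pnatr_eq0 => /eqP.
Qed.
Let e22 x : Om x -> mink ('D_(e2 x) E2 x) (E2 x) = 0.
Proof.
move=> Ox; have := mink_dv_norm dd2 sE2 (k := fun=> 1) m22 Ox.
by rewrite (ds_cst dd2) => /eqP; rewrite mulf_eq0 pnatr_eq0 => /eqP.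
Qed.

(** The coordinate trace becomes a trace over [e1] and [e2]. In an orthonormal frame the derivative
    of Ei along itself on the surface has a single component, along the other field, which produces
    the two first-order terms. *)
Let trace_term x w : Om x ->
  mink (rough_laplacian Phi (tension Phi) x) ('D_w Phi x) =
  - mink ('D_(e1 x) (fun y => 'D_(e1 y) T y) x -
        mink ('D_(e1 x) E1 x) (E2 x) *: 'D_(e2 x) T x +
        ('D_(e2 x) (fun y => 'D_(e2 y) T y) x -
         mink ('D_(e2 x) E2 x) (E1 x) *: 'D_(e1 x) T x)) ('D_w Phi x).
Proof.
move=> Ox; have dT := smooth_differentiable sT Ox.
rewrite minkNl; congr (- _).
transitivity (mink (\sum_i \sum_j gram_inv Phi x i j *:
    ('D_(basis_vec i) ('D_(basis_vec j) T) x -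
     \sum_k christoffel Phi i j k x *: 'D_(basis_vec k) T x)) ('D_w Phi x)).
  rewrite !mink_suml; apply: eq_bigr => i _; rewrite !mink_suml.
  apply: eq_bigr => j _; rewrite !minkZl; congr (_ * _).
  rewrite [LHS]minkDl [RHS]minkDl !minkNl.
  apply: (congr2 (fun p q => p - q)); first exact: nabla2_tension.
  apply: (congr1 (mink^~ _)); apply: eq_bigr => k _.
  by apply: (congr1 ( *:%R _)); exact: nabla_tension.
rewrite (trace_frame oOm sPhi HPhi immPhi Ox (m11 Ox) (m22 Ox) (m12 Ox)).
apply: (congr1 (mink^~ _)).
apply: (congr2 +%R (etrans (esym (hessian_along (e1 x) se1 Ox)) _)
                   (etrans (esym (hessian_along (e2 x) se2 Ox)) _)).
  apply: (congr1 (fun z => _ - z)).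
  rewrite (cov_self se1 Ox) e11 // scale0r add0r.
  exact: derive_dirZ.
apply: (congr1 (fun z => _ - z)).
rewrite (cov_self se2 Ox) e22 // scale0r addr0.
exact: derive_dirZ.
Qed.

Lemma biconservative_in_frame x w : Om x ->
  tangent_part Phi x (bitension Phi x) = 0 ->
  mink ('D_(e1 x) (fun y => 'D_(e1 y) T y) x -
        mink ('D_(e1 x) E1 x) (E2 x) *: 'D_(e2 x) T x +
        ('D_(e2 x) (fun y => 'D_(e2 y) T y) x -
         mink ('D_(e2 x) E2 x) (E1 x) *: 'D_(e1 x) T x)) ('D_w Phi x) = 0.
Proof.
move=> Ox bic; have := tangent_partE (bitension Phi x) w Ox; rewrite bic mink0l.
have -> : mink (bitension Phi x) ('D_w Phi x) = _ :=
  etrans (minkDl _ _ _) (congr2 +%R (minkNl _ _) (minkNl _ _)).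
by rewrite curvature_term // trace_term // opprK subr0 => <-.
Qed.

End Tension.

End BiconservativeInFrame.

Lemma sum_delta_row (R : pzRingType) n (j : 'I_n) (F : 'I_n -> R) :
  \sum_k (delta_mx 0 j : 'rV[R]_n) 0 k * F k = F j.
Proof.
rewrite (bigD1 j) //= big1 ?addr0 => [|k kj]; first by rewrite mxE !eqxx mul1r.
by rewrite mxE (negbTE kj) andbF mul0r.
Qed.

(** * The structure equations on the given surface *)

Section SurfaceFrame.
Context {R : realType}.
Local Opaque derive.
Variables (Om : set 'rV[R]_2) (Phi : 'rV[R]_2 -> 'rV[R]_5) (h : 'rV[R]_2 -> R).
Variable c : R.
Hypotheses (oOm : open Om) (sPhi : smooth Om Phi).
Hypothesis HPhi : forall x, Om x -> H4 (Phi x).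
Hypothesis immPhi : forall x, Om x -> row_free (jacobian Phi x).
Hypothesis hE : forall x, Om x -> h x = mnorm (mean_vec Phi x).
Hypothesis h_gt0 : forall x, Om x -> 0 < h x.
Hypothesis grad_neq0 : forall x, Om x -> gradient Phi h x != 0.
Hypothesis parallel : forall x i, Om x -> normal_part Phi x
  (nabla_phi Phi (basis_vec i) (frame3 Phi h) x) = 0.
Hypothesis bicons : forall x, Om x -> tangent_part Phi x (bitension Phi x) = 0.
Hypothesis c_neq0 : c != 0.
Hypothesis shape4 : forall x E2 E4, Om x ->
  is_frame2 Phi h x E2 -> is_frame4 Phi h x E2 E4 ->
  Defs.shape Phi x E4 (frame1 Phi h x) = (c * h x `^ (3 / 2)) *: frame1 Phi h x /\
  Defs.shape Phi x E4 E2 = - (c * h x `^ (3 / 2)) *: E2.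
Hypothesis h1E : forall x, Om x ->
  'D_(frame1 Phi h x) h x = 4 / 3 * h x * speed c (h x).
Hypothesis h1_gt0 : forall x, Om x -> 0 < 'D_(frame1 Phi h x) h x.
Implicit Types (x v w : 'rV[R]_2) (i j k : 'I_2).

Local Notation e1 := (frame1 Phi h).
Local Notation e2 := (frame2 Phi h).
Local Notation E3 := (frame3 Phi h).

Let se1 : smooth Om e1.
Proof. exact: smooth_frame1 oOm sPhi HPhi immPhi hE h_gt0 grad_neq0. Qed.
Let se2 : smooth Om e2.
Proof. exact: smooth_frame2 oOm sPhi HPhi immPhi hE h_gt0 grad_neq0. Qed.
Let m11 x (Ox : Om x) := first_form_frame1 oOm sPhi HPhi immPhi grad_neq0 Ox.
Let m22 x (Ox : Om x) := first_form_frame2 oOm sPhi HPhi immPhi grad_neq0 Ox.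
Let m12 x (Ox : Om x) := first_form_frame12 h sPhi Ox.

Lemma shape_mink x eta X Y Z : Om x -> Defs.shape Phi x eta X = Z ->
  mink (second_form Phi X Y x) eta = first_form Phi x Z Y.
Proof.
move=> Ox <-; rewrite /Defs.shape (first_form_gram sPhi) // -gram_mulE mulmxKV; last first.
  exact: gram_unit oOm sPhi HPhi immPhi _ Ox.
have sE Y' : mink (second_form Phi X Y' x) eta =
    \sum_j Y' 0 j * \sum_i X 0 i * mink (second_form_basis Phi i j x) eta.
  rewrite mink_suml; under [RHS]eq_bigr do rewrite mulr_sumr.
  rewrite exchange_big; apply: eq_bigr => i _; rewrite mink_suml.
  by apply: eq_bigr => j _; rewrite minkZl mulrCA mulrA.
rewrite mxE sE; apply: eq_bigr => j _.
apply: etrans (mulrC _ _) _; apply: (congr2 *%R); last by rewrite mxE.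
rewrite mxE; apply: etrans (esym (sE (basis_vec j))).
apply: esym; exact: (sum_delta_row j (fun k => \sum_i X 0 i *
  mink (second_form_basis Phi i k x) eta)).
Qed.

Let det_flip (E1 E2 E3 E4 E5 : 'rV[R]_5) :
  \det (\matrix_(i < 5) nth 0 [:: E1; E2; E3; - E4; E5] i) =
  - \det (\matrix_(i < 5) nth 0 [:: E1; E2; E3; E4; E5] i).
Proof.
pose d : 'rV[R]_5 := \row_i (if i == inord 3 then -1 else 1).
have -> : \matrix_(i < 5) nth 0 [:: E1; E2; E3; - E4; E5] i =
  diag_mx d *m \matrix_(i < 5) nth 0 [:: E1; E2; E3; E4; E5] i.
  rewrite mul_diag_mx; apply/matrixP => i j; move: i.
  by apply: forall_I5; rewrite !mxE -val_eqE /= !inordK //= ?mul1r // mxE mulN1r.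
rewrite det_mulmx det_diag (bigD1 (inord 3)) //= big1 => [|i i3].
  by rewrite mxE eqxx mulr1 mulN1r.
by rewrite mxE (negbTE i3).
Qed.

(** A unit normal exists by counting dimensions. Passing to its opposite flips a nonzero
    determinant, so one of the two signs meets the orientation condition. *)
Let E4_exists x : Om x -> exists E4 : 'rV[R]_5, is_frame4 Phi h x (e2 x) E4.
Proof.
move=> Ox; have PP := mink_PhiPhi HPhi Ox.
have [E4 [u4 o41 o42 o43 o4P]] :=
  exists_unit_normal ('D_(e1 x) Phi x) ('D_(e2 x) Phi x) (E3 x) PP.
have dE v : mink E4 ('D_v Phi x) = 0.
  have key (D1 D2 D : 'rV[R]_5) a b : D = a *: D1 + b *: D2 ->
      mink E4 D1 = 0 -> mink E4 D2 = 0 -> mink E4 D = 0.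
    by move=> -> o1 o2; rewrite minkDr !minkZr o1 o2 !mulr0 addr0.
  exact: key (dPhi_expansion oOm sPhi HPhi immPhi Ox (m11 Ox) (m22 Ox) (m12 Ox) v)
    o41 o42.
have d0 : \det (\matrix_(i < 5) nth 0
    [:: 'D_(e1 x) Phi x; 'D_(e2 x) Phi x; E3 x; E4; Phi x] i) != 0.
  have unit_neq0 (z : R) : z = 1 -> z != 0 by move=> ->; exact: oner_neq0.
  have swap (y z : 'rV[R]_5) : mink y z = 0 -> mink z y = 0 by rewrite minkC.
  have f3 v := frame3_dPhi h oOm sPhi HPhi immPhi v Ox.
  have dP v := mink_dPhi_Phi oOm sPhi HPhi v Ox.
  have P0 : mink (Phi x) (Phi x) != 0 by rewrite PP oppr_eq0 oner_eq0.
  exact: (frame_det (unit_neq0 _ (m11 Ox)) (unit_neq0 _ (m22 Ox))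
    (unit_neq0 _ (frame3_unit hE h_gt0 Ox)) (unit_neq0 _ u4) P0
    (m12 Ox) (swap _ _ (f3 _)) (swap _ _ o41) (dP _) (swap _ _ (f3 _))
    (swap _ _ o42) (dP _) (swap _ _ o43) (frame3_Phi h oOm sPhi HPhi Ox) o4P).
have [dp|dn] := ltP 0 (\det (\matrix_(i < 5) nth 0
    [:: 'D_(e1 x) Phi x; 'D_(e2 x) Phi x; E3 x; E4; Phi x] i)).
  by exists E4; split; [exact: u4|exact: o43|exact: o4P|move=> i; exact: dE|].
have neg0 y z : mink y z = 0 -> mink (- y) z = 0 by move=> yz; rewrite minkNl yz oppr0.
exists (- E4); split.
- by rewrite minkNl minkNr opprK.
- exact: neg0.
- exact: neg0.
- by move=> i; apply: neg0; exact: dE.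
- rewrite det_flip oppr_gt0 lt_neqAle dn andbT; exact: d0.
Qed.

Theorem surface_frame :
  exists (f1 f2 : 'rV[R]_2 -> 'rV[R]_2) (f3 fV fW : 'rV[R]_2 -> 'rV[R]_5),
  [/\ smooth Om f1, smooth Om f2,
    (forall x v, Om x -> exists a b, v = a *: f1 x + b *: f2 x) &
    frame_equations Om (fun g x => 'D_(f1 x) g x) (fun g x => 'D_(f2 x) g x)
      (fun F x => 'D_(f1 x) F x) (fun F x => 'D_(f2 x) F x) Phi
      (fun x => 'D_(f1 x) Phi x) (fun x => 'D_(f2 x) Phi x) f3 fV fW h c].
Proof.
have sh := smooth_mean_curvature oOm sPhi HPhi immPhi hE h_gt0.
have sE3 := smooth_frame3 oOm sPhi HPhi immPhi hE h_gt0.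
have o3d v x (Ox : Om x) := frame3_dPhi h oOm sPhi HPhi immPhi v Ox.
have o3P x (Ox : Om x) := frame3_Phi h oOm sPhi HPhi Ox.
have dP v x (Ox : Om x) := mink_dPhi_Phi oOm sPhi HPhi v Ox.
have sT : smooth Om (fun y => (2 * h y) *: E3 y).
  apply: smoothZ => //; apply: smoothM => //; exact: smooth_cst.
have TE x : Om x -> tension Phi x = (2 * h x) *: E3 x.
  by move=> Ox; rewrite /tension (mean_vec_frame3 Phi h_gt0) // scalerA.
(* Built from derivatives of [Phi] and the smooth E3, so that smoothness does not hang on a choice
   of E4. *)
pose fV x := 'D_(e1 x) (fun y => 'D_(e1 y) Phi y) x + h x *: E3 x - Phi x.
pose fW x := speed c (h x) *: 'D_(e1 x) Phi x + (3 * h x) *: E3 x - fV x + Phi x.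
exists e1, e2, E3, fV, fW; split => //.
  move=> x v Ox; exists (first_form Phi x v (e1 x)), (first_form Phi x v (e2 x)).
  exact: (tangent_expansion oOm sPhi HPhi immPhi Ox (m11 Ox) (m22 Ox) (m12 Ox) v).
apply: (frame_equations_hold oOm (derivation_along oOm se1)
  (derivation_along oOm se2) (smooth_E oOm sPhi se1) (smooth_E oOm sPhi se2)
  sE3 sh m11 m22 m12 (fun x => o3d _ x) (fun x => o3d _ x)).
- by move=> x Ox; exact: (derive_frame3E oOm sPhi HPhi immPhi hE h_gt0 grad_neq0
    parallel _ Ox).
- by move=> x Ox; exact: (derive_frame3E oOm sPhi HPhi immPhi hE h_gt0 grad_neq0
    parallel _ Ox).
- by move=> x Ox; exact: (bracket_frame oOm sPhi HPhi immPhi se1 se2 m11 m22 m12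
    sE3 Ox).
- move=> x Ox; apply: (sym_frame oOm sPhi HPhi se1 se2 Ox).
    by move=> w; rewrite minkC; exact: o3d.
  by rewrite minkC; exact: o3P.
- move=> x Ox; apply: etrans (trace_mean_vec oOm sPhi HPhi immPhi se1 se2 m11 m22
    m12 Ox _ _) _.
  + by move=> w; rewrite minkC; exact: o3d.
  + by rewrite minkC; exact: o3P.
  + by rewrite (mean_vec_frame3 Phi h_gt0) // minkZl (frame3_unit hE h_gt0) // mulr1.
- exact: h_gt0.
- exact: h1_gt0.
- exact: derive_frame2_h oOm sPhi HPhi immPhi hE h_gt0 grad_neq0.
- have bif := biconservative_in_frame oOm sPhi HPhi immPhi se1 se2 m11 m22 m12 sT TE.
  have T0 x v : Om x -> mink ((2 * h x) *: E3 x) ('D_v Phi x) = 0.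
    by move=> Ox; rewrite minkZl o3d // mulr0.
  have TP x : Om x -> mink ((2 * h x) *: E3 x) (Phi x) = 0.
    by move=> Ox; rewrite minkZl o3P // mulr0.
  by move=> Eb x [->|->] Ox; exact: (bif T0 TP x _ Ox (bicons Ox)).
- exact: sPhi.
- exact: c_neq0.
- by move=> x Ox; exact: (mink_PhiPhi HPhi Ox).
- by move=> x Ox; exact: (frame3_unit hE h_gt0 Ox).
- by move=> x Ox; exact: dP.
- by move=> x Ox; exact: dP.
- by move=> x Ox; exact: o3P.
- by [].
- by [].
- exact: h1E.
- move=> x Ox; have [E4 fr4] := E4_exists Ox.
  have fr2 := frame2_is_frame2 oOm sPhi HPhi immPhi grad_neq0 Ox.
  have [s1 s2] := shape4 Ox fr2 fr4.
  have [u4 o43 o4P o4d _] := fr4.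
  have dE v : mink ('D_v Phi x) E4 = 0.
    rewrite (dPhi_row sPhi _ Ox) mink_suml big1 // => j _.
    by rewrite minkZl minkC; apply/eqP; rewrite mulf_eq0; apply/orP; right;
      apply/eqP; exact: o4d.
  have PE : mink (Phi x) E4 = 0 by rewrite minkC.
  have md e v (se : smooth Om e) := mink_derive_normal oOm sPhi HPhi v se Ox dE PE.
  exists E4; split; [exact: u4| |].
    by split; [exact: dE|exact: dE|by rewrite minkC|exact: PE].
  split.
  + apply: etrans (md _ _ se1) _; apply: etrans (shape_mink _ Ox s1) _.
    rewrite -[X in first_form _ _ _ X]scale1r (first_formZ sPhi) // m11 //.
    by rewrite !mulr1.
  + apply: etrans (md _ _ se2) _; apply: etrans (shape_mink _ Ox s1) _.
    rewrite -[X in first_form _ _ _ X]scale1r (first_formZ sPhi) // m12 //.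
    by rewrite mulr0.
  + apply: etrans (md _ _ se1) _; apply: etrans (shape_mink _ Ox s2) _.
    rewrite -[X in first_form _ _ _ X]scale1r (first_formZ sPhi) // first_formC.
    by rewrite m12 // mulr0.
  + apply: etrans (md _ _ se2) _; apply: etrans (shape_mink _ Ox s2) _.
    rewrite -[X in first_form _ _ _ X]scale1r (first_formZ sPhi) // m22 //.
    by rewrite !mulr1.
- by [].
- by [].
Qed.

End SurfaceFrame.

(** * Adapted coordinates *)

(** The integral starts at an endpoint to the left of [t0], so that the fundamental theorem applies
    at [t0] and on both sides of it. *)
Lemma local_antiderivative (R : realType) (D : set R) (g : R -> R) (t0 : R) :
  open D -> D t0 -> (forall t, D t -> {for t, continuous g}) ->
  exists (G : R -> R) (d : R), [/\ 0 < d, ball t0 d `<=` D &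
    forall t, ball t0 d t -> is_derive t 1 G (g t)].
Proof.
move=> oD Dt0 cg.
have : nbhs t0 D by exact: open_nbhs_nbhs.
move=> /nbhs_ballP[r /= r0 rD].
pose a := t0 - r / 2; pose b := t0 + r / 2.
have abD t : a <= t <= b -> D t.
  move=> /andP[at_ tb]; apply: rD; rewrite /ball /= ltr_norml.
  by move: at_ tb; rewrite /a /b => at_ tb; apply/andP; split; lra.
have cab : {within `[a, b], continuous g}.
  apply: continuous_in_subspaceT => t; rewrite inE /= in_itv /= => tab.
  exact/cg/abD.
have iab := continuous_compact_integrable (@segment_compact R a b) cab.
exists (fun x => (\int[lebesgue_measure]_(t in `[a, x]) g t)%R), (r / 2).
have r20 : 0 < r / 2 by rewrite divr_gt0.
split=> // [t|t]; rewrite /ball /= ltr_norml => /andP[h1 h2].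
  by apply: abD; rewrite /a /b; apply/andP; split; lra.
have at_ : a < t by rewrite /a; lra.
have tb : t < b by rewrite /b; lra.
have cgt : {for t, continuous g} by apply/cg/abD; rewrite !ltW.
have [dG GE] := continuous_FTC1_closed tb iab at_ cgt.
by split=> //; rewrite -derive1E.
Qed.

Lemma segment_const_real (R : realType) (V : normedModType R) (F : V -> R) x v :
  (forall s, 0 <= s <= 1 -> differentiable F (x + s *: v)) ->
  (forall s, 0 <= s <= 1 -> 'D_v F (x + s *: v) = 0) -> F (x + v) = F x.
Proof.
move=> dF DF; apply/eqP; rewrite -subr_eq0; apply/eqP.
have [s /andP[s0 s1]] := line_MVT ltr01 dF.
by rewrite scale1r DF ?mulr0 // !ltW.
Qed.

Section RowBall.
Context {R : realType}.

Lemma pt0 (u v : R) : pt u v 0 0 = u. Proof. by rewrite mxE. Qed.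
Lemma pt1 (u v : R) : pt u v 0 1 = v. Proof. by rewrite mxE. Qed.

Lemma pt_eta (y : 'rV[R]_2) : y = pt (y 0 0) (y 0 1).
Proof. by apply/rowP; apply: forall_I2; rewrite ?pt0 ?pt1. Qed.

Lemma ball_pt (y z : 'rV[R]_2) (r : R) : 0 < r -> ball y r z <->
  `|y 0 0 - z 0 0| < r /\ `|y 0 1 - z 0 1| < r.
Proof.
move=> r0; rewrite in_ballE; split=> [yz|[h0 h1]].
  by split; rewrite (le_lt_trans _ yz) //; have := coord_le_norm (y - z);
    [move=> /(_ 0)|move=> /(_ 1)]; rewrite !mxE.
have [i ni] : exists i, `|y - z| <= `|(y - z) 0 i|.
  have [le|le] := leP `|(y - z) 0 0| `|(y - z) 0 1|.
    by exists 1; apply: row_norm_le => //; apply: forall_I2.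
  by exists 0; apply: row_norm_le => //; apply: forall_I2 => //; exact: ltW.
by apply: le_lt_trans ni _; move: i; apply: forall_I2; rewrite !mxE.
Qed.

Lemma pt_u (u s v : R) : pt (u + s) v = pt u v + s *: delta_mx 0 0.
Proof. by apply/rowP; apply: forall_I2; rewrite !mxE /=; ring. Qed.

Lemma pt_v (u s v : R) : pt u (v + s) = pt u v + s *: delta_mx 0 1.
Proof. by apply/rowP; apply: forall_I2; rewrite !mxE /=; ring. Qed.

End RowBall.

Section Coordinates.
Context {R : realType}.
Local Opaque derive.
Variables (x0 : 'rV[R]_2) (r : R).
Hypothesis r_gt0 : 0 < r.
Local Notation Om := (ball x0 r).
Variables (Phi : 'rV[R]_2 -> 'rV[R]_5) (h : 'rV[R]_2 -> R).
Variables (c : R) (f1 f2 : 'rV[R]_2 -> 'rV[R]_2).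
Variables (f3 fV fW : 'rV[R]_2 -> 'rV[R]_5).
Hypotheses (sPhi : smooth Om Phi) (sf1 : smooth Om f1)
  (sf2 : smooth Om f2).
Hypothesis span : forall x v, Om x -> exists a b, v = a *: f1 x + b *: f2 x.
Local Notation E1 := (fun x => 'D_(f1 x) Phi x).
Local Notation E2 := (fun x => 'D_(f2 x) Phi x).
Hypothesis FE : frame_equations Om (fun g x => 'D_(f1 x) g x)
  (fun g x => 'D_(f2 x) g x) (fun F x => 'D_(f1 x) F x)
  (fun F x => 'D_(f2 x) F x) Phi E1 E2 f3 fV fW h c.
Local Notation s x := (speed c (h x)).
Implicit Types (x y v : 'rV[R]_2).

Let oOm : open Om. Proof. exact: ball_open. Qed.
Let x0_in : Om x0. Proof. exact: ballxx. Qed.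
Let dd1 := derivation_along oOm sf1.
Let dd2 := derivation_along oOm sf2.
Let sh := fe_smooth_h FE.
Let sW := fe_smoothW FE.
Let sE2 := fe_smooth2 FE.

Let h_gt0 x : Om x -> 0 < h x.
Proof. by move=> Ox; have [[]] := fe_at FE Ox. Qed.

Lemma smooth_power a : smooth Om (fun x => h x `^ a).
Proof. exact: smooth_comp_powR. Qed.

Let derive_power a v x : Om x ->
  'D_v (fun x => h x `^ a) x = a * h x `^ (a - 1) * 'D_v h x.
Proof.
move=> Ox; have dh := smooth_differentiable sh Ox.
exact: (derive_real_comp v dh (is_derive1_powR a (h_gt0 Ox))).
Qed.

(** The exponents 3/4 and -3/4 give the rates [s x] and [- s x], which match the growth of [fW]
    along E1. *)
Lemma derive1_power a x : Om x ->
  'D_(f1 x) (fun x => h x `^ a) x = a * (4 / 3) * s x * h x `^ a.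
Proof.
move=> Ox; rewrite derive_power //; have [_ _ _ _ [-> _ _ _ _]] := fe_at FE Ox.
have <- : h x * h x `^ (a - 1) = h x `^ a.
  rewrite powRB ?powRr1 ?ltW ?h_gt0 //; last first.
    by rewrite (gt_eqF (h_gt0 Ox)) implybT.
  by rewrite mulrCA mulfV ?mulr1 // gt_eqF // h_gt0.
by ring.
Qed.

Lemma derive2_power a x : Om x -> 'D_(f2 x) (fun x => h x `^ a) x = 0.
Proof.
move=> Ox; rewrite derive_power //; have [_ _ _ _ [_ -> _ _ _]] := fe_at FE Ox.
by rewrite mulr0.
Qed.

Let p x := h x `^ (- (3 / 4)).
Let q x := h x `^ (3 / 4).
Let sp : smooth Om p. Proof. exact: smooth_power. Qed.
Let sq : smooth Om q. Proof. exact: smooth_power. Qed.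

Lemma power_inv x : Om x -> q x * p x = 1.
Proof.
move=> Ox; rewrite /q /p powRN mulfV // gt_eqF // powR_gt0 // h_gt0 //.
Qed.

Let D1p x : Om x -> 'D_(f1 x) p x = - s x * p x.
Proof. by move=> Ox; rewrite derive1_power // /p; field. Qed.
Let D2q x : Om x -> 'D_(f2 x) q x = 0.
Proof. exact: derive2_power. Qed.
Let D2p x : Om x -> 'D_(f2 x) p x = 0.
Proof. exact: derive2_power. Qed.

(** The fields [f1] and [f2] span every direction and the ball is convex, so each point is joined to
    [x0] by a segment along which the derivative vanishes. *)
Lemma constant_on_ball n (F : 'rV[R]_2 -> 'rV[R]_n) x : smooth Om F ->
  (forall y, Om y -> 'D_(f1 y) F y = 0) -> (forall y, Om y -> 'D_(f2 y) F y = 0) ->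
  Om x -> F x = F x0.
Proof.
move=> sF F1 F2 bx; rewrite -[x](subrK x0) addrC.
have inb t : 0 <= t <= 1 -> Om (x0 + t *: (x - x0)).
  move=> /andP[t0 t1]; move: bx; rewrite !in_ballE => bx.
  rewrite opprD addNKr normrN normrZ ger0_norm //.
  by apply: le_lt_trans bx; rewrite distrC ler_piMl.
have D0 v y : Om y -> 'D_v F y = 0.
  move=> Oy; have dF := smooth_differentiable sF Oy.
  have [a [b ->]] := span v Oy.
  apply: etrans (derive_dirD _ _ dF) _.
  apply: etrans (congr2 +%R (derive_dirZ _ _ dF) (derive_dirZ _ _ dF)) _.
  by rewrite (F1 _ Oy) (F2 _ Oy) !scaler0 addr0.
apply: segment_const => t /inb Ot; first exact: smooth_differentiable sF Ot.
exact: D0.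
Qed.

(** The constant value of f^(-3/4) W, halved so that v^2 in the parametrization receives the
    coefficient f^(3/4). *)
Definition null_direction := (p x0 / 2) *: fW x0.
Definition spacelike_direction := E2 x0.
Local Notation b2 := null_direction.
Local Notation b1 := spacelike_direction.

Let q_gt0 x : Om x -> 0 < q x.
Proof. by move=> Ox; rewrite powR_gt0 // h_gt0. Qed.

Lemma null_field_on_ball x : Om x -> fW x = (2 * q x) *: b2.
Proof.
move=> Ox.
have sZ : smooth Om (fun x => p x *: fW x) by exact: smoothZ.
have D1 y : Om y -> 'D_(f1 y) (fun x => p x *: fW x) y = 0.
  move=> Oy; apply: etrans (dvZ dd1 sp sW Oy) _; rewrite D1p //.
  have [_ _ _ [_ _ _ _ ->] _] := fe_at FE Oy.
  by rewrite scalerA -scalerDl mulNr [p y * _]mulrC addNr scale0r.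
have D2 y : Om y -> 'D_(f2 y) (fun x => p x *: fW x) y = 0.
  move=> Oy; apply: etrans (dvZ dd2 sp sW Oy) _; rewrite D2p //.
  have [_ _ _ _ [_ _ _ -> _]] := fe_at FE Oy.
  by rewrite scale0r scaler0 addr0.
have E := constant_on_ball sZ D1 D2 Ox.
rewrite /null_direction scalerA.
have -> : 2 * q x * (p x0 / 2) = q x * p x0 by field.
by rewrite -scalerA -E scalerA power_inv // scale1r.
Qed.

Lemma null_direction_null : mink b2 b2 = 0.
Proof.
have [_ _ _ _ [_ _ _ _ [n _ _]]] := fe_at FE x0_in.
by rewrite minkZl minkZr n !mulr0.
Qed.

Lemma null_direction_orth : mink b1 b2 = 0.
Proof.
have [_ _ _ _ [_ _ _ _ [_ n _]]] := fe_at FE x0_in.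
by rewrite minkZr minkC n mulr0.
Qed.

Lemma spacelike_direction_unit : mink b1 b1 = 1.
Proof. by have [_ [_ n _ _ _] _ _ _] := fe_at FE x0_in. Qed.

(** This is <W, Phi> = -1 with W = 2 f^(3/4) b2 inserted; on the directrix it becomes the last
    formula of the theorem. *)
Lemma null_direction_Phi x : Om x -> mink (Phi x) b2 = - (2 * q x)^-1.
Proof.
move=> Ox; have [_ _ _ _ [_ _ _ _ [_ _]]] := fe_at FE Ox.
rewrite null_field_on_ball // minkZl [mink b2 _]minkC => E.
have q0 : q x != 0 by rewrite gt_eqF // q_gt0.
by apply: (mulfI (x := 2 * q x)); rewrite ?mulf_neq0 ?pnatr_eq0 // E; field.
Qed.

(** The leading factor compensates <b2, Phi(x0)> = - 1 / (2 f^(3/4)(x0)), so that the E2-derivative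
    is exactly [q x] and not a constant multiple of it. *)
Definition height x := - q x0 * mink (E2 x) (Phi x0).

Let sPhi0 : smooth Om (fun=> Phi x0). Proof. exact: smooth_cst. Qed.

Let smp : smooth Om (fun x => mink (E2 x) (Phi x0)).
Proof. exact: smooth_mink. Qed.

Lemma smooth_height : smooth Om height.
Proof. by apply: smoothM => //; exact: smooth_cst. Qed.

Let dheight ds dv x : derivation Om ds dv -> Om x ->
  ds height x = - q x0 * mink (dv E2 x) (Phi x0).
Proof.
move=> dd Ox; apply: etrans (dsZ dd _ smp Ox) _; congr (_ * _).
apply: etrans (ds_mink dd sE2 sPhi0 Ox) _.
by rewrite (dv_cst dd) mink0r addr0.
Qed.

Lemma derive1_height x : Om x -> 'D_(f1 x) height x = 0.
Proof.
move=> Ox; apply: etrans (dheight dd1 Ox) _.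
by have [_ _ _ [_ -> _ _ _] _] := fe_at FE Ox; rewrite mink0l mulr0.
Qed.

Lemma derive2_height x : Om x -> 'D_(f2 x) height x = q x.
Proof.
move=> Ox; apply: etrans (dheight dd2 Ox) _.
have [_ _ _ _ [_ _ -> _ _]] := fe_at FE Ox.
rewrite null_field_on_ball // minkZl minkC null_direction_Phi //.
have q0 : q x0 != 0 by rewrite gt_eqF // q_gt0.
by field.
Qed.

Lemma height_base : height x0 = 0.
Proof.
have [_ _ [_ [_ _ o] _] _ _] := fe_at FE x0_in.
by rewrite /height o mulr0.
Qed.

(** Both sides have E1-derivative zero and E2-derivative [fW], and they agree at [x0], where the
    height is 0. *)
Lemma frame2_on_ball x : Om x -> E2 x = b1 + (2 * height x) *: b2.
Proof.
move=> Ox; have sw := smooth_height.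
have s2w : smooth Om (fun x => 2 * height x).
  by apply: smoothM => //; exact: smooth_cst.
have sb : smooth Om (fun=> b2) by exact: smooth_cst.
have sZ : smooth Om (fun x => (2 * height x) *: b2) by exact: smoothZ.
have sF : smooth Om (fun x => E2 x - (2 * height x) *: b2) by exact: smoothB.
have dF ds dv y : derivation Om ds dv -> Om y ->
    dv (fun x => E2 x - (2 * height x) *: b2) y =
    dv E2 y - (2 * ds height y) *: b2.
  move=> dd Oy; apply: etrans (dvB oOm dd sE2 sZ Oy) _.
  apply: etrans (congr1 (fun z => dv E2 y - z) (dvZ dd s2w sb Oy)) _.
  by rewrite (dv_cst dd) scaler0 addr0 (dsZ dd _ sw Oy).
have D1 y : Om y -> 'D_(f1 y) (fun x => E2 x - (2 * height x) *: b2) y = 0.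
  move=> Oy; apply: etrans (dF _ _ _ dd1 Oy) _; rewrite derive1_height //.
  have [_ _ _ [_ -> _ _ _] _] := fe_at FE Oy.
  by rewrite mulr0 scale0r subrr.
have D2 y : Om y -> 'D_(f2 y) (fun x => E2 x - (2 * height x) *: b2) y = 0.
  move=> Oy; apply: etrans (dF _ _ _ dd2 Oy) _; rewrite derive2_height //.
  have [_ _ _ _ [_ _ -> _ _]] := fe_at FE Oy.
  by rewrite null_field_on_ball // subrr.
have E := constant_on_ball sF D1 D2 Ox.
rewrite height_base mulr0 scale0r subr0 in E.
by rewrite -[LHS](subrK ((2 * height x) *: b2)) E.
Qed.

(** Dividing by f^(3/4) makes the E2-derivative 1, so that v is arc length along the integral curves
    of E2; the price is E1 v = - s v. *)
Definition vcoord x := height x * p x.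

Lemma smooth_vcoord : smooth Om vcoord.
Proof. by apply: smoothM => //; exact: smooth_height. Qed.

Lemma derive1_vcoord x : Om x -> 'D_(f1 x) vcoord x = - (s x * vcoord x).
Proof.
move=> Ox; apply: etrans (dsM dd1 smooth_height sp Ox) _.
by rewrite derive1_height // D1p // /vcoord; ring.
Qed.

Lemma derive2_vcoord x : Om x -> 'D_(f2 x) vcoord x = 1.
Proof.
move=> Ox; apply: etrans (dsM dd2 smooth_height sp Ox) _.
by rewrite derive2_height // D2p // mulr0 addr0 power_inv.
Qed.

Lemma vcoord_base : vcoord x0 = 0.
Proof. by rewrite /vcoord height_base mul0r. Qed.

Lemma frame2_vcoord x : Om x -> E2 x = b1 + (2 * vcoord x * q x) *: b2.
Proof.
move=> Ox; apply: etrans (frame2_on_ball Ox) _; congr (_ + _ *: _).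
by rewrite /vcoord -!mulrA [p x * q x]mulrC power_inv // mulr1.
Qed.

End Coordinates.

Section DerivationQuotient.
Context {R : realType} (Om : set 'rV[R]_2).
Variables (ds : ('rV[R]_2 -> R) -> 'rV[R]_2 -> R)
  (dv : ('rV[R]_2 -> 'rV[R]_5) -> 'rV[R]_2 -> 'rV[R]_5).
Hypotheses (oOm : open Om) (dd : derivation Om ds dv).
Implicit Types (g : 'rV[R]_2 -> R).

Lemma dsV g x : smooth Om g -> (forall y, Om y -> g y != 0) -> Om x ->
  ds (fun y => (g y)^-1) x = - ds g x / g x ^+ 2.
Proof.
move=> sg g0 Ox; have sV := smoothV oOm g0 sg.
have E y : Om y -> g y * (g y)^-1 = 1 by move=> Oy; rewrite mulfV // g0.
have := dsM dd sg sV Ox; rewrite (ds_eq_cst dd E Ox).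
have gx := g0 x Ox; move: (ds _ x) (ds _ x) (g x) gx => X Y z z0 H.
apply: (mulfI z0); have -> : z * (- Y / z ^+ 2) = - (Y / z) by field.
lra.
Qed.

Lemma ds_sqrt g x : smooth Om g -> (forall y, Om y -> 0 < g y) -> Om x ->
  ds (fun y => Num.sqrt (g y)) x = ds g x / (2 * Num.sqrt (g x)).
Proof.
move=> sg g0 Ox; have sS := smooth_sqrt oOm g0 sg.
have E y : Om y -> g y = Num.sqrt (g y) * Num.sqrt (g y).
  by move=> Oy; rewrite -expr2 sqr_sqrtr // ltW // g0.
have := dsM dd sS sS Ox; rewrite -(ds_eq dd E Ox) => ->.
have : Num.sqrt (g x) != 0 by rewrite gt_eqF // sqrtr_gt0 g0.
by move: (ds _ x) (Num.sqrt _) => X z z0; field.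
Qed.

End DerivationQuotient.

(** * The Frenet frame of the directrix *)

Section Frenet.
Context {R : realType} (Om : set 'rV[R]_2).
Variables (ds1 ds2 : ('rV[R]_2 -> R) -> 'rV[R]_2 -> R)
  (dv1 dv2 : ('rV[R]_2 -> 'rV[R]_5) -> 'rV[R]_2 -> 'rV[R]_5).
Hypotheses (oOm : open Om) (d1 : derivation Om ds1 dv1).
Variables (Phi f1 f2 f3 fV fW : 'rV[R]_2 -> 'rV[R]_5) (h : 'rV[R]_2 -> R).
Variable c : R.
Hypothesis c_neq0 : c != 0.
Hypothesis FE : frame_equations Om ds1 ds2 dv1 dv2 Phi f1 f2 f3 fV fW h c.
Local Notation s x := (speed c (h x)).
Implicit Types x : 'rV[R]_2.

Let sh := fe_smooth_h FE.
Let s3 := fe_smooth3 FE.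
Let sV := fe_smoothV FE.
Let h_gt0 x : Om x -> 0 < h x.
Proof. by move=> Ox; have [[]] := fe_at FE Ox. Qed.
Let h1 x : Om x -> ds1 h x = 4 / 3 * h x * s x.
Proof. by move=> Ox; have [_ _ _ _ []] := fe_at FE Ox. Qed.

(** Together with [m] it satisfies r^2 = 1 + m^2 and c^2 h^3 = (m h)^2, so that the Frenet equations
    become rational identities in [h], [r], [m] and s. *)
Let r x := Num.sqrt (1 + c ^+ 2 * h x).
Let m x := `|c| * Num.sqrt (h x).

Let r_arg x : Om x -> 0 < 1 + c ^+ 2 * h x.
Proof.
move=> Ox; rewrite ltr_wpDr // ltW // mulr_gt0 ?h_gt0 //.
by rewrite lt_neqAle sqr_ge0 eq_sym expf_neq0.
Qed.
Let r_gt0 x : Om x -> 0 < r x.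
Proof. by move=> Ox; rewrite sqrtr_gt0 r_arg. Qed.
Let m_gt0 x : Om x -> 0 < m x.
Proof. by move=> Ox; rewrite mulr_gt0 ?normr_gt0 // sqrtr_gt0 h_gt0. Qed.
Let m_sqr x : Om x -> m x ^+ 2 = c ^+ 2 * h x.
Proof.
move=> Ox; rewrite exprMn sqr_sqrtr ?ltW ?h_gt0 //.
by rewrite real_normK // num_real.
Qed.
Let r_sqr x : Om x -> r x ^+ 2 = 1 + m x ^+ 2.
Proof. by move=> Ox; rewrite m_sqr // sqr_sqrtr // ltW // r_arg. Qed.

Let sarg : smooth Om (fun x => 1 + c ^+ 2 * h x).
Proof.
apply: smoothD => //; first exact: smooth_cst.
by apply: smoothM => //; exact: smooth_cst.
Qed.
Let sr : smooth Om r. Proof. exact: smooth_sqrt. Qed.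
Let sq : smooth Om (fun x => Num.sqrt (h x)). Proof. exact: smooth_sqrt. Qed.
Let sm : smooth Om m.
Proof. by apply: smoothM => //; exact: smooth_cst. Qed.

Let m1 x : Om x -> ds1 m x = 2 / 3 * s x * m x.
Proof.
move=> Ox; apply: etrans (dsZ d1 _ sq Ox) _.
rewrite (ds_sqrt oOm d1) // h1 // /m.
have q2 : Num.sqrt (h x) ^+ 2 = h x by rewrite sqr_sqrtr // ltW // h_gt0.
have : Num.sqrt (h x) != 0 by rewrite gt_eqF // sqrtr_gt0 h_gt0.
move: (s x) => t; rewrite -{2}q2; move: (Num.sqrt _) => z z0; by field.
Qed.

Let r1 x : Om x -> ds1 r x = 2 / 3 * s x * m x ^+ 2 / r x.
Proof.
move=> Ox; rewrite (ds_sqrt oOm d1) //.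
have c1 : smooth Om (fun=> 1 : R) by exact: smooth_cst.
have c2 : smooth Om (fun x => c ^+ 2 * h x).
  by apply: smoothM => //; exact: smooth_cst.
rewrite (dsD d1 c1 c2 Ox) (ds_cst d1) (dsZ d1) // h1 // m_sqr // -/(r x).
have : r x != 0 by rewrite gt_eqF // r_gt0.
by move: (s x) (r x) => t z z0; field.
Qed.

(** The vector in parentheses is the part of D_{E1} E1 tangent to the hyperboloid, of length
    [h x * r x]; the binormal is the orthogonal direction in the plane of E3 and E4. Neither E3 nor
    E4 turns inside this plane along E1, so the torsion is the E1-derivative of the angle arctan(|c|
    sqrt f). *)
Definition frenet_normal x := (h x * r x)^-1 *: (fV x - h x *: f3 x).
Definition frenet_binormal x :=
  (m x * h x * r x)^-1 *: (fV x + (m x ^+ 2 * h x) *: f3 x).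
Definition curvature x := h x * r x.
Definition torsion x :=
  2 * `|c| * Num.sqrt (h x) / (3 * (1 + c ^+ 2 * h x)) * s x.

Let hr0 x : Om x -> h x * r x != 0.
Proof. by move=> Ox; exact: (lt0r_neq0 (mulr_gt0 (h_gt0 Ox) (r_gt0 Ox))). Qed.
Let mhr0 x : Om x -> m x * h x * r x != 0.
Proof.
move=> Ox; apply: lt0r_neq0.
exact: (mulr_gt0 (mulr_gt0 (m_gt0 Ox) (h_gt0 Ox)) (r_gt0 Ox)).
Qed.
Let shr : smooth Om (fun x => h x * r x). Proof. exact: smoothM. Qed.
Let smh : smooth Om (fun x => m x * h x). Proof. exact: smoothM. Qed.
Let smhr : smooth Om (fun x => m x * h x * r x). Proof. exact: smoothM. Qed.
Let sm2h : smooth Om (fun x => m x ^+ 2 * h x).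
Proof. by apply: smoothM => //; exact: smoothX. Qed.
Let sN' : smooth Om (fun x => fV x - h x *: f3 x).
Proof. by apply: smoothB => //; exact: smoothZ. Qed.
Let sB' : smooth Om (fun x => fV x + (m x ^+ 2 * h x) *: f3 x).
Proof. by apply: smoothD => //; exact: smoothZ. Qed.
Let sa : smooth Om (fun x => (h x * r x)^-1).
Proof. exact: smoothV. Qed.
Let sb : smooth Om (fun x => (m x * h x * r x)^-1).
Proof. exact: smoothV. Qed.

Lemma smooth_frenet_normal : smooth Om frenet_normal.
Proof. exact: smoothZ. Qed.
Lemma smooth_frenet_binormal : smooth Om frenet_binormal.
Proof. exact: smoothZ. Qed.

Lemma curvature_gt0 x : Om x -> 0 < curvature x.
Proof. by move=> Ox; rewrite mulr_gt0 ?h_gt0 ?r_gt0. Qed.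

Lemma torsion_ge0 x : Om x -> 0 <= torsion x.
Proof.
move=> Ox; rewrite !mulr_ge0 ?invr_ge0 ?mulr_ge0 ?sqrtr_ge0 //.
  by rewrite ltW // r_arg.
Qed.

Let torsionE x : Om x -> torsion x = 2 * m x / (3 * r x ^+ 2) * s x.
Proof.
by move=> Ox; rewrite /torsion -[2 * _ * _]mulrA sqr_sqrtr // ltW // r_arg.
Qed.

Let a1 x : Om x -> ds1 (fun x => (h x * r x)^-1) x =
  - (4 / 3 * r x ^+ 2 + 2 / 3 * m x ^+ 2) * s x / (h x * r x ^+ 3).
Proof.
move=> Ox; rewrite (dsV oOm d1 shr hr0 Ox) (dsM d1 sh sr Ox) h1 // r1 //.
have := h_gt0 Ox; have := r_gt0 Ox; move: (h x) (r x) (m x) (s x) => H r' m' t.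
by move=> /lt0r_neq0 r0 /lt0r_neq0 h0; field; apply/andP.
Qed.

Let b1 x : Om x -> ds1 (fun x => (m x * h x * r x)^-1) x =
  - (2 * r x ^+ 2 + 2 / 3 * m x ^+ 2) * s x / (m x * h x * r x ^+ 3).
Proof.
move=> Ox; rewrite (dsV oOm d1 smhr mhr0 Ox) (dsM d1 smh sr Ox) (dsM d1 sm sh Ox).
rewrite h1 // r1 // m1 //.
have := h_gt0 Ox; have := r_gt0 Ox; have := m_gt0 Ox.
move: (h x) (r x) (m x) (s x) => H r' m' t.
by move=> /lt0r_neq0 m0 /lt0r_neq0 r0 /lt0r_neq0 h0; field; apply/and3P.
Qed.

Lemma dv1_frenet_tangent x : Om x ->
  dv1 f1 x = curvature x *: frenet_normal x + Phi x.
Proof.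
move=> Ox; have [_ _ _ [-> _ _ _ _] _] := fe_at FE Ox.
rewrite /curvature /frenet_normal scalerA mulfV ?hr0 // scale1r.
by rewrite scaleNr [- _ + _]addrC.
Qed.

Lemma dv1_frenet_normal x : Om x ->
  dv1 frenet_normal x = - curvature x *: f1 x + torsion x *: frenet_binormal x.
Proof.
move=> Ox; apply: etrans (dvZ d1 sa sN' Ox) _.
have sZ := smoothZ oOm sh s3.
rewrite a1 // (dvB oOm d1 sV sZ Ox) (dvZ d1 sh s3 Ox) h1 // torsionE //.
have [_ _ _ [_ _ -> -> _] _] := fe_at FE Ox.
rewrite /curvature /frenet_binormal.
(* Both [c] and the even powers of [m] are eliminated in favour of [r], which leaves an identity of
   rational functions in each coordinate. *)
have C3 : c ^+ 2 * h x ^+ 3 = (r x ^+ 2 - 1) * h x ^+ 2.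
  by rewrite r_sqr // m_sqr //; ring.
have m2 : m x ^+ 2 = r x ^+ 2 - 1 by rewrite r_sqr //; ring.
rewrite C3 m2; apply/rowP => j; rewrite !mxE.
have := lt0r_neq0 (h_gt0 Ox); have := lt0r_neq0 (r_gt0 Ox).
have := lt0r_neq0 (m_gt0 Ox).
move: (h x) (r x) (m x) (s x) (f1 x 0 j) (f3 x 0 j) (fV x 0 j).
by move=> H r' m' t F1 F3 FV m0 r0 h0; field; apply/and3P.
Qed.

Lemma dv1_frenet_binormal x : Om x ->
  dv1 frenet_binormal x = - torsion x *: frenet_normal x.
Proof.
move=> Ox; apply: etrans (dvZ d1 sb sB' Ox) _.
have sZ := smoothZ oOm sm2h s3; have sm2 := smoothM oOm sm sm.
have dm2h : ds1 (fun x => m x ^+ 2 * h x) x = 8 / 3 * s x * m x ^+ 2 * h x.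
  rewrite (dsM d1 sm2 sh Ox) (dsM d1 sm sm Ox) m1 // h1 //.
  by move: (s x) (m x) => t m'; field.
rewrite b1 // (dvD d1 sV sZ Ox) (dvZ d1 sm2h s3 Ox) dm2h torsionE //.
have [_ _ _ [_ _ -> -> _] _] := fe_at FE Ox.
rewrite /frenet_normal.
have C3 : c ^+ 2 * h x ^+ 3 = (r x ^+ 2 - 1) * h x ^+ 2.
  by rewrite r_sqr // m_sqr //; ring.
have m2 : m x ^+ 2 = r x ^+ 2 - 1 by rewrite r_sqr //; ring.
(* The fraction is expanded by [m x] so that the numerator contains [m x ^+ 2], which is then
   replaced by [r x ^+ 2 - 1]. *)
have E : 2 * m x / (3 * r x ^+ 2) * s x =
    2 * (m x ^+ 2) / (3 * m x * r x ^+ 2) * s x.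
  have := lt0r_neq0 (r_gt0 Ox); have := lt0r_neq0 (m_gt0 Ox).
  by move: (r x) (m x) (s x) => r' m' t m0 r0; field; apply/andP.
rewrite E C3 m2; apply/rowP => j; rewrite !mxE.
have := lt0r_neq0 (h_gt0 Ox); have := lt0r_neq0 (r_gt0 Ox).
have := lt0r_neq0 (m_gt0 Ox).
move: (h x) (r x) (m x) (s x) (f1 x 0 j) (f3 x 0 j) (fV x 0 j).
by move=> H r' m' t F1 F3 FV m0 r0 h0; field; apply/and3P.
Qed.

Lemma frenet_unit x : Om x ->
  mink (frenet_normal x) (frenet_normal x) = 1 /\
  mink (frenet_binormal x) (frenet_binormal x) = 1.
Proof.
move=> Ox; have [_ [_ _ n3 nV _] [_ _ [ o3V _ _] ] _ _] := fe_at FE Ox.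
have oV3 : mink (fV x) (f3 x) = 0 by rewrite minkC.
rewrite /frenet_normal /frenet_binormal.
have C3 : c ^+ 2 * h x ^+ 3 = m x ^+ 2 * h x ^+ 2.
  by rewrite m_sqr //; ring.
have m2 : r x ^+ 2 = 1 + m x ^+ 2 by exact: r_sqr.
have := lt0r_neq0 (h_gt0 Ox); have := lt0r_neq0 (r_gt0 Ox).
have := lt0r_neq0 (m_gt0 Ox).
rewrite C3 in nV; move: m2; move: (h x) (r x) (m x) n3 nV o3V oV3.
move: (f3 x) (fV x) => e3 eV H r' m' n3 nV o3V oV3 m2 m0 r0 h0.
rewrite !(minkDl, minkDr, minkNl, minkNr, minkZl, minkZr) n3 nV o3V oV3.
split.
  apply: (mulfI (x := H ^+ 2 * r' ^+ 2)); first by rewrite mulf_neq0 ?expf_neq0.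
  transitivity (H ^+ 2 * (1 + m' ^+ 2)); last by rewrite m2 mulr1.
  by field; apply/andP.
apply: (mulfI (x := m' ^+ 2 * H ^+ 2 * r' ^+ 2)).
  by rewrite !mulf_neq0 ?expf_neq0.
transitivity (m' ^+ 2 * H ^+ 2 * (1 + m' ^+ 2)); last by rewrite m2 mulr1.
by field; apply/and3P.
Qed.

Lemma frenet_orthogonal x : Om x ->
  [/\ mink (f1 x) (frenet_normal x) = 0, mink (f1 x) (frenet_binormal x) = 0 &
      mink (frenet_normal x) (frenet_binormal x) = 0].
Proof.
move=> Ox; have [_ [_ _ n3 nV _] [[_ o13 o1V _] _ [ o3V _ _] ] _ _] := fe_at FE Ox.
have oV3 : mink (fV x) (f3 x) = 0 by rewrite minkC.
have C3 : c ^+ 2 * h x ^+ 3 = m x ^+ 2 * h x ^+ 2.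
  by rewrite m_sqr //; ring.
rewrite /frenet_normal /frenet_binormal.
rewrite C3 in nV; move: n3 nV o13 o1V o3V oV3.
move: (f1 x) (f3 x) (fV x) (h x) (r x) (m x) => e1 e3 eV H r' m' n3 nV o13 o1V o3V oV3.
rewrite !(minkDl, minkDr, minkNl, minkNr, minkZl, minkZr) n3 nV o13 o1V o3V oV3.
by split; ring.
Qed.

Lemma frenet_normal_space x w : Om x -> w = Phi x \/ w = f2 x ->
  mink (frenet_normal x) w = 0 /\ mink (frenet_binormal x) w = 0.
Proof.
move=> Ox wE; have [_ _ [_ [ o23 o2V _] [_ o3P oVP]] _ _] := fe_at FE Ox.
have [m3 mV] : mink (f3 x) w = 0 /\ mink (fV x) w = 0.
  by case: wE => ->; split=> //; rewrite minkC.
rewrite /frenet_normal /frenet_binormal; move: m3 mV.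
move: (f3 x) (fV x) (h x) (r x) (m x) => e3 eV H r' m' m3 mV.
rewrite !(minkDl, minkNl, minkZl) m3 mV.
by split; ring.
Qed.

End Frenet.

Lemma ball_box (R : realType) (u0 rho u v : R) : 0 < rho ->
  ball (pt u0 0) rho (pt u v) <->
  `]u0 - rho, u0 + rho[%classic u /\ `](- rho), rho[%classic v.
Proof.
move=> rho_gt0; rewrite ball_pt // !pt0 !pt1 /= !in_itv /= sub0r normrN.
rewrite distrC !ltr_norml ltrBlDl ltrBrDl.
by split=> [[]|[]].
Qed.

(** * The parametrization by parabolas and its directrix *)

Section Parametrization.
Context {R : realType}.
Local Opaque derive.
Variables (x0 : 'rV[R]_2) (r : R).
Hypothesis r_gt0 : 0 < r.
Local Notation Om := (ball x0 r).
Variables (Phi : 'rV[R]_2 -> 'rV[R]_5) (h : 'rV[R]_2 -> R).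
Variables (c : R) (f1 f2 : 'rV[R]_2 -> 'rV[R]_2).
Variables (f3 fV fW : 'rV[R]_2 -> 'rV[R]_5).
Hypotheses (c_neq0 : c != 0) (sPhi : smooth Om Phi) (sf1 : smooth Om f1)
  (sf2 : smooth Om f2).
Hypothesis HPhi : forall x, Om x -> H4 (Phi x).
Hypothesis span : forall x v, Om x -> exists a b, v = a *: f1 x + b *: f2 x.
Local Notation E1 := (fun x => 'D_(f1 x) Phi x).
Local Notation E2 := (fun x => 'D_(f2 x) Phi x).
Hypothesis FE : frame_equations Om (fun g x => 'D_(f1 x) g x)
  (fun g x => 'D_(f2 x) g x) (fun F x => 'D_(f1 x) F x)
  (fun F x => 'D_(f2 x) F x) Phi E1 E2 f3 fV fW h c.
Local Notation s x := (speed c (h x)).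
Local Notation b2 := (null_direction x0 h fW).
Local Notation b1 := (spacelike_direction x0 Phi f2).
Local Notation vcoord := (vcoord x0 Phi h f2).
Implicit Types (x y w : 'rV[R]_2).

Variables (u0 rho : R) (inv : 'rV[R]_2 -> 'rV[R]_2).
Hypothesis rho_gt0 : 0 < rho.
Local Notation Q := (ball (pt u0 0) rho).
Hypothesis sinv : smooth Q inv.
Hypothesis inv_in : forall y, Q y -> Om (inv y).
Hypothesis inv_vcoord : forall y, Q y -> vcoord (inv y) = y 0 1.
Hypothesis derive_inv : forall y w, Q y -> 'D_w inv y =
  w 0 0 *: (f1 (inv y) + (s (inv y) * vcoord (inv y)) *: f2 (inv y)) +
  w 0 1 *: f2 (inv y).

Let I := `]u0 - rho, u0 + rho[%classic.
Let J := `](- rho), rho[%classic.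
Let gam u := inv (pt u 0).

Let oOm : open Om. Proof. exact: ball_open. Qed.
Let dd1 := derivation_along oOm sf1.
Let dd2 := derivation_along oOm sf2.
Let sh := fe_smooth_h FE.

Let Q_pt u v : Q (pt u v) <-> I u /\ J v.
Proof. exact: ball_box. Qed.

Let J0 : J 0. Proof. by rewrite /J /= in_itv /= oppr_lt0 rho_gt0. Qed.
Let Q0 u : I u -> Q (pt u 0). Proof. by move=> Iu; apply/Q_pt. Qed.
Let gam_in u : I u -> Om (gam u). Proof. by move=> /Q0/inv_in. Qed.

Let derive_v n (F : 'rV[R]_2 -> 'rV[R]_n) y : Q y -> smooth Om F ->
  'D_(delta_mx 0 1) (F \o inv) y = 'D_(f2 (inv y)) F (inv y).
Proof.
move=> Qy sF; rewrite derive_comp; first last.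
- exact: smooth_differentiable sF (inv_in Qy).
- exact: smooth_differentiable sinv Qy.
by rewrite derive_inv // !mxE /= scale0r add0r scale1r.
Qed.

Let derive_v_real (F : 'rV[R]_2 -> R) y : Q y -> smooth Om F ->
  'D_(delta_mx 0 1) (F \o inv) y = 'D_(f2 (inv y)) F (inv y).
Proof.
move=> Qy sF; rewrite derive_comp; first last.
- exact: smooth_differentiable sF (inv_in Qy).
- exact: smooth_differentiable sinv Qy.
by rewrite derive_inv // !mxE /= scale0r add0r scale1r.
Qed.

Let Q_segment u v t : I u -> J v -> 0 <= t <= 1 ->
  Q (pt u 0 + t *: (v *: delta_mx 0 1)).
Proof.
move=> Iu Jv /andP[t0 t1]; rewrite scalerA -pt_v add0r; apply/Q_pt; split=> //.
move: Jv; rewrite /J /= !in_itv /= -!ltr_norml normrM (ger0_norm t0).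
by apply: le_lt_trans; rewrite ler_piMl.
Qed.

Let const_v n (F : 'rV[R]_2 -> 'rV[R]_n) u v : I u -> J v -> smooth Om F ->
  (forall x, Om x -> 'D_(f2 x) F x = 0) -> F (inv (pt u v)) = F (gam u).
Proof.
move=> Iu Jv sF F2; rewrite -[v]add0r pt_v.
have dF y : Q y -> differentiable (F \o inv) y.
  move=> Qy; apply: differentiable_comp.
    exact: smooth_differentiable sinv Qy.
  exact: smooth_differentiable sF (inv_in Qy).
apply: (segment_const (F := F \o inv)) => t t01.
  exact/dF/Q_segment.
have Qt := Q_segment Iu Jv t01.
apply: etrans (derive_dirZ _ _ (dF _ Qt)) _.
by rewrite (derive_v Qt sF) (F2 _ (inv_in Qt)) scaler0.
Qed.

Let h_const u v : I u -> J v -> h (inv (pt u v)) = h (gam u).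
Proof.
move=> Iu Jv; rewrite -[v]add0r pt_v.
have dF y : Q y -> differentiable (h \o inv) y.
  move=> Qy; apply: differentiable_comp.
    exact: smooth_differentiable sinv Qy.
  exact: smooth_differentiable sh (inv_in Qy).
apply: (segment_const_real (F := h \o inv)) => t t01.
  exact/dF/Q_segment.
have Qt := Q_segment Iu Jv t01.
apply: etrans (derive_dirZ _ _ (dF _ Qt)) _.
rewrite (derive_v_real Qt sh).
have [_ _ _ _ [_ -> _ _ _]] := fe_at FE (inv_in Qt).
by rewrite scaler0.
Qed.

Let q x := h x `^ (3 / 4).
Let sq : smooth Om q. Proof. exact: (smooth_power FE). Qed.
Let D2q x : Om x -> 'D_(f2 x) q x = 0.
Proof. exact: (derive2_power FE). Qed.
Let sv : smooth Om vcoord. Proof. exact: (smooth_vcoord FE). Qed.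

(** What must depend on u alone: its E2-derivative is E2 - b1 - 2 v f^(3/4) b2 = 0, and on v = 0 it
    equals [Phi]. *)
Let parabola x := Phi x - vcoord x *: b1 - (vcoord x ^+ 2 * q x) *: b2.

Let vcoord_gam u : I u -> vcoord (gam u) = 0.
Proof. by move=> /Q0 Qu; rewrite inv_vcoord // pt1. Qed.

Let derive_parabola x : Om x -> smooth Om parabola /\ 'D_(f2 x) parabola x = 0.
Proof.
move=> Ox.
have sb1 : smooth Om (fun=> b1) by exact: smooth_cst.
have sb2 : smooth Om (fun=> b2) by exact: smooth_cst.
have sv2 : smooth Om (fun x => vcoord x * vcoord x) by exact: smoothM.
have sv2q : smooth Om (fun x => vcoord x * vcoord x * q x) by exact: smoothM.
have sZ1 : smooth Om (fun x => vcoord x *: b1) by exact: smoothZ.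
have sZ2 : smooth Om (fun x => (vcoord x * vcoord x * q x) *: b2) by exact: smoothZ.
have sB : smooth Om (fun x => Phi x - vcoord x *: b1) by exact: smoothB.
split; first exact: smoothB.
apply: etrans (dvB oOm dd2 sB sZ2 Ox) _.
apply: etrans (congr2 (fun a b => a - b) (dvB oOm dd2 sPhi sZ1 Ox)
  (dvZ dd2 sv2q sb2 Ox)) _.
rewrite (dvZ dd2 sv sb1 Ox) (dsM dd2 sv2 sq Ox) (dsM dd2 sv sv Ox).
rewrite !(dv_cst dd2) !scaler0 !addr0.
rewrite D2q // mulr0 addr0 (derive2_vcoord r_gt0 sf1 sf2 span FE Ox).
rewrite (frame2_vcoord r_gt0 sf1 sf2 span FE Ox) scale1r.
rewrite mul1r mulr1 -mulr2n -mulr_natl -/(q x).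
by apply/rowP => j; rewrite !mxE; ring.
Qed.

Lemma parametrization u v : I u -> J v ->
  h (inv (pt u v)) = h (gam u) /\
  Phi (inv (pt u v)) =
    Phi (gam u) + v *: b1 + (v ^+ 2 * h (gam u) `^ (3 / 4)) *: b2.
Proof.
move=> Iu Jv; split; first exact: h_const.
have [sP _] := derive_parabola (gam_in Iu).
have := const_v Iu Jv sP (fun x Ox => proj2 (derive_parabola Ox)).
rewrite /parabola vcoord_gam // inv_vcoord ?pt1; last exact/Q_pt.
rewrite /q h_const // scale0r subr0 expr0n mul0r scale0r subr0 => <-.
by apply/rowP => j; rewrite !mxE; ring.
Qed.

Let is_derive_pt (u : R) : is_derive u 1 (fun t : R => pt t 0) (delta_mx 0 0).
Proof.
have -> : (fun t : R => pt t 0) = (fun t : R => pt 0 0 + t *: delta_mx 0 0).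
  by apply/funext => t; rewrite -pt_u add0r.
exact: is_derive_line.
Qed.

(** On v = 0 the correction s v E2 in the coordinate field of u vanishes, so [gam] is an integral
    curve of [f1]. *)
Let derive_u (W : normedModType R) (F : 'rV[R]_2 -> W) (u : R) : I u -> smooth Om F ->
  is_derive u 1 (F \o gam) ('D_(f1 (gam u)) F (gam u)).
Proof.
move=> Iu sF; have Qu := Q0 Iu.
have di : is_derive u 1 gam (f1 (gam u)).
  have := is_derive_curve (g := fun t : R => pt t 0)
    (smooth_differentiable sinv Qu) (is_derive_pt u).
  rewrite derive_inv // !mxE /= scale0r addr0 scale1r.
  by rewrite vcoord_gam // mulr0 scale0r addr0.
exact: is_derive_curve (smooth_differentiable sF (gam_in Iu)) di.
Qed.

Let smooth_gam : smooth I gam.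
Proof.
have oI : open I by exact: interval_open.
have sp : smooth I (fun t : R => pt t 0).
  apply: (smooth_row (F := fun j (t : R) => nth 0 [:: t; 0] j)) oI _ => j.
  move: j; apply: forall_I2; [exact: smooth_id|exact: smooth_cst].
exact: (smooth_comp_row oI Q0 sp sinv).
Qed.

Lemma profile_derivative u : I u ->
  [/\ 0 < h (gam u), derivable (h \o gam) u 1,
      derive1 (h \o gam) u = 4 / 3 * h (gam u) * s (gam u) &
      0 < derive1 (h \o gam) u].
Proof.
move=> Iu; have [[h0 s0 _] _ _ _ [h1 _ _ _ _]] := fe_at FE (gam_in Iu).
have [d1 d2] := derive_u Iu sh.
rewrite derive1E d2 h1; split=> //.
by rewrite !mulr_gt0 // invr_gt0.
Qed.

Let derive_sigma u : I u -> derive1 (Phi \o gam) u = E1 (gam u).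
Proof. by move=> Iu; rewrite derive1E; have [_ ->] := derive_u Iu sPhi. Qed.

Let frame2_gam u : I u -> E2 (gam u) = b1.
Proof.
move=> Iu.
apply: etrans (frame2_vcoord r_gt0 sf1 sf2 span FE (gam_in Iu)) _.
by rewrite vcoord_gam // mulr0 mul0r scale0r addr0.
Qed.

Lemma directrix :
  [/\ smooth I (Phi \o gam), (forall u, I u -> H3 b1 (Phi (gam u))),
    (forall u, I u ->
       mink (derive1 (Phi \o gam) u) (derive1 (Phi \o gam) u) = 1) &
    (forall u, I u ->
       mink (Phi (gam u)) b2 = - (2 * h (gam u) `^ (3 / 4))^-1)].
Proof.
split=> [|u Iu|u Iu|u Iu].
- have oI : open I by exact: interval_open.
  exact: (smooth_comp_row oI gam_in smooth_gam sPhi).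
- split; first exact/HPhi/gam_in.
  rewrite /= -(frame2_gam Iu) minkC.
  by have [_ _ [_ [_ _ o2P] _] _ _] := fe_at FE (gam_in Iu).
- rewrite derive_sigma //.
  by have [_ [n1 _ _ _ _] _ _ _] := fe_at FE (gam_in Iu).
- exact: (null_direction_Phi sf1 sf2 span FE (gam_in Iu)).
Qed.

Lemma directrix_frenet : frenet_curvatures b1 I (Phi \o gam)
  (fun u => curvature h c (gam u)) (fun u => torsion h c (gam u)).
Proof.
have sE1 := fe_smooth1 FE.
have sN := smooth_frenet_normal oOm c_neq0 FE.
have sB := smooth_frenet_binormal oOm c_neq0 FE.
exists (fun u => E1 (gam u)), (frenet_normal f3 fV h c \o gam),
  (frenet_binormal f3 fV h c \o gam) => u Iu.
have Ou := gam_in Iu.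
have [d1 D1] := derive_u Iu sE1; have [d2 D2] := derive_u Iu sN.
have [d3 D3] := derive_u Iu sB.
have [_ [n1 _ _ _ nP] [ [ o12 _ _ o1P] [_ _ o2P] _] _ _] := fe_at FE Ou.
have [nN nB] := frenet_unit c_neq0 FE Ou.
have [ oTN oTB oNB] := frenet_orthogonal FE Ou.
have [ oNP oBP] := frenet_normal_space FE Ou (or_introl erefl).
have [ oN2 oB2] := frenet_normal_space FE Ou (or_intror erefl).
(* Along the directrix E2 equals [b1], so orthogonality to E2 gives the orthogonality to [b1]
   required of fields tangent to [H3 b1]. *)
have b1E (w : 'rV[R]_5) : mink w (E2 (gam u)) = 0 -> mink w b1 = 0.
  by move=> w0; apply: etrans (congr1 (mink w) (esym (frame2_gam Iu))) w0.
have o1b := b1E _ o12; have oNb := b1E _ oN2; have oBb := b1E _ oB2.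
have oPb : mink (Phi (gam u)) b1 = 0 by apply: b1E; rewrite minkC; exact: o2P.
split.
- exact/esym/derive_sigma.
- by split.
- by split.
- move=> V [->|[->|->]].
  + by split; [exact: o1P|exact: o1b|exact: d1].
  + by split; [exact: oNP|exact: oNb|exact: d2].
  + by split; [exact: oBP|exact: oBb|exact: d3].
split; first exact: (curvature_gt0 c_neq0 FE Ou).
- exact: (torsion_ge0 c_neq0 FE Ou).
(* The summand [Phi] of the flat derivative is normal to the hyperboloid and is removed by the
   projection. *)
- rewrite /cov_along /projH3 derive1E D1.
  rewrite (dv1_frenet_tangent c_neq0 FE Ou).
  move: oNP nP oNb oPb; rewrite /=.
  move: (frenet_normal _ _ _ _ _) (Phi _) (curvature _ _ _) b1 => N P k b oNP nP oNb oPb.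
  rewrite !minkDl !minkZl oNP nP oNb oPb.
  by rewrite !mulr0 !add0r scaleN1r scale0r subr0 addrK.
- rewrite /cov_along /projH3 derive1E D2.
  rewrite (dv1_frenet_normal oOm dd1 c_neq0 FE Ou).
  move: o1P oBP o1b oBb; rewrite /=.
  move: (frenet_binormal _ _ _ _ _) ('D_(_) Phi _) (curvature _ _ _) (torsion _ _ _) => B T k t.
  move: (Phi _) b1 => P b o1P oBP o1b oBb.
  rewrite !minkDl !minkZl o1P oBP o1b oBb.
  by rewrite !mulr0 addr0 !scale0r subr0 addr0.
- rewrite /cov_along /projH3 derive1E D3.
  rewrite (dv1_frenet_binormal oOm dd1 c_neq0 FE Ou).
  move: oNP oNb; rewrite /=.
  move: (frenet_normal _ _ _ _ _) (torsion _ _ _) (Phi _) b1 => N t P b oNP oNb.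
  rewrite !minkZl oNP oNb.
  by rewrite !mulr0 !scale0r subr0 addr0.
Qed.

End Parametrization.

Lemma frame_equations_subset (R : realType) (Om Om' : set 'rV[R]_2)
    (ds1 ds2 : ('rV[R]_2 -> R) -> 'rV[R]_2 -> R)
    (dv1 dv2 : ('rV[R]_2 -> 'rV[R]_5) -> 'rV[R]_2 -> 'rV[R]_5)
    (Phi f1 f2 f3 fV fW : 'rV[R]_2 -> 'rV[R]_5) (h : 'rV[R]_2 -> R) (c : R) :
  Om' `<=` Om -> frame_equations Om ds1 ds2 dv1 dv2 Phi f1 f2 f3 fV fW h c ->
  frame_equations Om' ds1 ds2 dv1 dv2 Phi f1 f2 f3 fV fW h c.
Proof.
move=> sub FE; split; try by move=> x /sub /(fe_at FE).
all: apply: (smooth_subset sub); by case: FE.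
Qed.

Section ProfileCoordinate.
Context {R : realType}.
Local Opaque derive.
Variables (Om : set 'rV[R]_2) (x0 : 'rV[R]_2).
Hypotheses (oOm : open Om) (Ox0 : Om x0).
Variables (c : R) (h : 'rV[R]_2 -> R) (f1 f2 : 'rV[R]_2 -> 'rV[R]_2).
Hypothesis sh : smooth Om h.
Hypothesis h_gt0 : forall x, Om x -> 0 < h x.
Hypothesis speed_gt0 : forall x, Om x -> 0 < speed c (h x).
Hypothesis h1 : forall x, Om x -> 'D_(f1 x) h x = 4 / 3 * h x * speed c (h x).
Hypothesis h2 : forall x, Om x -> 'D_(f2 x) h x = 0.

Lemma profile_coordinate : exists (r : R) (u : 'rV[R]_2 -> R),
  [/\ 0 < r, ball x0 r `<=` Om, smooth (ball x0 r) u,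
    (forall x, ball x0 r x -> 'D_(f1 x) u x = 1) &
    (forall x, ball x0 r x -> 'D_(f2 x) u x = 0)].
Proof.
pose pol (t : R) := 1 - 9 * t ^+ 2 - c ^+ 2 * t ^+ 3.
(* On this open set, which contains the values of [h], the reciprocal of (4/3) t s(t) is smooth. *)
pose D := [set t : R | 0 < t /\ 0 < pol t].
have sid A : open A -> smooth A (fun t : R => t) by exact: smooth_id.
have spol A : open A -> smooth A pol.
  move=> oA; apply: smoothB => //; last first.
    apply: smoothM => //; first exact: smooth_cst.
    by apply: (smoothX 3 oA); exact: sid.
  apply: smoothB => //; first exact: smooth_cst.
  apply: smoothM => //; first exact: smooth_cst.
  by apply: (smoothX 2 oA); exact: sid.
have oD : open D.
  have -> : D = [set t : R | 0 < t] `&` pol @^-1` [set t : R | 0 < t] by [].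
  apply: openI; first exact: open_gt.
  apply: open_comp; last exact: open_gt.
  by move=> t _; exact: smooth_continuous (spol setT openT) I.
have hD x : Om x -> D (h x).
  move=> Ox; split; first exact: h_gt0.
  by have := speed_gt0 Ox; rewrite /speed sqrtr_gt0.
pose g t := (4 / 3 * t * speed c t)^-1.
have sg : smooth D g.
  apply: smoothV => //.
    by move=> t [t0 p0]; rewrite gt_eqF // !mulr_gt0 ?invr_gt0 // sqrtr_gt0.
  apply: smoothM => //.
    by apply: smoothM => //; [exact: smooth_cst|exact: sid].
  by apply: smooth_sqrt => // [t []//|]; exact: spol.
have [G [d [d0 dD dG]]] := local_antiderivative oD (hD _ Ox0)
  (fun t Dt => smooth_continuous sg Dt).
have oB : open (ball (h x0) d) by exact: ball_open.
have sG : smooth (ball (h x0) d) G.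
  exact: smooth_antiderivative oB dG (smooth_subset dD sg).
have nO : nbhs x0 (Om `&` h @^-1` ball (h x0) d).
  apply: filterI; first exact: open_nbhs_nbhs.
  apply: (smooth_continuous sh Ox0); exact: nbhsx_ballx.
have [r /= r0 rO] := (iffLR (nbhs_ballP _ _) nO).
have rOm x : ball x0 r x -> Om x by move=> /rO[].
have rd x : ball x0 r x -> ball (h x0) d (h x) by move=> /rO[].
have Du v x : ball x0 r x -> 'D_v (G \o h) x =
    (4 / 3 * h x * speed c (h x))^-1 * 'D_v h x.
  move=> bx; apply: derive_real_comp; last exact/dG/rd.
  exact: smooth_differentiable sh (rOm _ bx).
exists r, (G \o h); split=> // [|x bx|x bx].
- apply: smooth_comp_real rd _ sG; first exact: ball_open.
  exact: smooth_subset rOm sh.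
- have Ox := rOm _ bx; rewrite (Du _ _ bx) h1 // mulVf // gt_eqF //.
  by rewrite !mulr_gt0 ?invr_gt0 ?h_gt0 ?speed_gt0.
- by rewrite (Du _ _ bx) h2 ?mulr0 //; exact: rOm.
Qed.

End ProfileCoordinate.

Section AdaptedCoordinates.
Context {R : realType}.
Local Opaque derive.
Variables (Om : set 'rV[R]_2) (x0 : 'rV[R]_2).
Hypotheses (oOm : open Om) (Ox0 : Om x0).
Variables (Phi : 'rV[R]_2 -> 'rV[R]_5) (h : 'rV[R]_2 -> R).
Variables (c : R) (f1 f2 : 'rV[R]_2 -> 'rV[R]_2).
Variables (f3 fV fW : 'rV[R]_2 -> 'rV[R]_5).
Hypotheses (c_neq0 : c != 0) (sPhi : smooth Om Phi) (sf1 : smooth Om f1)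
  (sf2 : smooth Om f2).
Hypothesis HPhi : forall x, Om x -> H4 (Phi x).
Hypothesis span : forall x v, Om x -> exists a b, v = a *: f1 x + b *: f2 x.
Local Notation E1 := (fun x => 'D_(f1 x) Phi x).
Local Notation E2 := (fun x => 'D_(f2 x) Phi x).
Hypothesis FE : frame_equations Om (fun g x => 'D_(f1 x) g x)
  (fun g x => 'D_(f2 x) g x) (fun F x => 'D_(f1 x) F x)
  (fun F x => 'D_(f2 x) F x) Phi E1 E2 f3 fV fW h c.

Theorem adapted_coordinates :
  exists (r rho u0 : R) (Psi inv : 'rV[R]_2 -> 'rV[R]_2) (b1 b2 : 'rV[R]_5),
    let I := `]u0 - rho, u0 + rho[%classic in
    let J := `](- rho), rho[%classic in
    let gam u := inv (pt u 0) in
    [/\ [/\ 0 < r, 0 < rho, ball x0 r `<=` Om, smooth (ball x0 r) Psi &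
          Psi x0 = pt u0 0],
        [/\ (forall y, ball (pt u0 0) rho y ->
               ball x0 r (inv y) /\ Psi (inv y) = y),
            (forall x, ball x0 r x -> ball (pt u0 0) rho (Psi x) ->
               inv (Psi x) = x) &
            smooth (ball (pt u0 0) rho) inv],
        [/\ (forall u v, I u -> J v -> h (inv (pt u v)) = h (gam u) /\
               Phi (inv (pt u v)) = Phi (gam u) + v *: b1 +
                 (v ^+ 2 * h (gam u) `^ (3 / 4)) *: b2) &
            (forall u, I u ->
               [/\ 0 < h (gam u), derivable (h \o gam) u 1,
                   derive1 (h \o gam) u =
                     4 / 3 * h (gam u) * speed c (h (gam u)) &
                   0 < derive1 (h \o gam) u])],
        [/\ mink b1 b1 = 1, mink b2 b2 = 0 & mink b1 b2 = 0] &
        [/\ smooth I (Phi \o gam),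
            (forall u, I u -> H3 b1 (Phi (gam u))),
            (forall u, I u ->
               mink (derive1 (Phi \o gam) u) (derive1 (Phi \o gam) u) = 1),
            frenet_curvatures b1 I (Phi \o gam)
              (fun u => curvature h c (gam u)) (fun u => torsion h c (gam u)) &
            (forall u, I u ->
               mink (Phi (gam u)) b2 = - (2 * h (gam u) `^ (3 / 4))^-1)]].
Proof.
have [r [u [r0 rOm su u1 u2]]] : exists (r : R) (u : 'rV[R]_2 -> R),
  [/\ 0 < r, ball x0 r `<=` Om, smooth (ball x0 r) u,
    (forall x, ball x0 r x -> 'D_(f1 x) u x = 1) &
    (forall x, ball x0 r x -> 'D_(f2 x) u x = 0)].
  apply: (profile_coordinate oOm Ox0 (c := c) (fe_smooth_h FE)) => x Ox.
  - by have [[]] := fe_at FE Ox.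
  - by have [[]] := fe_at FE Ox.
  - by have [_ _ _ _ []] := fe_at FE Ox.
  - by have [_ _ _ _ []] := fe_at FE Ox.
have FEr := frame_equations_subset rOm FE.
have [sP s1 s2] := And3 (smooth_subset rOm sPhi) (smooth_subset rOm sf1)
  (smooth_subset rOm sf2).
have spanr x v : ball x0 r x -> exists a b, v = a *: f1 x + b *: f2 x.
  by move=> /rOm; exact: span.
have oB : open (ball x0 r) by exact: ball_open.
pose vc := vcoord x0 Phi h f2.
have sv : smooth (ball x0 r) vc by exact: (smooth_vcoord FEr).
pose Psi x := pt (u x) (vc x).
have sPsi : smooth (ball x0 r) Psi.
  apply: (smooth_row (F := fun j x => nth 0 [:: u x; vc x] j)) oB _ => j.
  by move: j; apply: forall_I2.
(* The fields dual to du and dv: the defect E1 v = - s v is offset by adding s v E2, since E2 v = 1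
   and E2 u = 0. *)
pose K (i : 'I_2) x := if i == 0 then f1 x + (speed c (h x) * vc x) *: f2 x else f2 x.
have sK i : smooth (ball x0 r) (K i).
  move: i; apply: forall_I2; last exact: s2.
  apply: smoothD => //; apply: smoothZ => //; apply: smoothM => //.
  exact: fe_smooth_speed FEr.
have DPsi x w : ball x0 r x -> 'D_w Psi x = pt ('D_w u x) ('D_w vc x).
  move=> bx; have dPsi := smooth_differentiable sPsi bx.
  apply/rowP; apply: forall_I2; rewrite ?pt0 ?pt1 -derive_coord //.
    by congr ('D_w _ x); apply/funext => y; rewrite pt0.
  by congr ('D_w _ x); apply/funext => y; rewrite pt1.
have DK x i : ball x0 r x -> 'D_(K i x) Psi x = delta_mx 0 i.
  move=> bx; rewrite DPsi //.
  have du := smooth_differentiable su bx; have dv := smooth_differentiable sv bx.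
  have v1 := derive1_vcoord s1 FEr bx.
  have v2 := derive2_vcoord r0 s1 s2 spanr FEr bx.
  move: i; apply: forall_I2; rewrite /K /=.
    rewrite !derive_dirD // !derive_dirZ // v1 v2 u1 // u2 //.
    rewrite scaler0 addr0 [_ *: 1]mulr1 addNr.
    by apply/rowP; apply: forall_I2; rewrite ?pt0 ?pt1 !mxE.
  rewrite u2 // v2.
  by apply/rowP; apply: forall_I2; rewrite ?pt0 ?pt1 !mxE.
have [r1 [rho [inv [r10 rho0 r1r invE [invK sinv dinv]]]]] :=
  local_inverse oB sPsi sK DK (ballxx x0 r0).
have vc0 : vc x0 = 0 by exact: (vcoord_base r0 FEr).
have Psi0 : Psi x0 = pt (u x0) 0 by rewrite /Psi vc0.
rewrite Psi0 in invE invK sinv dinv.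
have inv_in y : ball (pt (u x0) 0) rho y -> ball x0 r (inv y).
  by move=> /invE[/r1r].
have inv_v y : ball (pt (u x0) 0) rho y -> vc (inv y) = y 0 1.
  by move=> /invE[_ {2}<-]; rewrite pt1.
have dinv' y w : ball (pt (u x0) 0) rho y -> 'D_w inv y =
  w 0 0 *: (f1 (inv y) + (speed c (h (inv y)) * vc (inv y)) *: f2 (inv y)) +
  w 0 1 *: f2 (inv y).
  by move=> Qy; rewrite dinv // sum2.
have HPr x : ball x0 r x -> H4 (Phi x) by move=> /rOm; exact: HPhi.
exists r1, rho, (u x0), Psi, inv, (spacelike_direction x0 Phi f2),
  (null_direction x0 h fW).
have [d1 d2 d3 d4] := directrix r0 sP s1 s2 HPr spanr FEr rho0 sinv inv_in inv_v dinv'.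
split.
- by split=> //; [move=> x /r1r/rOm|exact: smooth_subset sPsi].
- by [].
- split; first exact: (parametrization r0 sP s1 s2 spanr FEr rho0 sinv inv_in inv_v dinv').
  exact: (profile_derivative FEr rho0 sinv inv_in inv_v dinv').
- split; [exact: (spacelike_direction_unit r0 FEr)|
    exact: (null_direction_null r0 FEr)|exact: (null_direction_orth r0 FEr)].
split; [exact: d1|exact: d2|exact: d3| |exact: d4].
exact: (directrix_frenet r0 c_neq0 sP s1 s2 spanr FEr rho0 sinv inv_in inv_v dinv').
Qed.

End AdaptedCoordinates.

(** * Charts *)

Section Charts.
Context {R : realType} {M : topologicalType}.
Implicit Types (a b : chart R M) (A : set (chart R M)).

(** By continuity of the inverse chart, coordinates close to those of a point of [U] belong to
    points of [U]. *)
Lemma open_chart_image a (U : set M) : is_chart a -> open U ->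
  open (cmap a @` (dom a `&` U)).
Proof.
move=> [oa ca aK _ cinva] oU; rewrite openE => _ [q [aq Uq] <-].
have cq : coords a (cmap a q) by exists q.
have n1 : nbhs (cmap a q) (coords a) by exact: open_nbhs_nbhs.
have n2 : nbhs (cmap a q) (cinv a @^-1` U).
  by apply: (cinva _ cq); rewrite aK //; exact: open_nbhs_nbhs.
apply: filterS (filterI n1 n2) => _ [[q' aq' <-]].
by rewrite /= aK // => Uq'; exists q'.
Qed.

(** A chart composed with a local diffeomorphism: each transition map involving [b] is one involving
    [a], followed by [Psi] or preceded by [inv]. *)
Lemma smooth_chart_change A a (x0 y0 : 'rV[R]_2) (r rho : R)
    (Psi inv : 'rV[R]_2 -> 'rV[R]_2) :
  oriented_surface A -> A a -> ball x0 r `<=` coords a ->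
  smooth (ball x0 r) Psi -> smooth (ball y0 rho) inv ->
  0 < r -> 0 < rho ->
  (forall y, ball y0 rho y -> ball x0 r (inv y) /\ Psi (inv y) = y) ->
  (forall x, ball x0 r x -> ball y0 rho (Psi x) -> inv (Psi x) = x) ->
  let b := Chart [set q | [/\ dom a q, ball x0 r (cmap a q) &
                             ball y0 rho (Psi (cmap a q))]]
             (Psi \o cmap a) (cinv a \o inv) in
  smooth_chart A b /\ coords b = ball y0 rho.
Proof.
move=> [_ _ _ [charts _ trans]] Aa rco sPsi sinv r0 rho0 invE invK b.
have cha := charts _ Aa; have [oa oca aK ca cinva] := cha.
have ox : open (ball x0 r) by exact: ball_open.
have oy : open (ball y0 rho) by exact: ball_open.
have coordsE : coords b = ball y0 rho.
  apply/seteqP; split=> [_ [q [_ _ Pq] <-] //|y Qy].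
  have [by_ Py] := invE _ Qy; have [q aq qE] := rco _ by_.
  exists q; last by rewrite /= qE.
  by split; rewrite ?qE ?Py.
have cb q : dom b q -> {for q, continuous (cmap b)}.
  move=> [aq xq _]; apply: continuous_comp; first exact: ca.
  exact: smooth_continuous sPsi xq.
have chb : is_chart b.
  split=> [||q [aq xq yq]|//|y].
  - rewrite openE => q dq; have [aq xq yq] := dq.
    have n1 : nbhs q (dom a) by exact: open_nbhs_nbhs.
    have n2 : nbhs q (cmap a @^-1` ball x0 r).
      by apply: (ca _ aq); exact: open_nbhs_nbhs.
    have n3 : nbhs q (cmap b @^-1` ball y0 rho).
      by apply: (cb _ dq); exact: open_nbhs_nbhs.
    by apply: filterS (filterI n1 (filterI n2 n3)) => q' [? []].
  - by rewrite coordsE.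
  - by rewrite /= invK // aK.
  - rewrite coordsE => Qy; apply: continuous_comp.
      exact: smooth_continuous sinv Qy.
    by apply: cinva; apply: rco; case: (invE _ Qy).
split=> //; split=> // a' Aa'; have [sa'a _] := trans _ _ Aa' Aa.
have [saa' _] := trans _ _ Aa Aa'; have cha' := charts _ Aa'.
have [_ _ a'K _ _] := cha'; have [ob _ _ _ _] := chb; have [oa' _ _ _ _] := cha'.
split.
- have o1 : open (overlap a' b) by exact: open_chart_image.
  have s1 : smooth (overlap a' b) (transition a' a).
    apply: smooth_subset sa'a => _ [q [a'q [aq _ _]] <-].
    by exists q.
  have in_x z : overlap a' b z -> ball x0 r (transition a' a z).
    by move=> [q [a'q [aq xq _]] <-]; rewrite /transition /= a'K.
  exact: smooth_comp_row o1 in_x s1 sPsi.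
- have o1 : open (overlap b a') by exact: open_chart_image.
  have s1 : smooth (overlap b a') inv.
    by apply: smooth_subset sinv => _ [q [[aq xq yq] _] <-].
  have in_x z : overlap b a' z -> overlap a a' (inv z).
    by move=> [q [[aq xq yq] a'q] <-]; rewrite /= invK //; exists q.
  exact: smooth_comp_row o1 in_x s1 saa'.
Qed.

End Charts.

(** * The local parametrization around a given point *)

Theorem theorem2p6 (R : realType) (M : topologicalType)
    (A : set (chart R M)) (phi : M -> 'rV[R]_5) (f : M -> R) (c C : R)
    (hM : oriented_surface A)
    (hphi : immersion_H4 A phi)
    (hf : is_mean_curvature A phi f)
    (hbic : PNMC_biconservative A phi f)
    (hcC : attached_constants A phi f c C)
    (hC : C = 0) :
  forall p : M,
  exists (b : chart R M) (u1 u2 v1 v2 : R) (F : R -> R)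
         (sigma : R -> 'rV[R]_5) (b1 b2 : 'rV[R]_5),
    let I := `]u1, u2[%classic in
    let J := `]v1, v2[%classic in
    [/\ [/\ smooth_chart A b, dom b p,
            coords b = [set pt u v | u in I & v in J] &
            (forall u v, I u -> J v ->
               f (cinv b (pt u v)) = F u /\
               phi (cinv b (pt u v)) =
                 sigma u + v *: b1 + (v ^+ 2 * F u `^ (3 / 4)) *: b2)],
        c != 0 /\
        (forall u, I u ->
           [/\ 0 < F u, derivable F u 1,
               derive1 F u = 4 / 3 * F u *
                 Num.sqrt (1 - 9 * F u ^+ 2 - c ^+ 2 * F u ^+ 3) &
               0 < derive1 F u]),
        [/\ mink b1 b1 = 1, mink b2 b2 = 0 & mink b1 b2 = 0] &
        [/\ smooth I sigma,
            (forall u, I u -> H3 b1 (sigma u)),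
            (forall u, I u -> mink (derive1 sigma u) (derive1 sigma u) = 1),
            frenet_curvatures b1 I sigma
              (fun u => F u * Num.sqrt (1 + c ^+ 2 * F u))
              (fun u => 2 * `|c| * Num.sqrt (F u) / (3 * (1 + c ^+ 2 * F u)) *
                 Num.sqrt (1 - 9 * F u ^+ 2 - c ^+ 2 * F u ^+ 3)) &
            (forall u, I u -> mink (sigma u) b2 = - (2 * F u `^ (3 / 4))^-1)]].
Proof.
have [immH imm] := hphi; have [bic f_gt0 gradf par _] := hbic.
have [c0 hc] := hcC => p.
have [_ _ _ [charts cover _]] := hM; have [a Aa ap] := cover p.
have [oa oca aK ca cinva] := charts _ Aa; have [sPhi iPhi] := imm _ Aa.
pose Phi := phi \o cinv a; pose h := f \o cinv a; pose x0 := cmap a p.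
have cx0 : coords a x0 by exists p.
have HPhi x : coords a x -> H4 (Phi x) by move=> _; exact: immH.
have hcx x : coords a x ->
    'D_(frame1 Phi h x) h x = 4 / 3 * h x * speed c (h x) /\
    0 < 'D_(frame1 Phi h x) h x.
  move=> cx; have [_ [E pos]] := hc _ _ Aa cx; split; last exact: pos.
  (* With [C = 0] the term in [C] drops out and the radical is [speed c (h x)]. *)
  by apply: etrans E _; rewrite hC mulr0 mul0r addr0.
have [f1 [f2 [f3 [fV [fW [sf1 sf2 span FE]]]]]] :=
  surface_frame oca sPhi HPhi iPhi (fun x cx => hf _ _ Aa cx)
    (fun x _ => f_gt0 (cinv a x)) (fun x cx => gradf _ _ Aa cx)
    (fun x i cx => par _ _ i Aa cx) (fun x cx => bic _ _ Aa cx) c0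
    (fun x E2 E4 cx => proj1 (hc _ _ Aa cx) E2 E4)
    (fun x cx => proj1 (hcx x cx)) (fun x cx => proj2 (hcx x cx)).
have [r [rho [u0 [Psi [inv [b1 [b2 [[r0 rho0 rOm sPsi Psi0] [invE invK sinv]
    [par1 prof] bs [s1 s2 s3 s4 s5]]]]]]]]] :=
  adapted_coordinates oca cx0 c0 sPhi sf1 sf2 HPhi span FE.
have [chb cob] := smooth_chart_change hM Aa rOm sPsi sinv r0 rho0 invE invK.
(* The coordinate domain is the open square of half-width [rho] around (u0, 0), the coordinates of
   [p]. The interval for v thus contains 0, and the curve v = 0 serves as [sigma]. *)
exists (Chart [set q | [/\ dom a q, ball x0 r (cmap a q) &
                             ball (pt u0 0) rho (Psi (cmap a q))]]
             (Psi \o cmap a) (cinv a \o inv)), (u0 - rho), (u0 + rho), (- rho), rho,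
  (fun u => h (inv (pt u 0))), (fun u => Phi (inv (pt u 0))), b1, b2 => I J.
split; [split|by split|exact: bs|by split].
- exact: chb.
- split; [exact: ap|exact: ballxx|by rewrite -/x0 Psi0; exact: ballxx].
- rewrite cob; apply/seteqP; split=> [y Qy|_ [u Iu [v Jv <-]]].
    rewrite (pt_eta y) in Qy; have [Iu Jv] := (iffLR (ball_box _ _ _ rho0) Qy).
    by exists (y 0 0) => //; exists (y 0 1) => //; rewrite -pt_eta.
  by apply/ball_box.
- exact: par1.
Qed.
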